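(* There is a constant $C$ independent of the mesh size such that, for every $T\in\mathcal T_h$ and every $q\in Q_0(T)$, there exists $\boldsymbol v\in\boldsymbol V_0(T)$ such that $$(\nabla\cdot\boldsymbol v)(x)=\frac{h_T^2\,q(x)}{\det(DF_T(F_T^{-1}(x)))}\qquad\text{and}\qquad\|\boldsymbol v\|_{H^1(T)}\le C\|q\|_{L^2(T)}.$$
   Context: $\mathcal T_h$ is an isoparametric mesh obtained from a shape-regular affine triangulation $\tilde{\mathcal T}_h$ with mesh size $h$ sufficiently small: $\mathcal T_h=\{G_h(\tilde T):\tilde T\in\tilde{\mathcal T}_h\}$ with $G_h$ a continuous piecewise quadratic map. $\hat T$ is the reference triangle with vertices $(1,0),(0,1),(0,0)$. For $T=G_h(\tilde T)$, $h_T=\mathrm{diam}(\tilde T)$, and $F_T=G_h\circ F_{\tilde T}:\hat T\to T$ (with $F_{\tilde T}:\hat T\to\tilde T$ affine) is a quadratic diffeomorphism satisfying $|F_T|_{W^{m,\infty}(\hat T)}\le Ch_T^m$ ($0\le m\le2$), $|F_T^{-1}|_{W^{m,\infty}(T)}\le Ch_T^{-m}$ ($0\le m\le3$), $c_1h_T^2\le\det(DF_T)\le c_2h_T^2$, with constants independent of the mesh size. $\hat T^{ct}$ is the Clough–Tocher split of $\hat T$ into three triangles obtained by joining the vertices to the barycenter; $\hat{\boldsymbol V}=\{\hat{\boldsymbol v}\in [H^1(\hat T)]^2:\hat{\boldsymbol v}|_{\hat K}\in[\mathcal P_2(\hat K)]^2\ \forall\hat K\in\hat T^{ct}\}$, $\hat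 Q=\{\hat q\in L^2(\hat T):\hat q|_{\hat K}\in\mathcal P_1(\hat K)\ \forall\hat K\in\hat T^{ct}\}$ ($\mathcal P_k$: polynomials of degree $\le k$), $\hat Q_0=\hat Q\cap L^2_0(\hat T)$ ($L^2_0$: zero mean). With $A_T=DF_T/\det(DF_T)$ and $x=F_T(\hat x)$: $\boldsymbol V(T)=\{\boldsymbol v\in[H^1(T)]^2:\boldsymbol v(x)=A_T(\hat x)\hat{\boldsymbol v}(\hat x),\ \hat{\boldsymbol v}\in\hat{\boldsymbol V}\}$, $\boldsymbol V_0(T)=\boldsymbol V(T)\cap[H^1_0(T)]^2$, $Q_0(T)=\{q\in L^2(T):q(x)=\hat q(\hat x),\ \hat q\in\hat Q_0\}$. *)

(* Defs.v *)
From HB Require Import structures.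
From mathcomp Require Import all_boot all_order all_algebra.
From mathcomp Require Import all_classical all_reals all_analysis.

Set Implicit Arguments.
Unset Strict Implicit.
Unset Printing Implicit Defensive.

Import Order.TTheory GRing.Theory Num.Theory numFieldNormedType.Exports.

Local Open Scope classical_set_scope.
Local Open Scope ring_scope.

Section Plane.
Variable R : realType.

(* Points of the plane are pairs; vector fields take values in column vectors,
   so that matrices act on them by *m. *)
Definition pt : Type := (R * R)%type.

Definition mu := (@lebesgue_measure R \x @lebesgue_measure R)%E.

Definition pcoord (i : 'I_2) (x : pt) : R := if i == ord0 then x.1 else x.2.

Definition basis (i : 'I_2) : pt := if i == ord0 then (1, 0) else (0, 1).

Definition partial (i : 'I_2) (f : pt -> R) : pt -> R :=
  fun x => 'D_(basis i) f x.

Definition partials (s : seq 'I_2) (f : pt -> R) : pt -> R := foldr partial f s.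

(* C^oo on an open set U. *)
Definition smooth_on (U : set pt) (f : pt -> R) : Prop :=
  forall (s : seq 'I_2) (x : pt), U x ->
    {for x, continuous (partials s f)} /\
    forall i, derivable (partials s f) x (basis i).

(* Row i of the Jacobian matrix is the gradient of component i. *)
Definition Jac (F : pt -> pt) (x : pt) : 'M[R]_2 :=
  \matrix_(i, j) partial j (pcoord i \o F) x.

Definition poly_on (k : nat) (D : set pt) (f : pt -> R) : Prop :=
  exists c : nat -> nat -> R, forall x, D x ->
    f x = \sum_(i < k.+1) \sum_(j < k.+1 | (i + j <= k)%N)
            c i j * x.1 ^+ i * x.2 ^+ j.

Definition edist (x y : pt) : R :=
  Num.sqrt ((x.1 - y.1) ^+ 2 + (x.2 - y.2) ^+ 2).

Definition ediam (D : set pt) : R :=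
  sup [set r | exists x y, [/\ D x, D y & r = edist x y]].

(* Diameter of the largest disk contained in D. *)
Definition indiam (D : set pt) : R :=
  sup [set d | exists c r, [/\ 0 <= r, [set x | edist c x <= r] `<=` D
                             & d = r *+ 2]].

(* The seminorm |f|_{W^{m,oo}(D)} of a map f that is smooth on the interior of
   D: there its derivatives are continuous, so the essential supremum is a
   supremum. *)
Definition Wsemi (m : nat) (D : set pt) (f : pt -> pt) : \bar R :=
  ereal_sup [set y | exists (s : seq 'I_2) i x,
    [/\ size s = m, (D°) x & y = `|partials s (pcoord i \o f) x|%:E]].

(* In what follows L^2, H^1, H^1_0 of a closed set D (a triangle or the image
   of one, whose boundary is negligible) are those of the open set D°; elements
   are represented by functions on the plane, of which only the values almost
   everywhere on D matter. *)

Definition in_L2 (D : set pt) (f : pt -> R) : Prop :=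
  measurable_fun D f /\ mu.-integrable D (fun x => (f x ^+ 2)%:E).

Definition L2norm (D : set pt) (f : pt -> R) : R :=
  Num.sqrt (\int[mu]_(x in D) (f x ^+ 2)).

(* C_c^oo(D°) *)
Definition test_fun (D : set pt) (phi : pt -> R) : Prop :=
  smooth_on setT phi /\
  (let S := closure [set x | phi x != 0] in compact S /\ S `<=` D°).

(* u belongs to H^1 and g is its weak gradient. *)
Definition weak_grad (D : set pt) (u : pt -> R) (g : pt -> 'rV[R]_2) : Prop :=
  in_L2 D u /\
  forall j, in_L2 D (fun x => g x 0 j) /\
    forall phi, test_fun D phi ->
      \int[mu]_(x in D) (u x * partial j phi x) =
      - \int[mu]_(x in D) (g x 0 j * phi x).

Definition in_H1 (D : set pt) (u : pt -> R) : Prop :=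
  exists g, weak_grad D u g.

(* H^1 norm of u, given its weak gradient g. *)
Definition H1norm (D : set pt) (u : pt -> R) (g : pt -> 'rV[R]_2) : R :=
  Num.sqrt (L2norm D u ^+ 2 + \sum_(j < 2) L2norm D (fun x => g x 0 j) ^+ 2).

(* H^1_0: the closure of C_c^oo in H^1. *)
Definition in_H10 (D : set pt) (u : pt -> R) : Prop :=
  exists2 g, weak_grad D u g &
    forall eps : R, 0 < eps -> exists2 phi, test_fun D phi &
      H1norm D (fun x => u x - phi x)
               (fun x => g x - \row_j partial j phi x) < eps.

Definition vcomp (v : pt -> 'cV[R]_2) (i : 'I_2) : pt -> R := fun x => v x i 0.

(* Row i of Dv is the weak gradient of component i of v, so that the weak
   divergence of v is \tr Dv. *)
Definition weak_jac (D : set pt) (v : pt -> 'cV[R]_2) (Dv : pt -> 'M[R]_2) :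
  Prop := forall i, weak_grad D (vcomp v i) (fun x => row i (Dv x)).

Definition H1normv (D : set pt) (v : pt -> 'cV[R]_2) (Dv : pt -> 'M[R]_2) : R :=
  Num.sqrt (\sum_(i < 2) H1norm D (vcomp v i) (fun x => row i (Dv x)) ^+ 2).

(* A triangle is given by its labelled vertices. *)
Definition triangle : Type := 'I_3 -> pt.

Definition hull (K : triangle) : set pt :=
  [set x | exists l : 'I_3 -> R,
    [/\ forall i, 0 <= l i, \sum_i l i = 1 & x = \sum_i l i *: K i]].

Definition edge (a b : pt) : set pt :=
  [set x | exists t : R, [/\ 0 <= t, t <= 1 & x = (1 - t) *: a + t *: b]].

Definition bary (K : triangle) : pt := 3^-1 *: \sum_i K i.

(* The k-th triangle of the Clough-Tocher split of K. *)
Definition ct (K : triangle) (k : 'I_3) : triangle :=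
  fun j => if j == k then bary K else K j.

Definition ref_tri : triangle :=
  fun i => nth 0 [:: (1, 0); (0, 1); (0, 0)] i.

Definition That : set pt := hull ref_tri.

(* The affine map sending ref_tri to K, vertex by vertex. *)
Definition aff_map (K : triangle) (x : pt) : pt :=
  x.1 *: K (inord 0) + x.2 *: K (inord 1) + (1 - x.1 - x.2) *: K (inord 2).

(* Two distinct closed triangles are disjoint, or share exactly one common
   vertex, or exactly one common edge. *)
Definition conforming (K K' : triangle) : Prop :=
  [\/ hull K `&` hull K' = set0,
      exists i i', K i = K' i' /\ hull K `&` hull K' = [set K i]
    | exists i j i' j', [/\ i != j, K i = K' i', K j = K' j' &
                           hull K `&` hull K' = edge (K i) (K j)]].

Definition triangulation (M : set triangle) : Prop :=
  [/\ finite_set M,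
      forall K, M K -> (hull K)° !=set0 &
      forall K K', M K -> M K' -> K <> K' -> conforming K K'].

Definition shape_regular (sigma : R) (M : set triangle) : Prop :=
  forall K, M K -> ediam (hull K) <= sigma * indiam (hull K).

Definition mesh_size (M : set triangle) : R :=
  sup [set ediam (hull K) | K in M].

(* Diffeomorphism between closed domains.  That the interiors correspond is
   automatic (invariance of domain), and smoothness refers to the interiors. *)
Definition diffeo (D E : set pt) (F Finv : pt -> pt) : Prop :=
  [/\ set_bij D E F,
      forall x, D x -> Finv (F x) = x,
      F @` D° = E° &
      forall i, smooth_on D° (pcoord i \o F) /\ smooth_on E° (pcoord i \o Finv)].

Definition elt_map (G : pt -> pt) (K : triangle) : pt -> pt :=
  fun xh => G (aff_map K xh).

Section Element.
Variable F : pt -> pt.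

Definition elt : set pt := F @` That.

Definition elt_inv : pt -> pt := 'pinv_(fun=> 0) That F.

Definition piola (xh : pt) : 'M[R]_2 := (\det (Jac F xh))^-1 *: Jac F xh.

End Element.

(* Jac F is used on the interior of That only, so that the values of F outside
   of That are irrelevant. *)
Record regular_elt_map (C0 c1 c2 h : R) (F : pt -> pt) : Prop := {
  rem_diffeo : diffeo That (elt F) F (elt_inv F);
  rem_bound : forall m, (m <= 2)%N -> (Wsemi m That F <= (C0 * h ^+ m)%:E)%E;
  rem_bound_inv : forall m, (m <= 3)%N ->
    (Wsemi m (elt F) (elt_inv F) <= (C0 * h ^- m)%:E)%E;
  rem_det : forall x, (That°) x ->
    c1 * h ^+ 2 <= \det (Jac F x) /\ \det (Jac F x) <= c2 * h ^+ 2 }.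

(* The isoparametric mesh { G (hull K) : K in M }. *)
Record isoparametric_mesh (sigma C0 c1 c2 : R)
    (M : set triangle) (G : pt -> pt) : Prop := {
  im_triangulation : triangulation M;
  im_shape_regular : shape_regular sigma M;
  im_continuous : {within \bigcup_(K in M) hull K, continuous G};
  im_quadratic : forall K, M K -> forall i, poly_on 2 (hull K) (pcoord i \o G);
  im_regular : forall K, M K ->
    regular_elt_map C0 c1 c2 (ediam (hull K)) (elt_map G K) }.

(* The condition on each piece is imposed on its interior, the common edges of
   the split being negligible. *)
Definition Vhat (v : pt -> 'cV[R]_2) : Prop :=
  (forall i, in_H1 That (vcomp v i)) /\
  (forall k i, poly_on 2 (hull (ct ref_tri k))° (vcomp v i)).

Definition Qhat (q : pt -> R) : Prop :=
  in_L2 That q /\ forall k, poly_on 1 (hull (ct ref_tri k))° q.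

Definition Qhat0 (q : pt -> R) : Prop :=
  Qhat q /\ \int[mu]_(x in That) q x = 0.

Definition in_V (F : pt -> pt) (v : pt -> 'cV[R]_2) : Prop :=
  (forall i, in_H1 (elt F) (vcomp v i)) /\
  exists2 vh, Vhat vh &
    {ae mu, forall x, elt F x ->
       v x = piola F (elt_inv F x) *m vh (elt_inv F x)}.

Definition in_V0 (F : pt -> pt) (v : pt -> 'cV[R]_2) : Prop :=
  in_V F v /\ forall i, in_H10 (elt F) (vcomp v i).

Definition in_Q0 (F : pt -> pt) (q : pt -> R) : Prop :=
  in_L2 (elt F) q /\
  exists2 qh, Qhat0 qh &
    {ae mu, forall x, elt F x -> q x = qh (elt_inv F x)}.

End Plane.

(* Main.v *)
Require Import Defs.
From HB Require Import structures.
From mathcomp Require Import all_boot all_order all_algebra.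
From mathcomp Require Import all_classical all_reals all_analysis.
From mathcomp Require Import measurable_realfun ring lra.
Set Implicit Arguments.
Unset Strict Implicit.
Unset Printing Implicit Defensive.
Import Order.TTheory GRing.Theory Num.Theory numFieldNormedType.Exports.
Local Open Scope classical_set_scope.
Local Open Scope ring_scope.

(* On the reference triangle let m be the minimum of the three barycentric coordinates, so that m is the k-th
   coordinate on the k-th triangle of the split.  Fields m (p + m g), with p affine and g constant, lie in Vhat and
   vanish on the boundary; for a piecewise affine qh the equation div (m (p + m g)) = qh - kappa, with a constant
   kappa, has an explicit solution whose coefficients are bounded by those of qh, and kappa = 0 if qh has mean zero,
   because the divergence of the field has integral zero.  The Piola transform of h_T^2 times this field is v.

   Membership in H^1_0 and the formula for the weak gradient: replacing m by a smooth function m_e that is supported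
   in {m >= e} and equals m near any given point with pairwise distinct coordinates as soon as e is small, with
   gradients bounded uniformly in e, yields test functions to which dominated convergence applies.

   The coefficients of qh on a triangle of the split are controlled by its modulus on a small square, whose image
   under F_T contains a square of side comparable to h_T; hence h_T |coefficients| <= C |q|_{L^2(T)}. *)

(** * Differential calculus in the plane *)

(** No divergence theorem on triangles and no change of variables in integrals is used. An integral
    identity for the field is the limit of the same identity for test functions, where Fubini and
    the fundamental theorem of calculus suffice; the zero mean of the divergence is obtained in this
    way too. On T the norm of v is a supremum times the side of a square containing T, and the norm
    of q is bounded below on a square inside T.

    The ansatz is a square system: p has six coefficients, g two, and kappa makes nine, as many as
    the three affine pieces of qh.

    Scaling: the Piola field is of order h_T times the coefficients and its gradient of order one
    times the coefficients; the area contributes a factor h_T. The norm of v is thus of order h_T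
    |coefficients|, which matches the lower bound for q. The surplus powers of h_T, coming from the
    L^2 part and from the second derivatives of F_T, are absorbed by the bound [h0] on the mesh
    size.

    F_T is known on the closed triangle only. It is replaced by the quadratic map on the whole plane
    that agrees with it there, while its inverse is used on the image of the open triangle only. *)

Lemma is_derive_line (R : realType) (V : normedModType R) (f : V -> R) (x v : V) (s : R) :
  derivable f (x + s *: v) v ->
  is_derive s 1 (fun t : R => f (x + t *: v)) ('D_v f (x + s *: v)).
Proof.
move=> df.
have E : (fun h : R => h^-1 *: (f (x + (h *: 1 + s) *: v) - f (x + s *: v))) =
         (fun h : R => h^-1 *: (f (h *: v + (x + s *: v)) - f (x + s *: v))).
  apply/funext => h; congr (_ *: (f _ - _)).
  by rewrite [h *: 1]mulr1 scalerDl addrCA.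
split; first by rewrite /derivable /= E.
by rewrite /derive /= E.
Qed.

(** [MVT_segment] wants ordered end points, so the two signs of [t] are treated apart; increments of
    both signs occur in a total differential. *)
Lemma MVT_line (R : realType) (V : normedModType R) (f : V -> R) (x v : V) (t : R) :
  (forall s, `|s| <= `|t| -> derivable f (x + s *: v) v) ->
  exists2 s, `|s| <= `|t| & f (x + t *: v) - f x = t * 'D_v f (x + s *: v).
Proof.
move=> df; have [t0|t0] := leP 0 t.
  have [||s st e] := @MVT_segment R (fun t => f (x + t *: v))
      (fun s => 'D_v f (x + s *: v)) 0 t t0.
  - by move=> s; rewrite in_itv/= => /andP[s0 st]; apply/is_derive_line/df; rewrite !ger0_norm// ltW.
  - apply: derivable_within_continuous => s; rewrite in_itv/= => /andP[s0 st].
    apply: ex_derive; apply/is_derive_line/df; rewrite !ger0_norm//.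
  exists s; first by move: st; rewrite in_itv/= => /andP[s0 st]; rewrite !ger0_norm.
  by move: e; rewrite scale0r addr0 subr0 mulrC.
have [||s st e] := @MVT_segment R (fun t => f (x + t *: v))
      (fun s => 'D_v f (x + s *: v)) t 0 (ltW t0).
- by move=> s; rewrite in_itv/= => /andP[s0 st]; apply/is_derive_line/df; rewrite !ltr0_norm// lerN2 ltW.
- apply: derivable_within_continuous => s; rewrite in_itv/= => /andP[s0 st].
  apply: ex_derive; apply/is_derive_line/df; rewrite !ler0_norm// ?lerN2// ltW//.
exists s; first by move: st; rewrite in_itv/= => /andP[s0 st]; rewrite !ler0_norm ?lerN2// ltW.
by move: e; rewrite scale0r addr0 sub0r mulrN mulrC => /(congr1 -%R); rewrite opprB opprK.
Qed.

Lemma ler_norm_lin2 (R : realFieldType) (h1 h2 d1 d2 n d : R) :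
  `|h1| <= n -> `|h2| <= n -> `|d1| <= d / 2 -> `|d2| <= d / 2 ->
  `|h1 * d1 + h2 * d2| <= d * n.
Proof.
move=> h1n h2n d1e d2e; rewrite (le_trans (ler_normD _ _))// !normrM.
rewrite [X in _ <= X * _](splitr d) mulrDl.
by rewrite lerD// mulrC ler_pM.
Qed.

Section PlaneCalculus.
Variable R : realType.
Implicit Types (U : set (pt R)) (f g : pt R -> R) (x : pt R).


Lemma ord2P (P : 'I_2 -> Prop) : P ord0 -> P (lift ord0 ord0) -> forall i, P i.
Proof.
move=> P0 P1 i; have [->//|] := eqVneq i ord0.
move=> i0; suff -> : i = lift ord0 ord0 by [].
by apply: val_inj; move: i i0 => [[|[|]]].
Qed.

Lemma pt_eq (x y : pt R) : x.1 = y.1 -> x.2 = y.2 -> x = y.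
Proof. by case: x y => [a b] [c d] /= -> ->. Qed.

Lemma pt_normE x : `|x| = Num.max `|x.1| `|x.2|. Proof. by []. Qed.

(** The increment is split along two axis-parallel segments, first in direction 1 and then in
    direction 0, with the mean value theorem on each. Continuity of the partials at [x] alone makes
    the error o(|h|). *)
Lemma C1_differentiable U f x : open U -> U x ->
  (forall y i, U y -> derivable f y (Defs.basis R i)) ->
  (forall i, {for x, continuous (partial i f)}) ->
  differentiable f x /\
  forall v, 'd f x v = v.1 * partial ord0 f x + v.2 * partial (lift ord0 ord0) f x.
Proof.
move=> oU Ux df cf.
set a := partial ord0 f x; set b := partial (lift ord0 ord0) f x.
pose L (v : pt R) : R := v.1 * a + v.2 * b.
have Llin : linear L.
  move=> k u v; rewrite /L /=.
  have lin2 (u1 u2 v1 v2 : R) : (k * u1 + v1) * a + (k * u2 + v2) * b =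
      k * (u1 * a + u2 * b) + (v1 * a + v2 * b) by ring.
  exact: lin2.
pose LM := GRing.isLinear.Build _ _ _ _ _ Llin.
pose LL : {linear pt R -> R} := HB.pack L LM.
have cL : continuous LL.
  move=> y; apply: (@continuousD _ _ _ (fun v : pt R => v.1 * a) (fun v : pt R => v.2 * b)).
    by apply: continuousM; [exact: cvg_fst|exact: cvg_cst].
  by apply: continuousM; [exact: cvg_snd|exact: cvg_cst].
have E : f \o shift x = cst (f x) + LL +o_ (nbhs (0 : pt R)) id.
  apply/eqaddoP => /= e e0.
  have e20 : 0 < e / 2 by rewrite divr_gt0.
  have : \forall y \near x, U y /\ `|a - partial ord0 f y| < e / 2 /\ `|b - partial (lift ord0 ord0) f y| < e / 2.
    have /cvgrPdist_lt/(_ _ e20) n0 := cf ord0.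
    have /cvgrPdist_lt/(_ _ e20) n1 := cf (lift ord0 ord0).
    have nU : \forall y \near x, U y by exact: open_nbhs_nbhs.
    by apply: filterS3 nU n0 n1.
  move=> /nbhs_ballP[r /= r0 br].
  near=> h.
  have hr : `|h| < r.
    near: h; apply/nbhs_ballP; exists r => //= y; by rewrite -ball_normE /ball_/= sub0r normrN.
  have h1 : `|h.1| <= `|h| by rewrite pt_normE le_max lexx.
  have h2 : `|h.2| <= `|h| by rewrite pt_normE le_max lexx orbT.
  have inb (u : pt R) : `|u.1| <= `|h.1| -> `|u.2| <= `|h.2| -> ball x r (x + u).
    move=> u1 u2; rewrite -ball_normE /ball_/= opprD addrA subrr sub0r normrN.
    by rewrite pt_normE gt_max (le_lt_trans u1 (le_lt_trans h1 hr)) (le_lt_trans u2 (le_lt_trans h2 hr)).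
  have [|s1 s1h E1] := @MVT_line R _ f (x + (0, h.2)) (Defs.basis R ord0) h.1.
    move=> s sh; apply: df; apply: (br _ _).1; rewrite -addrA; apply: inb => /=.
      by rewrite add0r [s *: 1]mulr1.
    by rewrite [s *: 0]mulr0 addr0.
  have [|s2 s2h E2] := @MVT_line R _ f x (Defs.basis R (lift ord0 ord0)) h.2.
    move=> s sh; apply: df; apply: (br _ _).1; apply: inb => /=.
      by rewrite [s *: 0]mulr0 normr0.
    by rewrite [s *: 1]mulr1.
  have -> : (f \o shift x - (cst (f x) + LL)) h =
      h.1 * ('D_(Defs.basis R ord0) f (x + (0, h.2) + s1 *: Defs.basis R ord0) - a) +
      h.2 * ('D_(Defs.basis R (lift ord0 ord0)) f (x + s2 *: Defs.basis R (lift ord0 ord0)) - b).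
    rewrite !mulrBr -E1 -E2.
    have -> : x + (0, h.2) + h.1 *: Defs.basis R ord0 = h + x.
      rewrite -addrA addrC; congr (_ + _); apply: pt_eq => /=.
        by rewrite add0r [h.1 *: 1]mulr1.
      by rewrite [h.1 *: 0]mulr0 addr0.
    have -> : x + h.2 *: Defs.basis R (lift ord0 ord0) = x + (0, h.2).
      congr (_ + _); apply: pt_eq => /=.
        by rewrite [h.2 *: 0]mulr0.
      by rewrite [h.2 *: 1]mulr1.
    rewrite /= /L /shift /= !fctE /= /L.
    ring.
  have [_ [B1 _]] : U (x + (0, h.2) + s1 *: Defs.basis R ord0) /\
      `|a - partial ord0 f (x + (0, h.2) + s1 *: Defs.basis R ord0)| < e / 2 /\
      `|b - partial (lift ord0 ord0) f (x + (0, h.2) + s1 *: Defs.basis R ord0)| < e / 2.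
    apply: br; rewrite -addrA; apply: inb => /=.
      by rewrite add0r [s1 *: 1]mulr1.
    by rewrite [s1 *: 0]mulr0 addr0.
  have [_ [_ B2]] : U (x + s2 *: Defs.basis R (lift ord0 ord0)) /\
      `|a - partial ord0 f (x + s2 *: Defs.basis R (lift ord0 ord0))| < e / 2 /\
      `|b - partial (lift ord0 ord0) f (x + s2 *: Defs.basis R (lift ord0 ord0))| < e / 2.
    apply: br; apply: inb => /=.
      by rewrite [s2 *: 0]mulr0 normr0.
    by rewrite [s2 *: 1]mulr1.
  by apply: ler_norm_lin2 => //; rewrite distrC; apply: ltW; [exact: B1|exact: B2].
have D : 'd f x = LL :> (pt R -> R) by apply: diff_unique.
split; first by apply/diff_locallyP; rewrite D.
by move=> v; rewrite D.
Unshelve. all: by end_near. Qed.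

End PlaneCalculus.

Lemma continuous_pair (T U V : topologicalType) (f : T -> U) (g : T -> V) (x : T) :
  {for x, continuous f} -> {for x, continuous g} ->
  {for x, continuous (fun y => (f y, g y))}.
Proof.
move=> cf cg A /= nA.
by apply: (@cvg_pair _ _ _ (nbhs x) (nbhs (f x)) (nbhs (g x))) nA.
Qed.

(** For a function of one real variable derivability is differentiability. Restricting to a line
    therefore gives chain and pairing rules for directional derivatives without total
    differentiability of the inner functions. *)
Lemma derive_line0 (R : realType) (V W : normedModType R) (f : V -> W) (x v : V) :
  (derivable (fun t : R => f (x + t *: v)) 0 1 <-> derivable f x v) /\
  'D_1 (fun t : R => f (x + t *: v)) 0 = 'D_v f x.
Proof.
have E : (fun h : R => h^-1 *: (f (x + ((h *: (1 : R) + 0) : R) *: v) - f (x + 0 *: v))) =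
         (fun h : R => h^-1 *: (f (h *: v + x) - f x)).
  apply/funext => h; congr (_ *: (f _ - f _)); last by rewrite scale0r addr0.
  by rewrite [h *: 1]mulr1 addr0 addrC.
split; first by rewrite /derivable /= E.
by rewrite /derive /= E.
Qed.

Lemma is_derive_compd (R : realType) (V W X : normedModType R) (f : W -> X) (g : V -> W) (x v : V) :
  derivable g x v -> differentiable f (g x) ->
  is_derive x v (f \o g) ('d f (g x) ('D_v g x)).
Proof.
move=> dg df.
have [gl1 gl2] := derive_line0 g x v.
have [hl1 hl2] := derive_line0 (f \o g) x v.
set c := (fun t : R => g (x + t *: v)) in gl1 gl2 *.
have dc : differentiable c 0 by apply/derivable1_diffP; apply/gl1.
have c0 : c 0 = g x by rewrite /c scale0r addr0.
have dfc : differentiable f (c 0) by rewrite c0.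
have dfoc : differentiable (f \o c) 0 by exact: differentiable_comp.
split; first by apply/hl1; apply/derivable1_diffP.
rewrite -hl2 -/(f \o c) (deriveE _ dfoc) (diff_comp dc dfc) -gl2 (deriveE _ dc).
by rewrite /= c0.
Qed.

Lemma is_derive_pair (R : realType) (V W X : normedModType R) (f : V -> W) (g : V -> X) (x v : V) :
  derivable f x v -> derivable g x v ->
  is_derive x v (fun y => (f y, g y)) ('D_v f x, 'D_v g x).
Proof.
move=> df dg.
have [fl1 fl2] := derive_line0 f x v.
have [gl1 gl2] := derive_line0 g x v.
have [hl1 hl2] := derive_line0 (fun y => (f y, g y)) x v.
set a := (fun t : R => f (x + t *: v)) in fl1 fl2 *.
set b := (fun t : R => g (x + t *: v)) in gl1 gl2 *.
have da : differentiable a 0 by apply/derivable1_diffP; apply/fl1.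
have db : differentiable b 0 by apply/derivable1_diffP; apply/gl1.
have dc : differentiable (fun t => (a t, b t)) 0 by exact: differentiable_pair.
split; first by apply/hl1; apply/derivable1_diffP.
rewrite -hl2 -fl2 -gl2 (deriveE _ da) (deriveE _ db) (deriveE _ dc).
by rewrite (diff_pair da db).
Qed.

Lemma is_derive_comp1 (R : realType) (V : normedModType R) (h : R -> R) (h' : R) (f : V -> R) (x v : V) :
  is_derive (f x) 1 h h' -> derivable f x v ->
  is_derive x v (h \o f) (h' * 'D_v f x).
Proof.
move=> [dh hE] df.
have dh' : differentiable h (f x) := (derivable1_diffP h (f x)).1 dh.
have [d1 d2] := is_derive_compd df dh'.
split=> //; rewrite d2 -hE (deriveE _ dh').
by rewrite -{1}['D_v f x]mulr1 -[_ * 1]/(_ *: 1) linearZ [LHS]mulrC.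
Qed.

(** * Smooth functions, by order of differentiability *)

Section Smooth.
Variable R : realType.
Implicit Types (U V W : set (pt R)) (f g : pt R -> R) (x : pt R).

Local Notation o0 := (@ord0 1).
Local Notation o1 := (lift (@ord0 1) (@ord0 0)).
Local Notation e_ := (@Defs.basis R).

Lemma is_derive_comp2 U f (P : pt R -> pt R) x v : open U -> U (P x) ->
  (forall y i, U y -> derivable f y (e_ i)) ->
  (forall i, {for P x, continuous (partial i f)}) ->
  (forall i, derivable (pcoord i \o P) x v) ->
  is_derive x v (f \o P)
    ('D_v (pcoord o0 \o P) x * partial o0 f (P x) + 'D_v (pcoord o1 \o P) x * partial o1 f (P x)).
Proof.
move=> oU UPx df cf dP.
have [dfP dfPE] := C1_differentiable oU UPx df cf.
have [dQ dQE] := is_derive_pair (dP o0) (dP o1).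
have PE : P = (fun y => ((pcoord o0 \o P) y, (pcoord o1 \o P) y)).
  by apply/funext => y; apply: pt_eq.
rewrite PE in dfP.
have [d1 d2] := is_derive_compd dQ dfP.
split; rewrite {1}PE; first exact: d1.
rewrite d2 dQE; have -> : (fun y : pt R => ((pcoord o0 \o P) y, (pcoord o1 \o P) y)) x = P x by apply: pt_eq.
exact: dfPE.
Qed.

(** The finite-order form of [smooth_on], made for induction on the order. It peels off the
    innermost derivative, whereas [partials] peels off the outermost one; [partials_rcons]
    reconciles the two. *)
Fixpoint smoothn n U f : Prop :=
  (forall x, U x -> {for x, continuous f} /\ forall i, derivable f x (e_ i)) /\
  (if n is n'.+1 then forall i, smoothn n' U (partial i f) else True).

Lemma smoothn_base n U f x : smoothn n U f -> U x ->
  {for x, continuous f} /\ forall i, derivable f x (e_ i).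
Proof. by case: n => [|n] [+ _] => /[apply]. Qed.

Lemma partials_rcons s i f : partials (rcons s i) f = partials s (partial i f).
Proof. by rewrite /partials foldr_rcons. Qed.

Lemma smooth_onP U f : smooth_on U f <-> forall n, smoothn n U f.
Proof.
split=> [sf n|sf].
  elim: n f sf => [|n IH] f sf; split=> //; try by move=> x /(sf [::]).
  by move=> i; apply: IH => s x Ux; rewrite -partials_rcons; exact: sf.
move=> s; elim/last_ind: s f sf => [|s i IH] f sf x Ux; first exact: smoothn_base (sf 0%N) Ux.
rewrite partials_rcons; apply: IH => // n; exact: (sf n.+1).2.
Qed.

Lemma smoothn_le n U f : smoothn n.+1 U f -> smoothn n U f.
Proof.
elim: n f => [|n IH] f; first by case.
by case=> b s; split=> // i; apply: IH; exact: s.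
Qed.

Lemma near_eq_partial f g x i : (\near x, f x = g x) -> partial i f x = partial i g x.
Proof. by move=> fg; apply: near_eq_derive. Qed.

(** The local representative may change from point to point. This is what makes functions glued from
    a formula on an open set and zero elsewhere smooth. *)
Lemma smoothn_local n U f :
  (forall x, U x -> exists V g, [/\ open V, V x, smoothn n V g & forall y, V y -> f y = g y]) ->
  smoothn n U f.
Proof.
have base U' f' : (forall x, U' x -> exists V g, [/\ open V, V x, smoothn 0 V g & forall y, V y -> f' y = g y]) ->
    forall x, U' x -> {for x, continuous f'} /\ forall i, derivable f' x (e_ i).
  move=> loc x /loc [V [g [oV Vx sg fg]]].
  have fgn : \near x, f' x = g x by apply: filterS fg _; exact: open_nbhs_nbhs.
  have [c d] := smoothn_base sg Vx; split.
    change (f' @ x --> f' x); rewrite (fg _ Vx); apply: cvg_trans c; apply: near_eq_cvg.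
    by apply: filterS fgn => y ->.
  by move=> i; apply: near_eq_derivable (d i); apply: filterS fgn => y ->.
elim: n U f => [|n IH] U f loc; split=> //; first exact: base.
  apply: base => x /loc [V [g [oV Vx sg fg]]]; exists V, g; split=> //.
  by split=> // y Vy; exact: smoothn_base sg Vy.
move=> i; apply: IH => x /loc [V [g [oV Vx sg fg]]].
exists V, (partial i g); split=> //; first exact: sg.2.
move=> y Vy; apply: near_eq_partial.
by apply: filterS fg _; exact: open_nbhs_nbhs.
Qed.

Lemma smoothn_ext n U f g : open U -> (forall y, U y -> f y = g y) ->
  smoothn n U g -> smoothn n U f.
Proof. by move=> oU fg sg; apply: smoothn_local => x Ux; exists U, g. Qed.

Lemma smoothn_cst n U (c : R) : smoothn n U (cst c).
Proof.
elim: n c => [|n IH] c; split=> //; try by (move=> x _; split; [exact: cvg_cst|move=> i; exact: derivable_cst]).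
move=> i; suff -> : partial i (cst c) = cst 0 by exact: IH.
by apply/funext => x; rewrite /partial derive_cst.
Qed.

Lemma is_derive_affine (a b s : R) : is_derive s 1 (fun t : R => a + t * b) b.
Proof.
apply: is_derive_eq.
by rewrite add0r scaler0 add0r [_%:A]mulr1 mul1r.
Qed.

Lemma is_derive_coord i x (v : pt R) : is_derive x v (@pcoord R i) (pcoord i v).
Proof.
have [l1 l2] := derive_line0 (@pcoord R i) x v.
have E : (fun t : R => pcoord i (x + t *: v)) = (fun t : R => pcoord i x + t * pcoord i v).
  by apply/funext => t; rewrite /pcoord; case: ifP.
rewrite {}E in l1 l2; have [d1 d2] := is_derive_affine (pcoord i x) (pcoord i v) 0.
by apply: DeriveDef; [exact: (l1.1 d1)|rewrite -l2].
Qed.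

Lemma pcoord_continuous i : continuous (@pcoord R i).
Proof.
move=> x; rewrite /pcoord; case: (i == ord0); [exact: cvg_fst|exact: cvg_snd].
Qed.

Lemma partial_coord i j x : partial j (@pcoord R i) x = (i == j)%:R.
Proof.
rewrite /partial (@derive_val _ _ _ _ _ _ _ (is_derive_coord i x (e_ j))).
by move: i j; apply: ord2P; apply: ord2P.
Qed.

Lemma smoothn_coord n U i : smoothn n U (@pcoord R i).
Proof.
have b x : U x -> {for x, continuous (@pcoord R i)} /\ forall j, derivable (@pcoord R i) x (e_ j).
  move=> _; split; first exact: pcoord_continuous.
  by move=> j; apply: ex_derive; exact: is_derive_coord.
case: n => [|n]; split=> // j.
suff -> : partial j (@pcoord R i) = cst (i == j)%:R by exact: smoothn_cst.
by apply/funext => x; rewrite partial_coord.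
Qed.

Lemma smoothnD n U f g : open U -> smoothn n U f -> smoothn n U g ->
  smoothn n U (fun x => f x + g x).
Proof.
move=> oU; elim: n f g => [|n IH] f g sf sg; split=> //.
- move=> x Ux; have [cf df] := smoothn_base sf Ux; have [cg dg] := smoothn_base sg Ux.
  by split=> [|i]; [exact: continuousD|exact: derivableD].
- move=> x Ux; have [cf df] := smoothn_base sf Ux; have [cg dg] := smoothn_base sg Ux.
  by split=> [|i]; [exact: continuousD|exact: derivableD].
move=> i; apply: (smoothn_ext oU) (IH _ _ (sf.2 i) (sg.2 i)) => x Ux.
have [_ df] := smoothn_base sf Ux; have [_ dg] := smoothn_base sg Ux.
exact: deriveD.
Qed.

Lemma smoothnM n U f g : open U -> smoothn n U f -> smoothn n U g ->
  smoothn n U (fun x => f x * g x).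
Proof.
move=> oU; elim: n f g => [|n IH] f g sf sg; split=> //.
- move=> x Ux; have [cf df] := smoothn_base sf Ux; have [cg dg] := smoothn_base sg Ux.
  by split=> [|i]; [exact: continuousM|exact: derivableM].
- move=> x Ux; have [cf df] := smoothn_base sf Ux; have [cg dg] := smoothn_base sg Ux.
  by split=> [|i]; [exact: continuousM|exact: derivableM].
move=> i; have sf' := smoothn_le sf; have sg' := smoothn_le sg.
apply: (smoothn_ext oU) (smoothnD oU (IH _ _ sf' (sg.2 i)) (IH _ _ sg' (sf.2 i))) => x Ux.
have [_ df] := smoothn_base sf Ux; have [_ dg] := smoothn_base sg Ux.
exact: deriveM.
Qed.

(** The outer function is taken from a family [H] closed under differentiation, so that the
    induction never needs a formula for its higher derivatives. *)
Lemma smoothn_comp1 (H : set (R -> R)) (W1 : set R) n U f :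
  (forall h, H h -> exists2 h', H h' & forall s, W1 s -> is_derive s 1 h (h' s)) ->
  open U -> (forall x, U x -> W1 (f x)) -> smoothn n U f ->
  forall h, H h -> smoothn n U (fun x => h (f x)).
Proof.
move=> HH oU UW; elim: n f UW => [|n IH] f UW sf h Hh; have [h' Hh' dh] := HH h Hh; split=> //.
- move=> x Ux; have [cf df] := smoothn_base sf Ux; split.
    apply: continuous_comp => //; apply: differentiable_continuous; apply/derivable1_diffP.
    exact: (@ex_derive _ _ _ _ _ _ _ (dh _ (UW _ Ux))).
  by move=> i; apply: ex_derive; exact: is_derive_comp1 (dh _ (UW _ Ux)) (df i).
- move=> x Ux; have [cf df] := smoothn_base sf Ux; split.
    apply: continuous_comp => //; apply: differentiable_continuous; apply/derivable1_diffP.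
    exact: (@ex_derive _ _ _ _ _ _ _ (dh _ (UW _ Ux))).
  by move=> i; apply: ex_derive; exact: is_derive_comp1 (dh _ (UW _ Ux)) (df i).
move=> i; have sf' := smoothn_le sf.
apply: (smoothn_ext oU) (smoothnM oU (IH f UW sf' h' Hh') (sf.2 i)) => x Ux.
have [_ df] := smoothn_base sf Ux.
exact: (@derive_val _ _ _ _ _ _ _ (is_derive_comp1 (dh _ (UW _ Ux)) (df i))).
Qed.

(** One order more is asked of [f] because the chain rule at each stage needs its partials to be
    continuous, which order zero does not give. *)
Lemma smoothn_comp n U W f (P : pt R -> pt R) : open U -> open W ->
  (forall x, U x -> W (P x)) ->
  smoothn n.+1 W f -> (forall i, smoothn n U (pcoord i \o P)) -> smoothn n U (f \o P).
Proof.
move=> oU oW UW; elim: n f => [|n IH] f sf sP.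
  split=> // x Ux; have UPx := UW _ Ux.
  have [cf _] := smoothn_base sf UPx.
  have cP i := (smoothn_base (sP i) Ux).1; have dP i := (smoothn_base (sP i) Ux).2.
  have cPx : {for x, continuous P}.
    suff -> : P = (fun y => ((pcoord o0 \o P) y, (pcoord o1 \o P) y)).
      exact: continuous_pair.
    by apply/funext => y; apply: pt_eq.
  split; first exact: continuous_comp.
  move=> j; apply: ex_derive; apply: (@is_derive_comp2 W) => //.
    by move=> y i Wy; exact: (smoothn_base sf Wy).2.
  by move=> i; have s1 : smoothn 0 W (partial i f) := sf.2 i; exact: (smoothn_base s1 UPx).1.
have IHf := IH _ (smoothn_le sf) (fun i => smoothn_le (sP i)).
split; first by move=> x Ux; exact: smoothn_base IHf Ux.
move=> j.
have S1 i : smoothn n U (fun x => partial j (pcoord i \o P) x * (partial i f \o P) x).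
  apply: smoothnM => //; first exact: (sP i).2.
  by apply: IH; [exact: sf.2|move=> k; exact: smoothn_le].
apply: (smoothn_ext oU) (smoothnD oU (S1 o0) (S1 o1)) => x Ux.
have UPx := UW _ Ux.
apply: (@derive_val _ _ _ _ _ _ _ (@is_derive_comp2 W f P x (e_ j) oW UPx _ _ _)).
- by move=> y i Wy; exact: (smoothn_base sf Wy).2.
- by move=> i; have s1 : smoothn n.+1 W (partial i f) := sf.2 i; exact: (smoothn_base s1 UPx).1.
- by move=> i; exact: (smoothn_base (sP i) Ux).2.
Qed.

End Smooth.

(** * A smoothed minimum *)

Section FlatExp.
Variable R : realType.
Implicit Types (P : {poly R}) (s t : R).

(** The flat function exp(-1/s) with a polynomial in 1/s in front: the derivative of P(1/s)
    exp(-1/s) has the same shape, with X^2 (P - P') in place of P. *)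
Definition flat_exp P s : R := if 0 < s then P.[s^-1] * expR (- s^-1) else 0.

Lemma horner_bound P : exists2 K : R, 0 < K & forall u, 1 <= u -> `|P.[u]| <= K * u ^+ size P.
Proof.
exists (1 + \sum_(i < size P) `|P`_i|).
  by rewrite ltr_pwDl// sumr_ge0.
move=> u u1; have u0 : 0 <= u by rewrite (le_trans _ u1).
rewrite horner_coef (le_trans (ler_norm_sum _ _ _))//.
apply: (@le_trans _ _ ((\sum_(i < size P) `|P`_i|) * u ^+ size P)).
  rewrite mulr_suml; apply: ler_sum => i _.
  rewrite normrM normrX (ger0_norm u0) ler_wpM2l//.
  by apply: ler_weXn2l => //; exact: ltnW.
by rewrite ler_wpM2r ?exprn_ge0// lerDr.
Qed.

(** With u = 1/t, exp(-u) is at most n! / u^n for n two larger than [size P], while P(u) is at most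
    a multiple of u^(size P). The two spare powers leave t^2, which forces derivative zero at the
    origin. *)
Lemma flat_exp_bound P : exists2 K : R, 0 < K & forall t, `|t| <= 1 -> `|flat_exp P t| <= K * t ^+ 2.
Proof.
have [K K0 KP] := horner_bound P.
exists (K * ((size P).+2)`!%:R); first by rewrite mulr_gt0// ltr0n fact_gt0.
move=> t t1; rewrite /flat_exp; case: ifPn => t0; last first.
  by rewrite normr0 mulr_ge0 ?sqr_ge0// mulr_ge0// ltW.
set u := t^-1; have u0 : 0 < u by rewrite invr_gt0.
have u1 : 1 <= u by rewrite invf_ge1// -(gtr0_norm t0).
rewrite normrM (gtr0_norm (expR_gt0 _)).
apply: (@le_trans _ _ (K * u ^+ size P * ((size P).+2`!%:R * u ^- (size P).+2))).
  apply: ler_pM; [exact: normr_ge0|exact: expR_ge0|exact: KP|].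
  rewrite expRN -[X in _ <= X]invrK lef_pV2 ?posrE ?expR_gt0//; last first.
    by rewrite invr_gt0 mulr_gt0 ?ltr0n ?fact_gt0// invr_gt0 exprn_gt0.
  rewrite invfM invrK mulrC.
  apply: le_trans (expR_ge1Dxn (size P).+1 (ltW u0)).
  by rewrite lerDr.
rewrite le_eqVlt; apply/orP; left; apply/eqP.
have -> : t ^+ 2 = u ^- 2 by rewrite exprVn invrK.
rewrite [u ^+ (size P).+2](_ : _ = u ^+ size P * u ^+ 2); last by rewrite -exprD addn2.
have un : u ^+ size P != 0 by rewrite expf_neq0// gt_eqF.
have u2 : u ^+ 2 != 0 by rewrite expf_neq0// gt_eqF.
move: (u ^+ size P) (u ^+ 2) un u2 => a b a0 b0.
by field; rewrite a0 b0.
Qed.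

Lemma is_derive_flat_exp P s :
  is_derive s 1 (flat_exp P) (flat_exp ('X^2 * (P - P^`())) s).
Proof.
have [s0|s0|->] := ltgtP s 0.
- rewrite [X in is_derive _ _ _ X]/flat_exp ltNge (ltW s0)/=.
  apply: (@near_eq_is_derive _ _ _ (cst (0 : R))).
  near=> t; rewrite /flat_exp ifF//; apply/negbTE; rewrite -leNgt ltW//.
  by near: t; exact: lt_nbhsl.
- rewrite [X in is_derive _ _ _ X]/flat_exp s0.
  apply: (@near_eq_is_derive _ _ _ (fun t : R => P.[t^-1] * expR (- t^-1))).
    by near=> t; rewrite /flat_exp ifT//; near: t; apply: lt_nbhsr.
  have sn0 : s != 0 by rewrite gt_eqF.
  have dV : is_derive s 1 (fun t : R => t^-1) (- s ^- 2).
    apply: is_derive_eq; first exact: is_deriveV.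
    by rewrite [_ *: _]mulr1.
  have dP : is_derive s 1 (fun t : R => P.[t^-1]) (P^`().[s^-1] * (- s ^- 2)).
    rewrite -[X in _ * X](@derive_val _ _ _ _ _ _ _ dV).
    exact: (@is_derive_comp1 _ _ (horner P) _ (fun t : R => t^-1)).
  have dE : is_derive s 1 (fun t : R => expR (- t^-1)) (expR (- s^-1) * s ^- 2).
    have dN : is_derive s 1 (fun t : R => - t^-1) (s ^- 2).
      by rewrite -[s ^- 2]opprK; exact: is_deriveN.
    rewrite -[X in _ * X](@derive_val _ _ _ _ _ _ _ dN).
    exact: (@is_derive_comp1 _ _ expR _ (fun t : R => - t^-1)).
  have dM := @is_deriveM _ _ _ _ _ _ _ _ dP dE.
  apply: (@is_derive_eq _ _ _ _ _ _ _ _ dM).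
  rewrite /= !hornerE -!exprVn.
  have alg (a b c d : R) : a * (c * d ^+ 2) + c * (b * - d ^+ 2) = d ^+ 2 * (a - b) * c by ring.
  exact: alg.
have [K K0 KP] := flat_exp_bound P.
have -> : flat_exp ('X^2 * (P - P^`())) 0 = 0 by rewrite /flat_exp ltxx.
have f0 : flat_exp P 0 = 0 by rewrite /flat_exp ltxx.
(* By the quadratic bound the difference quotient at 0 is at most K |h|, so one limit yields both
   derivability and the value. *)
suff cv : h^-1 *: (flat_exp P (h *: (1 : R) + 0) - flat_exp P 0) @[h --> (0:R)^'] --> (0 : R).
  apply: DeriveDef; last exact: cvg_lim.
  by apply/cvg_ex; exists 0.
apply/cvgr0Pnorm_le => e e0.
have hsmall d : 0 < d -> \forall h \near (0:R)^', `|h| <= d.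
  move=> d0; apply: nbhs_dnbhs; apply/nbhs_ballP; exists d => //= y.
  by rewrite -ball_normE/= sub0r normrN => /ltW.
have eK : 0 < e / K by rewrite divr_gt0.
near=> h.
have h0 : h != 0 by near: h; exact: nbhs_dnbhs_neq.
have h1 : `|h| <= 1 by near: h; exact: hsmall.
have he : `|h| <= e / K by near: h; exact: hsmall.
rewrite f0 subr0 addr0 [h *: 1]mulr1 [_ *: _]/(_ * _) normrM normfV.
rewrite ler_pdivrMl ?normr_gt0//.
apply: (le_trans (KP h h1)).
by rewrite -(@real_normK _ h) ?num_real// expr2 mulrA mulrC ler_wpM2l// mulrC -ler_pdivlMr.
Unshelve. all: by end_near. Qed.

Lemma flat_exp_gt0 s : 0 < s -> 0 < flat_exp 1 s.
Proof. by move=> s0; rewrite /flat_exp s0 hornerE mul1r expR_gt0. Qed.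

Lemma flat_exp_ge0 s : 0 <= flat_exp 1 s.
Proof. by rewrite /flat_exp; case: ifP => // _; rewrite hornerE mul1r expR_ge0. Qed.

Lemma flat_exp_le0 P s : s <= 0 -> flat_exp P s = 0.
Proof. by rewrite /flat_exp leNgt => /negbTE ->. Qed.

Lemma smoothn_flat_exp n U f P : open U -> smoothn n U f ->
  smoothn n U (fun x => flat_exp P (f x)).
Proof.
move=> oU sf.
apply: (@smoothn_comp1 _ [set h | exists P, h = flat_exp P] setT) sf _ _ => //; last by exists P.
move=> _ [Q ->]; exists (flat_exp ('X^2 * (Q - Q^`()))); first by eexists.
by move=> s _; exact: is_derive_flat_exp.
Qed.

Lemma smoothnV n U (f : pt R -> R) : open U -> (forall x, U x -> f x != 0) -> smoothn n U f ->
  smoothn n U (fun x => (f x)^-1).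
Proof.
move=> oU f0 sf.
(* The functions c s^(-k) form a family closed under differentiation away from 0. *)
apply: (@smoothn_comp1 _ [set h | exists c k, h = fun s : R => c * (s^-1) ^+ k] [set s | s != 0]) sf (fun s => s^-1) _ => //; last first.
  by exists 1, 1%N; apply/funext => s; rewrite mul1r expr1.
move=> _ [c [k ->]]; exists (fun s : R => (- k%:R * c) * (s^-1) ^+ k.+1); first by eexists; eexists.
move=> s /= s0.
have dV : is_derive s 1 (fun t : R => t^-1) (- s ^- 2).
  apply: is_derive_eq; first exact: is_deriveV.
  by rewrite [_ *: _]mulr1.
have dX : is_derive (s^-1) 1 (fun u : R => c * u ^+ k) (c * (k%:R * (s^-1) ^+ k.-1)).
  have d1 : is_derive (s^-1) (1 : R) (horner (c *: 'X^k)) (c *: 'X^k)^`().[s^-1].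
    exact: is_derive_poly.
  have -> : (fun u : R => c * u ^+ k) = horner (c *: 'X^k) by apply/funext => u; rewrite !hornerE.
  apply: is_derive_eq.
  by rewrite derivZ derivXn hornerZ hornerMn hornerXn mulr_natl.
apply: (@is_derive_eq _ _ _ _ _ _ _ _ (is_derive_comp1 dX (@ex_derive _ _ _ _ _ _ _ dV))).
rewrite (@derive_val _ _ _ _ _ _ _ dV).
case: (k) => [|m]; first by rewrite !(mul0r, mulr0, oppr0).
by rewrite -exprVn /= !exprS expr0; ring.
Qed.

End FlatExp.

Section Theta.
Variable R : realType.
Implicit Types (s t : R).

(* A smooth step from 0 on s <= 1 to 1 on s >= 2. *)
Definition smooth_step s : R :=
  flat_exp 1 (s - 1) * (flat_exp 1 (s - 1) + flat_exp 1 (2 - s))^-1.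

(** Flat near 0, the identity for large s, with bounded derivative; the rescaling s -> e Theta(s /
    e) keeps the derivative bound whatever e is. *)
Definition Theta s : R := s * smooth_step s.

Lemma smooth_step_den s : 0 < flat_exp 1 (s - 1) + flat_exp 1 (2 - s).
Proof.
have [s1|s1] := leP s 1.
  by rewrite ltr_wpDl ?flat_exp_ge0// flat_exp_gt0//; lra.
by rewrite ltr_pwDl ?flat_exp_ge0// flat_exp_gt0//; lra.
Qed.

Lemma smooth_step_ge0 s : 0 <= smooth_step s.
Proof. by rewrite mulr_ge0 ?flat_exp_ge0// invr_ge0 ltW// smooth_step_den. Qed.

Lemma smooth_step_le1 s : smooth_step s <= 1.
Proof. by rewrite ler_pdivrMr ?smooth_step_den// mul1r lerDl flat_exp_ge0. Qed.

Lemma Theta_le1 s : s <= 1 -> Theta s = 0.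
Proof. by move=> s1; rewrite /Theta /smooth_step flat_exp_le0 ?subr_le0// mul0r mulr0. Qed.

Lemma Theta_ge2 s : 2 <= s -> Theta s = s.
Proof.
move=> s2; rewrite /Theta /smooth_step [flat_exp 1 (2 - s)]flat_exp_le0 ?subr_le0//.
by rewrite addr0 mulfV ?mulr1// gt_eqF// flat_exp_gt0//; lra.
Qed.

Lemma Theta_ge0 s : 0 <= Theta s.
Proof.
have [/Theta_le1 ->//|s1] := leP s 1.
by rewrite mulr_ge0 ?smooth_step_ge0//; lra.
Qed.

Lemma Theta_ge s : s - 2 <= Theta s.
Proof.
have [s2|/ltW/Theta_ge2 ->] := leP s 2; last by lra.
by rewrite (le_trans _ (Theta_ge0 s))//; lra.
Qed.

Lemma Theta_norm s : `|Theta s| <= `|s|.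
Proof.
rewrite normrM ler_piMr// ger0_norm ?smooth_step_ge0//; exact: smooth_step_le1.
Qed.

Lemma smoothn_Theta n U (f : pt R -> R) : open U -> smoothn n U f ->
  smoothn n U (fun x => Theta (f x)).
Proof.
move=> oU sf; apply: smoothnM => //.
have s1 : smoothn n U (fun x => flat_exp 1 (f x - 1)).
  by apply: smoothn_flat_exp => //; apply: smoothnD => //; exact: smoothn_cst.
have s2 : smoothn n U (fun x => flat_exp 1 (2 - f x)).
  apply: smoothn_flat_exp => //; apply: (@smoothn_ext _ _ _ _ (fun x => 2 + -1 * f x)) => //.
    by move=> y _; rewrite mulN1r.
  by apply: smoothnD => //; [|apply: smoothnM => //]; exact: smoothn_cst.
apply: smoothnM => //; apply: smoothnV => //; last exact: smoothnD.
by move=> x _; rewrite gt_eqF// smooth_step_den.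
Qed.

(** Smoothness has been set up for functions on the plane, so [Theta] is viewed as a function of the
    first coordinate. Its derivative is continuous, hence bounded on [0, 3]; below 1 it is 0 and
    above 2 it is 1. *)
Lemma Theta_deriv : exists2 L : R, 0 < L & forall s, exists2 d : R, `|d| <= L & is_derive s 1 Theta d.
Proof.
pose f : pt R -> R := fun x => Theta (pcoord ord0 x).
have sf n : smoothn n setT f by apply: smoothn_Theta; [exact: openT|exact: smoothn_coord].
have dT s : is_derive s 1 Theta (partial ord0 f (s, 0)).
  have [_ /(_ ord0) df] := smoothn_base (sf 0%N) (I : setT (s, 0 : R)).
  have dl := @is_derive_line R _ f (0, 0) (1, 0) s.
  have E : (0, 0) + s *: (1, 0) = (s, 0) :> pt R.
    by apply: pt_eq => /=; rewrite add0r ?[_ *: 1]mulr1// [_ *: 0]mulr0.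
  rewrite E in dl; move: (dl df).
  rewrite (_ : (fun t : R => f ((0, 0) + t *: (1, 0))) = Theta)//.
  by apply/funext => t; rewrite /f /pcoord /= add0r [_ *: 1]mulr1.
have cd : continuous (fun s : R => partial ord0 f (s, 0)).
  move=> s; apply: (@continuous_comp _ _ _ (fun s : R => (s, 0 : R)) (partial ord0 f)).
    by apply: continuous_pair; [exact: cvg_id|exact: cvg_cst].
  have s1 : smoothn 0 setT (partial ord0 f) := (sf 1%N).2 ord0.
  exact: (smoothn_base s1 I).1.
have cN : {within `[0, 3], continuous (fun s : R => `|partial ord0 f (s, 0)|)}.
  by apply: continuous_subspaceT => s; apply: cvg_norm; exact: cd.
have [c _ cmax] := EVT_max (ler0n R 3) cN.
exists (1 + `|partial ord0 f (c, 0)|); first by rewrite ltr_pwDl.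
move=> s; have [s1|s1] := ltP s 1.
  exists 0; first by rewrite normr0 addr_ge0.
  apply: (@near_eq_is_derive _ _ _ (cst (0 : R))).
  by near=> t; rewrite Theta_le1// ltW//; near: t; exact: lt_nbhsl.
have [s2|s2] := leP s 2.
  exists (partial ord0 f (s, 0)) => //.
  rewrite (le_trans (cmax s _)) ?lerDr// in_itv/=; lra.
exists 1; first by rewrite normr1 lerDl.
apply: (@near_eq_is_derive _ _ _ (@idfun R)).
by near=> t; rewrite Theta_ge2// ltW//; near: t; exact: lt_nbhsr.
Unshelve. all: by end_near. Qed.

End Theta.

Section SmoothMin.
Variable R : realType.
Implicit Types (e t a b c : R).

(* shrink e t is 0 for t <= e and t for t >= 2 e, so smin e a b = min a b if a <= b or b + 2 e <= a; the outer
   shrink in smin3 makes it vanish unless a, b, c >= e. *)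
Definition shrink e t : R := e * Theta (t / e).
Definition smin e a b : R := a - shrink e (a - b).
Definition smin3 e a b c : R := shrink (3 * e) (smin e (smin e a b) c).

Lemma shrink_ge0 e t : 0 < e -> 0 <= shrink e t.
Proof. by move=> e0; rewrite mulr_ge0 ?Theta_ge0// ltW. Qed.

Lemma shrink_le e t : 0 < e -> t <= e -> shrink e t = 0.
Proof. by move=> e0 te; rewrite /shrink Theta_le1 ?mulr0// ler_pdivrMr// mul1r. Qed.

Lemma shrink_ge e t : 0 < e -> 2 * e <= t -> shrink e t = t.
Proof.
move=> e0 te; rewrite /shrink Theta_ge2 ?ler_pdivlMr//.
by rewrite mulrC divfK// gt_eqF.
Qed.

Lemma shrink_lb e t : 0 < e -> t - 2 * e <= shrink e t.
Proof.
move=> e0; rewrite /shrink [e * _]mulrC -ler_pdivrMr// mulrBl mulfK ?gt_eqF//.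
exact: Theta_ge.
Qed.

Lemma shrink_norm e t : 0 < e -> `|shrink e t| <= `|t|.
Proof.
move=> e0; rewrite /shrink normrM (gtr0_norm e0) mulrC -ler_pdivlMr//.
by rewrite (le_trans (Theta_norm _))// normrM normfV (gtr0_norm e0).
Qed.

Lemma smin_lel e a b : 0 < e -> smin e a b <= a.
Proof. by move=> e0; rewrite /smin gerBl shrink_ge0. Qed.

Lemma smin_ler e a b : 0 < e -> smin e a b <= b + 2 * e.
Proof. by move=> e0; rewrite /smin; have := shrink_lb (a - b) e0; lra. Qed.

Lemma smin_norm e a b : 0 < e -> `|smin e a b| <= `|a| + (`|a| + `|b|).
Proof.
move=> e0; rewrite (le_trans (ler_normB _ _))// lerD2l.
by rewrite (le_trans (shrink_norm _ e0))// ler_normB.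
Qed.

(** [smin] never exceeds its first argument but may exceed the second by [2 * e]. The outer
    threshold [3 * e] pays for this overshoot and leaves [e]. *)
Lemma smin3_supp e a b c : 0 < e -> smin3 e a b c != 0 -> [/\ e <= a, e <= b & e <= c].
Proof.
move=> e0; have e3 : 0 < 3 * e by lra.
have [h|h] := leP (smin e (smin e a b) c) (3 * e).
  by rewrite /smin3 shrink_le ?eqxx.
move=> _; have h1 := smin_ler (smin e a b) c e0; have h2 := smin_lel (smin e a b) c e0.
have h3 := smin_lel a b e0; have h4 := smin_ler a b e0.
by split; lra.
Qed.

(** By [smin_norm], the inner [smin] is at most 1 + (1 + 1) = 3 and the outer one at most 3 + (3 +
    1) = 7, independently of [e]. *)
Lemma smin3_norm e a b c : 0 < e -> `|a| <= 1 -> `|b| <= 1 -> `|c| <= 1 ->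
  `|smin3 e a b c| <= 7.
Proof.
move=> e0 a1 b1 c1; have e3 : 0 < 3 * e by lra.
rewrite (le_trans (shrink_norm _ e3))//.
have h1 := smin_norm (smin e a b) c e0; have h2 := smin_norm a b e0.
lra.
Qed.

Lemma sminE e a b : 0 < e -> 2 * e <= `|a - b| -> smin e a b = Num.min a b.
Proof.
move=> e0; rewrite /smin; have [ab|ab] := ltP a b => h.
  by rewrite shrink_le ?subr0//; lra.
rewrite shrink_ge//; [by lra|].
by move: h; rewrite ger0_norm//; lra.
Qed.

(** The bound [6 * e] is twice the outer threshold [3 * e], beyond which that [shrink] is the
    identity. *)
Lemma smin3E e a b c : 0 < e -> 6 * e <= a -> 6 * e <= b -> 6 * e <= c ->
  2 * e <= `|a - b| -> 2 * e <= `|a - c| -> 2 * e <= `|b - c| ->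
  smin3 e a b c = Num.min (Num.min a b) c.
Proof.
move=> e0 ea eb ec ab ac bc; have e3 : 0 < 3 * e by lra.
rewrite /smin3 (sminE e0 ab) sminE//; last by rewrite minElt; case: ifP.
rewrite shrink_ge//.
by rewrite !le_min; apply/andP; split; [apply/andP; split|]; lra.
Qed.

Section SmoothMinFun.
Variables (V : normedModType R) (L : R).
Hypothesis L0 : 0 < L.
Hypothesis LT : forall s : R, exists2 d : R, `|d| <= L & is_derive s 1 (@Theta R) d.

Lemma is_derive_shrink e (s : R) : 0 < e -> exists2 d : R, `|d| <= L & is_derive s 1 (shrink e) d.
Proof.
move=> e0; have [d dL dT] := LT (s / e); exists d => //.
have d1 : is_derive s 1 (fun t : R => 0 + t * e^-1) e^-1 := is_derive_affine _ _ _.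
have E : 0 + s * e^-1 = s / e by rewrite add0r.
rewrite -E in dT.
have d2 := @is_derive_comp1 R _ (@Theta R) d (fun t : R => 0 + t * e^-1) s 1 dT (@ex_derive _ _ _ _ _ _ _ d1).
rewrite (@derive_val _ _ _ _ _ _ _ d1) in d2.
have d3 := @is_deriveZ _ _ _ _ e _ _ _ d2.
rewrite (_ : shrink e = e *: (@Theta R \o (fun t : R => 0 + t * e^-1))); last first.
  apply/funext => t; rewrite /shrink.
  by transitivity (e * Theta (0 + t / e)); first by rewrite add0r.
apply: (@is_derive_eq _ _ _ _ _ _ _ _ d3).
by rewrite [_ *: _]mulrCA mulfV ?mulr1// gt_eqF.
Qed.

Lemma derive_shrink e (f : V -> R) x v (B : R) : 0 < e ->
  derivable f x v -> `|'D_v f x| <= B ->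
  derivable (fun y => shrink e (f y)) x v /\ `|'D_v (fun y => shrink e (f y)) x| <= L * B.
Proof.
move=> e0 df dB; have [d dL dS] := is_derive_shrink (f x) e0.
have [h1 h2] := is_derive_comp1 dS df.
by split=> //; rewrite [X in `|X|]h2 normrM ler_pM.
Qed.

Lemma derive_smin e (f g : V -> R) x v (A B : R) : 0 < e ->
  derivable f x v -> derivable g x v -> `|'D_v f x| <= A -> `|'D_v g x| <= B ->
  derivable (fun y => smin e (f y) (g y)) x v /\
  `|'D_v (fun y => smin e (f y) (g y)) x| <= A + L * (A + B).
Proof.
move=> e0 df dg dA dB.
have [h1 h2] : derivable (fun y => shrink e (f y - g y)) x v /\
    `|'D_v (fun y => shrink e (f y - g y)) x| <= L * (A + B).
  apply: derive_shrink => //; first exact: derivableB.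
  have -> : 'D_v (fun y => f y - g y) x = 'D_v f x - 'D_v g x by exact: deriveB.
  by rewrite (le_trans (ler_normB _ _))// lerD.
split; first exact: derivableB.
have -> : 'D_v (fun y => smin e (f y) (g y)) x = 'D_v f x - 'D_v (fun y => shrink e (f y - g y)) x.
  exact: deriveB.
by rewrite (le_trans (ler_normB _ _))// lerD.
Qed.

(** Starting from [B], one [smin] gives (1 + 2 L) B, the second (1 + 4 L + 2 L^2) B, and the outer
    [shrink] one more factor L. The parameter [e] has dropped out, which is the uniformity that
    dominated convergence needs. *)
Lemma derive_smin3 e (f g h : V -> R) x v (B : R) : 0 < e ->
  derivable f x v -> derivable g x v -> derivable h x v ->
  `|'D_v f x| <= B -> `|'D_v g x| <= B -> `|'D_v h x| <= B ->
  derivable (fun y => smin3 e (f y) (g y) (h y)) x v /\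
  `|'D_v (fun y => smin3 e (f y) (g y) (h y)) x| <= L * (1 + 4 * L + 2 * L ^+ 2) * B.
Proof.
move=> e0 df dg dh fB gB hB; have e3 : 0 < 3 * e by lra.
have [h1 h2] := derive_smin e0 df dg fB gB.
have [h3 h4] := derive_smin e0 h1 dh h2 hB.
have [h5 h6] := derive_shrink e3 h3 h4.
split=> //; apply: (le_trans h6); rewrite le_eqVlt; apply/orP; left; apply/eqP; ring.
Qed.

End SmoothMinFun.

Lemma smoothn_shrink n U e (f : pt R -> R) : open U -> smoothn n U f ->
  smoothn n U (fun x => shrink e (f x)).
Proof.
move=> oU sf; apply: smoothnM => //; first exact: smoothn_cst.
by apply: smoothn_Theta => //; apply: smoothnM => //; exact: smoothn_cst.
Qed.

Lemma smoothnB n U (f g : pt R -> R) : open U -> smoothn n U f -> smoothn n U g ->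
  smoothn n U (fun x => f x - g x).
Proof.
move=> oU sf sg; apply: (@smoothn_ext _ _ _ _ (fun x => f x + -1 * g x)) => //.
  by move=> y _; rewrite mulN1r.
by apply: smoothnD => //; apply: smoothnM => //; exact: smoothn_cst.
Qed.

Lemma smoothn_smin n U e (f g : pt R -> R) : open U -> smoothn n U f -> smoothn n U g ->
  smoothn n U (fun x => smin e (f x) (g x)).
Proof.
move=> oU sf sg; apply: smoothnB => //; apply: smoothn_shrink => //; exact: smoothnB.
Qed.

Lemma smoothn_smin3 n U e (f g h : pt R -> R) : open U ->
  smoothn n U f -> smoothn n U g -> smoothn n U h ->
  smoothn n U (fun x => smin3 e (f x) (g x) (h x)).
Proof.
move=> oU sf sg sh; apply: smoothn_shrink => //.
by apply: smoothn_smin => //; exact: smoothn_smin.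
Qed.

End SmoothMin.

(** * Test functions and weak gradients *)

Section PlaneMeasure.
Variable R : realType.
Implicit Types (A D U : set (pt R)).

Lemma ball_ptE (x : pt R) (r : R) :
  ball x r = [set y : R | `|x.1 - y| < r] `*` [set y : R | `|x.2 - y| < r].
Proof. by []. Qed.

Lemma open_abs_lt (a r : R) : open [set y : R | `|a - y| < r].
Proof.
have -> : [set y : R | `|a - y| < r] = ball a r by rewrite -ball_normE.
exact: ball_open.
Qed.

Lemma measurable_ball_pt (x : pt R) (r : R) : measurable (ball x r : set (R * R)).
Proof.
by rewrite ball_ptE; apply: measurableX; apply: open_measurable; exact: open_abs_lt.
Qed.

Lemma rat_near (a r : R) : 0 < r -> exists q : rat, `|a - ratr q| < r.
Proof.
move=> r0; have [|q] := @rat_in_itvoo R (a - r) (a + r); first lra.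
by rewrite in_itv/= => /andP[q1 q2]; exists q; rewrite ltr_norml; apply/andP; split; lra.
Qed.

(** Measurability is that of the product sigma-algebra, generated by rectangles; an open set is the
    union of the countably many rational squares it contains. *)
Lemma open_measurable_pt A : open A -> measurable (A : set (R * R)).
Proof.
move=> oA.
pose c (q : rat * rat * rat) : pt R := (ratr q.1.1, ratr q.1.2).
pose F (q : rat * rat * rat) : set (R * R) := if `[< ball (c q) (ratr q.2) `<=` A >] then ball (c q) (ratr q.2) else set0.
have -> : A = \bigcup_q F q.
  apply/seteqP; split => [x Ax|x [q _]]; last first.
    by rewrite /F; case: asboolP => // qA; exact: qA.
  have /nbhs_ballP[e /= e0 eA] : nbhs x A by exact: open_nbhs_nbhs.
  have [|r] := @rat_in_itvoo R 0 (e / 2); first lra.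
  rewrite in_itv/= => /andP[r0 re].
  have [q1 q1x] := rat_near x.1 r0; have [q2 q2x] := rat_near x.2 r0.
  exists (q1, q2, r) => //; rewrite /F; case: asboolP => [_|[]].
    by rewrite ball_ptE; split; rewrite /= distrC.
  move=> y; rewrite ball_ptE => -[/= y1 y2]; apply: eA; rewrite ball_ptE; split => /=.
    by rewrite (le_lt_trans (ler_distD (ratr q1) _ _))//; lra.
  by rewrite (le_lt_trans (ler_distD (ratr q2) _ _))//; lra.
apply: countable_bigcupT_measurable; first exact: countableP.
move=> q; rewrite /F; case: asboolP => _ //; exact: measurable_ball_pt.
Qed.

Lemma closed_measurable_pt A : closed A -> measurable (A : set (R * R)).
Proof. by move=> /closed_openC/open_measurable_pt/measurableC; rewrite setCK. Qed.

Lemma compact_measurable_pt A : compact A -> measurable (A : set (R * R)).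
Proof. by move=> cA; apply: closed_measurable_pt; apply: compact_closed => //; exact: norm_hausdorff. Qed.

Lemma open_continuous_measurable_pt U (f : pt R -> R) : open U ->
  (forall x, U x -> {for x, continuous f}) -> measurable_fun (U : set (R * R)) f.
Proof.
move=> oU cf; apply: (measurability _ (RGenOpens.measurableE R)).
move=> _ [_ [a [b ->] <-]]; apply: open_measurable_pt.
rewrite openE => x [Ux fx]; rewrite /interior.
apply: filterI; first exact: open_nbhs_nbhs.
by apply: (cf x Ux); apply: open_nbhs_nbhs; split=> //; exact: interval_open.
Qed.

Lemma mu_box (a b c d : R) : a <= b -> c <= d ->
  @mu R (`[a, b] `*` `[c, d]) = ((b - a) * (d - c))%:E.
Proof.
have L (u v : R) : u <= v -> @lebesgue_measure R `[u, v]%classic = (v - u)%:E.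
  move=> uv; rewrite lebesgue_measure_itv/= lte_fin; case: ltgtP uv => // -> _.
  by rewrite subrr.
move=> ab cd; rewrite EFinM -(L _ _ ab) -(L _ _ cd) /mu.
by apply: product_measure1E; exact: measurable_itv.
Qed.

End PlaneMeasure.

Section TestFunctions.
Variable R : realType.
Local Notation o0 := (@ord0 1).
Local Notation o1 := (lift (@ord0 1) (@ord0 0)).
Local Notation e_ := (@Defs.basis R).
Local Notation mu := (@mu R).
Implicit Types (D U : set (pt R)) (phi psi f : pt R -> R).

Lemma integral_derive_compact (g g' : R -> R) (L : R) : 0 < L ->
  (forall t : R, is_derive t 1 g (g' t)) -> continuous g' ->
  (forall t : R, L <= `|t| -> g t = 0 /\ g' t = 0) ->
  (\int[@lebesgue_measure R]_t (g' t)%:E = 0)%E.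
Proof.
move=> L0 dg cg' g0.
pose I := `[- L, L]%classic.
have -> : (\int[@lebesgue_measure R]_t (g' t)%:E = \int[@lebesgue_measure R]_(t in I) (g' t)%:E)%E.
  rewrite [RHS]integral_mkcond; apply: eq_integral => t _; rewrite /patch.
  case: ifPn => //; rewrite notin_setE /I /= in_itv/= => /negP; rewrite -ler_norml -ltNge => /ltW /g0[_ ->].
  by [].
have cg t : {for t, continuous g}.
  by apply/differentiable_continuous; apply/derivable1_diffP; exact: ex_derive.
rewrite (@continuous_FTC2 _ g' g)//.
- rewrite (g0 L _).1 ?(g0 (- L) _).1 ?subee//; by rewrite ?normrN (gtr0_norm L0).
- by rewrite gtrN.
- exact: continuous_subspaceT.
- split; first by move=> t _; exact: ex_derive.
    by apply: cvg_at_right_filter; exact: cg.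
  by apply: cvg_at_left_filter; exact: cg.
- by move=> t _; rewrite derive1E derive_val.
Qed.

Lemma bounded_integrable D f (B : R) : measurable (D : set (R * R)) -> (mu D < +oo)%E ->
  measurable_fun (D : set (R * R)) f -> (forall x, D x -> `|f x| <= B) ->
  mu.-integrable D (EFin \o f).
Proof.
move=> mD fD mf fB; apply: measurable_bounded_integrable => //.
exists B; split; first exact: num_real.
by move=> M BM x Dx; rewrite /= (le_trans (fB x Dx))// ltW.
Qed.

Lemma supp_partial phi x j : ~ closure [set y | phi y != 0] x ->
  phi x = 0 /\ partial j phi x = 0.
Proof.
move=> Sx.
have near0 : \near x, phi x = cst 0 x.
  have : nbhs x (~` closure [set y | phi y != 0]).
    by apply: open_nbhs_nbhs; split=> //; apply: closed_openC; exact: closed_closure.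
  apply: filterS => y Sy; apply/eqP; apply: contrapT => /negP y0; apply: Sy.
  exact: subset_closure.
split; first exact: (nbhs_singleton near0).
by rewrite (near_eq_partial j near0) /partial derive_cst.
Qed.

Lemma compact_box (S : set (pt R)) : compact S ->
  exists2 L : R, 0 < L & forall x, S x -> `|x.1| < L /\ `|x.2| < L.
Proof.
move=> /compact_bounded[M [Mr MS]].
exists (`|M| + 2); first by rewrite ltr_wpDl.
move=> x Sx; have xM : `|x| <= `|M| + 1.
  by apply: MS => //; rewrite (le_lt_trans (ler_norm M))// ltrDl.
split; apply: le_lt_trans (_ : _ <= `|M| + 1) _; rewrite ?ltrD2l ?ltr1n//.
  by apply: le_trans xM; rewrite pt_normE le_max lexx.
by apply: le_trans xM; rewrite pt_normE le_max lexx orbT.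
Qed.

Lemma test_fun_smooth D phi n : test_fun D phi -> smoothn n setT phi.
Proof. by case=> /smooth_onP. Qed.

Lemma test_fun_cont D phi : test_fun D phi ->
  continuous phi /\ forall j, continuous (partial j phi).
Proof.
move=> tp; have s1 := test_fun_smooth 1 tp.
split=> [x|j x]; first exact: (smoothn_base s1 I).1.
by have s2 : smoothn 0 setT (partial j phi) := s1.2 j; exact: (smoothn_base s2 I).1.
Qed.

Lemma compact_cont_bounded (S : set (pt R)) f : compact S -> continuous f ->
  exists2 B : R, 0 <= B & forall x, S x -> `|f x| <= B.
Proof.
move=> cS cf.
have /compact_bounded[M [Mr MS]] : compact (f @` S).
  by apply: continuous_compact => //; exact: continuous_subspaceT.
exists (`|M| + 1); first by rewrite addr_ge0.
move=> x Sx; apply: MS; last by exists x.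
by rewrite (le_lt_trans (ler_norm M))// ltrDl.
Qed.

Lemma test_fun_bounded D phi : test_fun D phi -> exists2 B : R, 0 <= B &
  forall x, `|phi x| <= B /\ forall j, `|partial j phi x| <= B.
Proof.
move=> tp; have [cp cdp] := test_fun_cont tp; case: tp => _ [cS _].
have [B B0 BS] := compact_cont_bounded cS cp.
have [B1 B10 BS1] := compact_cont_bounded cS (cdp o0).
have [B2 B20 BS2] := compact_cont_bounded cS (cdp o1).
exists (B + B1 + B2); first by rewrite !addr_ge0.
move=> x; have [Sx|Sx] := pselect (closure [set y | phi y != 0] x).
  split; first by rewrite (le_trans (BS _ Sx))// -addrA lerDl addr_ge0.
  apply: ord2P; first by rewrite (le_trans (BS1 _ Sx))// addrAC lerDr addr_ge0.
  by rewrite (le_trans (BS2 _ Sx))// lerDr addr_ge0.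
split; first by rewrite (supp_partial o0 Sx).1 normr0 !addr_ge0.
by move=> j; rewrite (supp_partial j Sx).2 normr0 !addr_ge0.
Qed.

(** Fubini with the inner integral in direction [j]: on each line the integrand is the derivative of
    a function that vanishes outside a bounded interval. *)
Lemma integral_partial D phi j : test_fun D phi ->
  (\int[mu]_x (partial j phi x)%:E = 0)%E.
Proof.
move=> tp; have [cp cdp] := test_fun_cont tp.
have [B B0 Bp] := test_fun_bounded tp.
have s1 := test_fun_smooth 0 tp.
have [L L0 LS] := compact_box tp.2.1.
have out (x : pt R) : L <= `|x.1| \/ L <= `|x.2| -> phi x = 0 /\ partial j phi x = 0.
  move=> xL; apply: supp_partial => /LS[]; rewrite !ltNge => /negP h1 /negP h2.
  by case: xL.
have int : mu.-integrable setT (EFin \o partial j phi).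
  have E : (EFin \o partial j phi) = (EFin \o partial j phi) \_ (`[- L, L] `*` `[- L, L]).
    apply/funext => x; rewrite /patch; case: ifPn => //; rewrite notin_setE /= => xL.
    congr EFin; apply: (out x _).2.
    have [|x1] := leP L `|x.1|; first by left.
    have [|x2] := leP L `|x.2|; first by right.
    by case: xL; rewrite !in_itv/= -!ler_norml; split; exact: ltW.
  rewrite E.
  have mQ : measurable (`[- L, L] `*` `[- L, L] : set (R * R)).
    by apply: measurableX; exact: measurable_itv.
  suff H : mu.-integrable (`[- L, L] `*` `[- L, L]) (EFin \o partial j phi).
    have K := (@integrable_mkcond _ _ R (lebesgue_measure \x lebesgue_measure)%E (`[- L, L]%classic `*` `[- L, L]%classic) (EFin \o partial j phi) mQ).
    exact: (K.1 H).
  apply: (@bounded_integrable _ _ B) => //.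
  - have LL : - L <= L by lra.
    by rewrite (mu_box LL LL) ltry.
  - apply: measurable_funS (open_continuous_measurable_pt openT _) => //.
    by move=> x _; exact: cdp.
  - by move=> x _; exact: (Bp x).2.
have line (x : pt R) (s : R) : is_derive s 1 (fun t : R => phi (x + t *: e_ j)) (partial j phi (x + s *: e_ j)).
  by apply: is_derive_line; exact: (smoothn_base s1 I).2.
have cline (x : pt R) : continuous (fun t : R => partial j phi (x + t *: e_ j)).
  move=> t; apply: (@continuous_comp _ _ _ (fun t : R => x + t *: e_ j) (partial j phi)); last exact: cdp.
  apply: cvgD; first exact: cvg_cst.
  by apply: cvgZr_tmp; exact: cvg_id.
(* The direction decides which of the two iterated integrals is used. *)
move: out int line cline; move: j; apply: ord2P => out int line cline.
  rewrite -(@integral21_prod_meas1 _ _ _ _ _ (@lebesgue_measure R) (@lebesgue_measure R) _ int).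
  apply: integral0_eq => y _; rewrite /fubini_G /=.
  have E (t : R) : (0, y) + t *: e_ o0 = (t, y) :> pt R.
    by apply: pt_eq => /=; rewrite ?add0r ?[_ *: 1]mulr1// [_ *: 0]mulr0 addr0.
  apply: (@integral_derive_compact (fun t => phi (t, y)) (fun t => partial o0 phi (t, y)) L) => //.
  - move=> t; rewrite -E (_ : (fun t => phi (t, y)) = (fun t => phi ((0, y) + t *: e_ o0))); first exact: line.
    by apply/funext => s; rewrite E.
  - rewrite (_ : (fun t => partial o0 phi (t, y)) = (fun t => partial o0 phi ((0, y) + t *: e_ o0))); first exact: cline.
    by apply/funext => s; rewrite E.
  - by move=> t tL; apply: out; left.
rewrite -(@integral12_prod_meas1 _ _ _ _ _ (@lebesgue_measure R) (@lebesgue_measure R) _ int).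
apply: integral0_eq => y _; rewrite /fubini_F /=.
have E (t : R) : (y, 0) + t *: e_ o1 = (y, t) :> pt R.
  by apply: pt_eq => /=; rewrite ?add0r ?[_ *: 1]mulr1// [_ *: 0]mulr0 addr0.
apply: (@integral_derive_compact (fun t => phi (y, t)) (fun t => partial o1 phi (y, t)) L) => //.
- move=> t; rewrite -E (_ : (fun t => phi (y, t)) = (fun t => phi ((y, 0) + t *: e_ o1))); first exact: line.
  by apply/funext => s; rewrite E.
- rewrite (_ : (fun t => partial o1 phi (y, t)) = (fun t => partial o1 phi ((y, 0) + t *: e_ o1))); first exact: cline.
  by apply/funext => s; rewrite E.
- by move=> t tL; apply: out; right.
Qed.

End TestFunctions.

(** Bounded convergence in the form used throughout: domain of finite measure, a constant as
    dominating function, and at each point of a set of full measure a sequence that is eventually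
    stationary. *)
Lemma Rintegral_eventually d (T : measurableType d) (R : realType)
    (mu : {measure set T -> \bar R}) (D O : set T) (f_ : nat -> T -> R) (f : T -> R) (B : R) :
  measurable D -> (mu D < +oo)%E -> mu.-negligible (D `\` O) ->
  (forall n, measurable_fun D (f_ n)) -> measurable_fun D f ->
  (forall n x, D x -> `|f_ n x| <= B) ->
  (forall x, O x -> \forall n \near \oo, f_ n x = f x) ->
  \int[mu]_(x in D) f_ n x @[n --> \oo] --> \int[mu]_(x in D) f x.
Proof.
move=> mD fD nO mf_ mf fB ff.
have iB : mu.-integrable D (EFin \o cst B).
  apply: measurable_bounded_integrable => //.
  by exists `|B|; split; [exact: num_real|move=> M BM x _ /=; exact: ltW].
have cae : {ae mu, forall x, D x -> (EFin \o f_ n) x @[n --> \oo] --> (EFin \o f) x}.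
  apply: negligibleS nO => x /= /not_implyP[Dx nc]; split=> // Ox; apply: nc.
  by apply: cvg_near_cst; apply: filterS (ff x Ox) => n /= ->.
have bae : {ae mu, forall x n, D x -> (`|(EFin \o f_ n) x| <= (EFin \o cst B) x)%E}.
  by apply: aeW => x n Dx; rewrite /= lee_fin; exact: fB.
have mf1 n := (measurable_EFinP _ _).2 (mf_ n).
have mf2 := (measurable_EFinP _ _).2 mf.
have [i1 _ i2] := dominated_convergence mD mf1 mf2 cae iB bae.
by apply: fine_cvg; rewrite fineK; [exact: i2|exact: (integrable_fin_num mD i1)].
Qed.

Lemma deriveMfun (R : realType) (V : normedModType R) (f g : V -> R) (x v : V) :
  derivable f x v -> derivable g x v ->
  'D_v (fun y => f y * g y) x = f x * 'D_v g x + g x * 'D_v f x.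
Proof. exact: deriveM. Qed.

(** * Weak gradients and H^1_0 by approximation with test functions *)

Section Approximation.
Variable R : realType.
Local Notation o0 := (@ord0 1).
Local Notation o1 := (lift (@ord0 1) (@ord0 0)).
Local Notation e_ := (@Defs.basis R).
Local Notation mu := (@mu R).
Implicit Types (D U O : set (pt R)) (phi psi f u : pt R -> R).

Lemma test_funM D phi psi : test_fun D phi -> smooth_on setT psi ->
  test_fun D (fun x => phi x * psi x).
Proof.
move=> tp sp; have [_ [cS SD]] := tp.
split.
  apply/smooth_onP => n; apply: smoothnM; first exact: openT.
    exact: test_fun_smooth tp.
  by move/smooth_onP : sp.
have sub : closure [set x | phi x * psi x != 0] `<=` closure [set x | phi x != 0].
  apply: closure_subset => x /=; apply: contraNN => /eqP ->.
  by rewrite mul0r.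
split=> /=; last exact: subset_trans SD.
by apply: (subclosed_compact _ cS) => //; exact: closed_closure.
Qed.

Lemma partialM f g x j : derivable f x (e_ j) -> derivable g x (e_ j) ->
  partial j (fun y => f y * g y) x = f x * partial j g x + g x * partial j f x.
Proof. by rewrite /partial; exact: deriveMfun. Qed.

Lemma Rintegral_partial D phi j : test_fun D phi -> \int[mu]_(x in D) partial j phi x = 0.
Proof.
move=> tp; have [_ [_ SD]] := tp; rewrite /Rintegral.
have -> : (\int[mu]_(x in D) (partial j phi x)%:E = \int[mu]_x (partial j phi x)%:E)%E; last first.
  by rewrite (integral_partial j tp).
rewrite integral_mkcond; apply: eq_integral => x _; rewrite /patch.
case: ifPn => [//|]; rewrite notin_setE => xD; congr EFin; apply/esym.
by apply: (supp_partial j _).2 => /SD/interior_subset.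
Qed.

(** The product of two test functions is a test function, so the integral of its derivative
    vanishes. *)
Lemma test_ibp D phi psi j : measurable (D : set (R * R)) -> (mu D < +oo)%E ->
  test_fun D phi -> test_fun D psi ->
  \int[mu]_(x in D) (phi x * partial j psi x) = - \int[mu]_(x in D) (partial j phi x * psi x).
Proof.
move=> mD fD tp tq.
have [cp cdp] := test_fun_cont tp; have [cq cdq] := test_fun_cont tq.
have [B B0 Bp] := test_fun_bounded tp; have [C C0 Cq] := test_fun_bounded tq.
have tpq := test_funM tp tq.1.
have mc f : continuous f -> measurable_fun (D : set (R * R)) f.
  move=> cf; apply: measurable_funS (open_continuous_measurable_pt openT _) => //.
  by move=> x _; exact: cf.
have i1 : mu.-integrable D (EFin \o (fun x => phi x * partial j psi x)).
  apply: (@bounded_integrable _ _ _ (B * C)) => //.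
    by apply: mc => x; apply: continuousM; [exact: cp|exact: cdq].
  by move=> x _; rewrite normrM ler_pM//; [exact: (Bp x).1|exact: (Cq x).2].
have i2 : mu.-integrable D (EFin \o (fun x => partial j phi x * psi x)).
  apply: (@bounded_integrable _ _ _ (B * C)) => //.
    by apply: mc => x; apply: continuousM; [exact: cdp|exact: cq].
  by move=> x _; rewrite normrM ler_pM//; [exact: (Bp x).2|exact: (Cq x).1].
apply/eqP; rewrite -subr_eq0 opprK -RintegralD//.
rewrite -[X in _ == X](Rintegral_partial j tpq); apply/eqP; apply: eq_Rintegral => x _.
have dp := (smoothn_base (test_fun_smooth 0 tp) (I : setT x)).2 j.
have dq := (smoothn_base (test_fun_smooth 0 tq) (I : setT x)).2 j.
by rewrite (partialM dp dq) [psi x * _]mulrC.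
Qed.

Lemma bounded_L2 D f (B : R) : measurable (D : set (R * R)) -> (mu D < +oo)%E ->
  measurable_fun (D : set (R * R)) f -> (forall x, D x -> `|f x| <= B) -> in_L2 D f.
Proof.
move=> mD fD mf fB; split=> //.
apply: (@bounded_integrable _ _ (fun x => f x ^+ 2) (B ^+ 2)) => //.
  exact: measurable_funX.
move=> x Dx; rewrite normrX ler_pXn2r// ?nnegrE//; first exact: fB.
exact: le_trans (fB x Dx).
Qed.

(* Test functions phi n with uniformly bounded gradients that are, near each point of an open set O of full measure,
   eventually equal to u: then u is in H^1_0 and its classical gradient on O is its weak gradient. *)
Section ApproxH10.
Variables (D O : set (pt R)) (u : pt R -> R) (phi : nat -> pt R -> R) (B B1 : R).
Hypothesis B1_ge0 : 0 <= B1.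
Hypothesis mD : measurable (D : set (R * R)).
Hypothesis fD : (mu D < +oo)%E.
Hypothesis oO : open O.
Hypothesis nO : mu.-negligible (D `\` O).
Hypothesis mu_ : measurable_fun (D : set (R * R)) u.
Hypothesis uB : forall x, D x -> `|u x| <= B.
Hypothesis tphi : forall n, test_fun D (phi n).
Hypothesis phiB : forall n x, D x -> `|phi n x| <= B.
Hypothesis dphiB : forall n x j, D x -> `|partial j (phi n) x| <= B1.
Hypothesis phiu : forall x, O x -> \forall n \near \oo, \forall y \near x, phi n y = u y.

(** Cut off outside [O], where [u] may have no classical derivatives, so that measurability and
    bounds hold on all of [D]. *)
Definition broken_grad : pt R -> 'rV[R]_2 := fun x => \row_j (partial j u \_ O) x.

Let phi_ev x : O x -> \forall n \near \oo, phi n x = u x.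
Proof. by move=> Ox; apply: filterS (phiu Ox) => n; exact: nbhs_singleton. Qed.

Let dphi_ev x j : O x -> \forall n \near \oo, partial j (phi n) x = partial j u x.
Proof. by move=> Ox; apply: filterS (phiu Ox) => n; exact: near_eq_partial. Qed.

Let broken_gradE j x : broken_grad x 0 j = (partial j u \_ O) x.
Proof. by rewrite mxE. Qed.

Let grad_ev x j : O x -> \forall n \near \oo, partial j (phi n) x = broken_grad x 0 j.
Proof.
move=> Ox; apply: filterS (dphi_ev j Ox) => n ->.
by rewrite broken_gradE /patch mem_set.
Qed.

Lemma broken_grad_bound j x : D x -> `|broken_grad x 0 j| <= B1.
Proof.
move=> Dx; have [Ox|Ox] := pselect (O x).
  have [n _ /(_ n (leqnn n)) <-] := grad_ev j Ox.
  exact: dphiB.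
by rewrite broken_gradE /patch memNset// normr0.
Qed.

(** No smoothness of [u] is assumed: near [x] it coincides with some test function, and by
    [near_join] so do the derivatives at all nearby points. *)
Let cont_partial j x : O x -> {for x, continuous (partial j u)}.
Proof.
move=> Ox; have [n _ /(_ n (leqnn n)) nu] := phiu Ox.
have c := (test_fun_cont (tphi n)).2 j x.
have e : \near x, partial j (phi n) x = partial j u x.
  by apply: filterS (near_join nu) => y; exact: near_eq_partial.
change (partial j u @ x --> partial j u x); rewrite -(nbhs_singleton e).
by apply: cvg_trans c; apply: near_eq_cvg.
Qed.

Let meas_grad j : measurable_fun (D : set (R * R)) (fun x => broken_grad x 0 j).
Proof.
have -> : (fun x => broken_grad x 0 j) = partial j u \_ O by apply/funext => x; exact: broken_gradE.
have mO : measurable_fun (O : set (R * R)) (partial j u).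
  by apply: open_continuous_measurable_pt => // x Ox; exact: cont_partial.
have H := (measurable_restrictT _ (open_measurable_pt oO)).1 mO.
exact: (measurable_funS measurableT (@subsetT _ _) H).
Qed.

Let meas_cont f : continuous f -> measurable_fun (D : set (R * R)) f.
Proof.
move=> cf; apply: measurable_funS (open_continuous_measurable_pt openT _) => //.
by move=> x _; exact: cf.
Qed.

Lemma broken_grad_weak : weak_grad D u broken_grad.
Proof.
split; first exact: bounded_L2 uB.
move=> j; split; first by apply: bounded_L2 (broken_grad_bound j) => //; exact: meas_grad.
move=> psi tpsi.
have [cq cdq] := test_fun_cont tpsi; have [C C0 Cq] := test_fun_bounded tpsi.
have c1 : \int[mu]_(x in D) (phi n x * partial j psi x) @[n --> \oo] --> \int[mu]_(x in D) (u x * partial j psi x).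
  apply: (@Rintegral_eventually _ _ _ (lebesgue_measure \x lebesgue_measure)%E D O (fun n x => phi n x * partial j psi x) _ (B * C)) => //.
  - move=> n; apply: measurable_funM; apply: meas_cont; [exact: (test_fun_cont (tphi n)).1|exact: cdq].
  - by apply: measurable_funM => //; apply: meas_cont; exact: cdq.
  - by move=> n x Dx; rewrite normrM ler_pM//; [exact: phiB|exact: (Cq x).2].
  - by move=> x Ox; apply: filterS (phi_ev Ox) => n ->.
have c2 : \int[mu]_(x in D) (partial j (phi n) x * psi x) @[n --> \oo] --> \int[mu]_(x in D) (broken_grad x 0 j * psi x).
  apply: (@Rintegral_eventually _ _ _ (lebesgue_measure \x lebesgue_measure)%E D O (fun n x => partial j (phi n) x * psi x) _ (B1 * C)) => //.
  - move=> n; apply: measurable_funM; apply: meas_cont; [exact: (test_fun_cont (tphi n)).2|exact: cq].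
  - by apply: measurable_funM => //; [exact: meas_grad|exact: meas_cont].
  - by move=> n x Dx; rewrite normrM ler_pM//; [exact: dphiB|exact: (Cq x).1].
  - by move=> x Ox; apply: filterS (grad_ev j Ox) => n ->.
have c3 := cvgN c2.
have E : (fun n => \int[mu]_(x in D) (phi n x * partial j psi x)) =
    (fun n => - \int[mu]_(x in D) (partial j (phi n) x * psi x)).
  by apply/funext => n; exact: test_ibp.
rewrite E in c1.
rewrite -(cvg_lim (@Rhausdorff R) c1).
exact: (cvg_lim (@Rhausdorff R) (c3 _)).
Qed.

(** Inherited in the limit from test functions, whose derivatives have integral zero. This takes the
    place of Green's formula when the mean of the divergence is computed. *)
Lemma broken_grad_integral j : \int[mu]_(x in D) broken_grad x 0 j = 0.
Proof.
have c2 : \int[mu]_(x in D) (partial j (phi n) x) @[n --> \oo] --> \int[mu]_(x in D) (broken_grad x 0 j).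
  apply: (@Rintegral_eventually _ _ _ (lebesgue_measure \x lebesgue_measure)%E D O (fun n x => partial j (phi n) x) _ B1) => //.
  - by move=> n; apply: meas_cont; exact: (test_fun_cont (tphi n)).2.
  - exact: meas_grad.
  - by move=> n x Dx; exact: dphiB.
  - by move=> x Ox; exact: (grad_ev j Ox).
rewrite -(cvg_lim (@Rhausdorff R) c2).
under eq_fun do rewrite Rintegral_partial//.
exact: (cvg_lim (@Rhausdorff R) (cvg_cst _)).
Qed.

Let sq_cvg (f_ : nat -> pt R -> R) (E : R) : (forall n, measurable_fun (D : set (R * R)) (f_ n)) ->
  (forall n x, D x -> `|f_ n x| <= 2 * E) -> (forall x, O x -> \forall n \near \oo, f_ n x = 0) ->
  L2norm D (f_ n) ^+ 2 @[n --> \oo] --> 0.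
Proof.
move=> mf fB f0.
have -> : (fun n => L2norm D (f_ n) ^+ 2) = (fun n => \int[mu]_(x in D) (f_ n x ^+ 2)).
  apply/funext => n; rewrite sqr_sqrtr//; apply: Rintegral_ge0 => x _; exact: sqr_ge0.
rewrite -[X in _ --> X](_ : \int[mu]_(x in D) (cst 0 x) = 0); last first.
  by rewrite /Rintegral integral0_eq.
apply: (@Rintegral_eventually _ _ _ (lebesgue_measure \x lebesgue_measure)%E D O _ (cst 0) ((2 * E) ^+ 2)) => //.
- by move=> n; apply: measurable_funX; exact: mf.
- move=> n x Dx; rewrite normrX ler_pXn2r// ?nnegrE//; first exact: fB.
  exact: le_trans (fB n x Dx).
- by move=> x Ox; apply: filterS (f0 x Ox) => n ->; rewrite expr0n.
Qed.

Lemma broken_grad_H10 : in_H10 D u.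
Proof.
exists broken_grad; first exact: broken_grad_weak.
move=> eps eps0.
have c1 : L2norm D (fun x => u x - phi n x) ^+ 2 @[n --> \oo] --> 0.
  apply: (sq_cvg (E := B)) => [n|n x Dx|x Ox].
  - by apply: measurable_funB => //; apply: meas_cont; exact: (test_fun_cont (tphi n)).1.
  - by rewrite mulr_natl mulr2n (le_trans (ler_normB _ _))// lerD//; [exact: uB|exact: phiB].
  - by apply: filterS (phi_ev Ox) => n ->; rewrite subrr.
have c2 j : L2norm D (fun x => (broken_grad x - \row_j partial j (phi n) x) 0 j) ^+ 2 @[n --> \oo] --> 0.
  apply: (sq_cvg (E := B1) (f_ := fun n x => (broken_grad x - \row_j partial j (phi n) x) 0 j)) => [n|n x Dx|x Ox].
  - have -> : (fun x => (broken_grad x - \row_j partial j (phi n) x) 0 j) =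
      (fun x => broken_grad x 0 j - partial j (phi n) x) by apply/funext => x; rewrite !mxE.
    apply: measurable_funB; first exact: meas_grad.
    by apply: meas_cont; exact: (test_fun_cont (tphi n)).2.
  - rewrite [X in `|X|](_ : _ = broken_grad x 0 j - partial j (phi n) x); last by rewrite !mxE.
    by rewrite mulr_natl mulr2n (le_trans (ler_normB _ _))// lerD//; [exact: broken_grad_bound|exact: dphiB].
  - apply: filterS (grad_ev j Ox) => n e.
    by rewrite [LHS](_ : _ = broken_grad x 0 j - partial j (phi n) x); [rewrite e subrr|rewrite !mxE].
pose s0 n : R := L2norm D (fun x => u x - phi n x) ^+ 2.
pose s1 j n : R := L2norm D (fun x => (broken_grad x - \row_j partial j (phi n) x) 0 j) ^+ 2.
have c3 : s0 n + (s1 o0 n + s1 o1 n) @[n --> \oo] --> 0 + (0 + 0 : R).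
  by apply: cvgD; [exact: c1|apply: cvgD; exact: c2].
have /cvgrPdist_lt c4 := c3.
have [n _ /(_ n (leqnn n)) /=] := c4 _ (exprn_gt0 2 eps0).
rewrite !addr0 sub0r normrN => h.
exists (phi n) => //; rewrite /H1norm.
rewrite -(ltr_pXn2r (ltn0Sn 1)) ?nnegrE ?sqrtr_ge0 ?ltW//.
rewrite sqr_sqrtr; last by rewrite addr_ge0 ?sqr_ge0// sumr_ge0// => i _; exact: sqr_ge0.
rewrite !big_ord_recl big_ord0 addr0.
exact: le_lt_trans (ler_norm _) h.
Qed.

End ApproxH10.

End Approximation.

Lemma ord3P (P : 'I_3 -> Prop) : P ord0 -> P (lift ord0 ord0) -> P (lift ord0 (lift ord0 ord0)) -> forall i, P i.
Proof.
move=> P0 P1 P2 i; have [->//|i0] := eqVneq i ord0.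
have [->//|i1] := eqVneq i (lift ord0 ord0).
suff -> : i = lift ord0 (lift ord0 ord0) by [].
by apply: val_inj; move: i i0 i1 => [[|[|[|]]]].
Qed.

(** * The reference triangle *)

Section Reference.
Variable R : realType.
Implicit Types (x y : pt R) (k i : 'I_3).

Definition lam k x : R := nth 0 [:: x.1; x.2; 1 - x.1 - x.2] k.

Definition open_tri : set (pt R) := [set x | forall i, 0 < lam i x].

(** Replacing vertex [k] by the barycenter cuts out the part where the [k]-th barycentric coordinate
    is the smallest; strict inequalities make it open. *)
Definition ct_open k : set (pt R) := [set x | 0 < lam k x /\ forall i, i != k -> lam k x < lam i x].

(* Also the median lines x.1 = x.2 etc. are removed in full, not only their halves interior to the split. *)
Definition generic : set (pt R) := [set x | open_tri x /\ forall i j, i != j -> lam i x != lam j x].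

Lemma hullE (K : triangle R) x : hull K x <-> exists l : 'I_3 -> R,
  [/\ forall i, 0 <= l i, l ord0 + l (lift ord0 ord0) + l (lift ord0 (lift ord0 ord0)) = 1,
   x.1 = l ord0 * (K ord0).1 + l (lift ord0 ord0) * (K (lift ord0 ord0)).1 +
     l (lift ord0 (lift ord0 ord0)) * (K (lift ord0 (lift ord0 ord0))).1
   & x.2 = l ord0 * (K ord0).2 + l (lift ord0 ord0) * (K (lift ord0 ord0)).2 +
     l (lift ord0 (lift ord0 ord0)) * (K (lift ord0 (lift ord0 ord0))).2].
Proof.
split=> -[l [l0 l1]].
  move=> ->; exists l; split=> //; rewrite ?(big_ord_recl, big_ord0) /=.
  - by rewrite -l1 !big_ord_recl big_ord0; ring.
  - by rewrite addr0 addrA.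
  - by rewrite addr0 addrA.
move=> x1 x2; exists l; split=> //; first by rewrite -l1 !big_ord_recl big_ord0; ring.
by rewrite !big_ord_recl big_ord0; apply: pt_eq; rewrite /= ?x1 ?x2 addr0 addrA.
Qed.

Lemma ThatE x : @That R x <-> forall i, 0 <= lam i x.
Proof.
rewrite /That hullE; split=> [[l [l0 l1 x1 x2]]|h].
  have := l0 ord0; have := l0 (lift ord0 ord0); have := l0 (lift ord0 (lift ord0 ord0)).
  rewrite /ref_tri /= in x1 x2.
  by move=> a b c; apply: ord3P; rewrite /lam /= ?x1 ?x2; lra.
exists (fun i => lam i x); split=> //; rewrite /lam /ref_tri /=; ring.
Qed.

Lemma bary_ref : bary (@ref_tri R) = (3^-1, 3^-1).
Proof.
rewrite /bary !big_ord_recl big_ord0 /ref_tri.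
by apply: pt_eq; rewrite /= !addr0 ?add0r; exact: mulr1.
Qed.

Lemma ct_hull k x : hull (ct (@ref_tri R) k) x -> forall i, lam k x <= lam i x.
Proof.
rewrite hullE; case=> l [l0 l1].
have := l0 ord0; have := l0 (lift ord0 ord0); have := l0 (lift ord0 (lift ord0 ord0)).
move: k; apply: ord3P; rewrite /ct bary_ref /ref_tri /= => a b c x1 x2;
  apply: ord3P; rewrite /lam /= ?x1 ?x2; lra.
Qed.

Lemma ct_open_hull k x : ct_open k x -> hull (ct (@ref_tri R) k) x.
Proof.
move=> [x0 xk]; rewrite hullE.
(* The barycenter takes weight 3 lam_k, which gives lam_k to every vertex; the remainder lam_i -
   lam_k stays on vertex i. *)
exists (fun i => if i == k then 3 * lam k x else lam i x - lam k x); split.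
- move=> i; case: ifPn => [_|/xk /ltW]; last by rewrite subr_ge0.
  by rewrite mulr_ge0// ltW.
- by move: k x0 xk; apply: ord3P => x0 xk; rewrite /lam /=; lra.
- by move: k x0 xk; apply: ord3P => x0 xk; rewrite /lam /ct bary_ref /ref_tri /=; lra.
- by move: k x0 xk; apply: ord3P => x0 xk; rewrite /lam /ct bary_ref /ref_tri /=; lra.
Qed.

Lemma lam_cont i : continuous (lam i).
Proof.
move: i; apply: ord3P => x; rewrite /lam /=; [exact: cvg_fst|exact: cvg_snd|].
by apply: cvgB; [apply: cvgB; [exact: cvg_cst|exact: cvg_fst]|exact: cvg_snd].
Qed.

Lemma open_lt_fun (f g : pt R -> R) : continuous f -> continuous g -> open [set x | f x < g x].
Proof.
move=> cf cg; rewrite openE => x /= fg; rewrite /interior.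
near=> y; rewrite /= -subr_gt0; near: y.
have c : (g y - f y) @[y --> x] --> g x - f x by apply: cvgB; [exact: cg|exact: cf].
by apply: (cvgr_gt _ c); rewrite subr_gt0.
Unshelve. all: by end_near. Qed.

Lemma open_forall3 (P : 'I_3 -> set (pt R)) : (forall i, open (P i)) -> open [set x | forall i, P i x].
Proof.
move=> oP; have -> : [set x | forall i, P i x] = P ord0 `&` P (lift ord0 ord0) `&` P (lift ord0 (lift ord0 ord0)).
  by apply/seteqP; split=> x /= => [h|[[a b] c]]; [do !split; exact: h|exact: ord3P].
by do !apply: openI.
Qed.

Lemma open_imp (P : set (pt R)) (b : bool) : open P -> open [set x | b -> P x].
Proof.
move=> oP; case: b; last by rewrite (_ : [set _ | _] = setT); [exact: openT|apply/seteqP].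
by rewrite (_ : [set _ | _] = P)//; apply/seteqP; split => x /= => [|h _]; [apply|].
Qed.

Lemma open_tri_open : open open_tri.
Proof. by apply: open_forall3 => i; apply: open_lt_fun; [move=> x; exact: cvg_cst|exact: lam_cont]. Qed.

Lemma ct_open_open k : open (ct_open k).
Proof.
apply: (@openI _ [set x | 0 < lam k x] [set x | forall i, i != k -> lam k x < lam i x]).
  by apply: open_lt_fun; [move=> x; exact: cvg_cst|exact: lam_cont].
apply: (@open_forall3 (fun i => [set x | i != k -> lam k x < lam i x])) => i.
by apply: (@open_imp [set x | lam k x < lam i x]); apply: open_lt_fun; exact: lam_cont.
Qed.

Lemma ct_open_interior k x : ct_open k x -> (hull (ct (@ref_tri R) k))° x.
Proof.
move=> xk; apply: (@filterS _ _ _ (ct_open k)); first exact: ct_open_hull.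
by apply: open_nbhs_nbhs; split => //; exact: ct_open_open.
Qed.

Lemma open_tri_That x : open_tri x -> (@That R)° x.
Proof.
move=> xk; apply: (@filterS _ _ _ open_tri) => [y yt|]; first by apply/ThatE => i; exact: ltW.
by apply: open_nbhs_nbhs; split => //; exact: open_tri_open.
Qed.

Lemma open_neq_fun (f g : pt R -> R) : continuous f -> continuous g -> open [set x | f x != g x].
Proof.
move=> cf cg; have -> : [set x | f x != g x] = [set x | f x < g x] `|` [set x | g x < f x].
  by apply/seteqP; split => x /=; rewrite neq_lt => /orP.
by apply: openU; exact: open_lt_fun.
Qed.

Lemma generic_open : open generic.
Proof.
apply: openI; first exact: open_tri_open.
apply: (@open_forall3 (fun i => [set x | forall j, i != j -> lam i x != lam j x])) => i.
apply: (@open_forall3 (fun j => [set x | i != j -> lam i x != lam j x])) => j.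
by apply: (@open_imp [set x | lam i x != lam j x]); apply: open_neq_fun; exact: lam_cont.
Qed.

Lemma generic_ct x : generic x -> exists k, ct_open k x.
Proof.
move=> [x0 xn].
have [k _ kmin] := @arg_minP _ _ _ (@ord0 2) predT (fun i => lam i x) isT.
exists k; split=> // i ik; rewrite lt_neqAle xn ?kmin// eq_sym//.
Qed.

Lemma ct_open_tri k : ct_open k `<=` open_tri.
Proof.
by move=> x [x0 xk] i; have [->//|ik] := eqVneq i k; exact: lt_trans (xk i ik).
Qed.

Lemma That_compact : compact (@That R).
Proof.
have sub : @That R `<=` (`[0, 1]%classic `*` `[0, 1]%classic : set (pt R)).
  move=> x /ThatE h; have := h ord0; have := h (lift ord0 ord0); have := h (lift ord0 (lift ord0 ord0)).
  by rewrite /lam /= => a b c; split; rewrite /= in_itv/=; lra.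
apply: (subclosed_compact _ _ sub).
  rewrite (_ : @That R = ~` [set x | exists i, lam i x < 0]).
    apply: open_closedC.
    have -> : [set x | exists i, lam i x < 0] = \bigcup_i [set x | lam i x < 0].
      by apply/seteqP; split => x /= [i]; [move=> h; exists i|move=> _ h; exists i].
    apply: bigcup_open => i _; apply: open_lt_fun; first exact: lam_cont.
    by move=> x; exact: cvg_cst.
  apply/seteqP; split => x /=.
    by move=> /ThatE h [i]; rewrite ltNge h.
  by move=> h; apply/ThatE => i; rewrite leNgt; apply/negP => xi; apply: h; exists i.
by apply: compact_setX; exact: segment_compact.
Qed.

End Reference.

(** * Lipschitz images of segments are negligible *)

Section NullCurves.
Variable R : realType.
Local Notation mu := (@mu R).

Lemma null_cover d (T : measurableType d) (nu : {measure set T -> \bar R}) (A : set T) (c : R) :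
  (forall n : nat, exists2 U : set T, measurable U & A `<=` U /\ (nu U <= (c / n.+1%:R)%:E)%E) ->
  nu.-negligible A.
Proof.
move=> h.
have /choice[U hU] n : exists U : set T, measurable U /\ A `<=` U /\ (nu U <= (c / n.+1%:R)%:E)%E.
  by have [U mU AU] := h n; exists U.
have mI : measurable (\bigcap_n U n) by apply: bigcap_measurable => // n _; have [] := hU n.
exists (\bigcap_n U n); split => //; last by move=> x Ax n _; apply: (hU n).2.1.
apply/eqP; rewrite eq_le measure_ge0 andbT.
apply/lee_addgt0Pr => e e0; rewrite add0e.
have [n n_e] : exists n : nat, c / n.+1%:R <= e.
  exists (Num.trunc (`|c| / e)); rewrite ler_pdivrMr ?ltr0n// -ler_pdivrMl//.
  apply: (@le_trans _ _ (`|c| / e)); first by rewrite mulrC ler_wpM2r ?invr_ge0 ?ler_norm// ltW.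
  by rewrite ltW// truncnS_gt// divr_ge0// ltW.
apply: le_trans (_ : (c / n.+1%:R)%:E <= _)%E; last by rewrite lee_fin.
apply: le_trans (hU n).2.2; apply: le_measure; rewrite ?inE//; first exact: (hU n).1.
by move=> x; exact.
Qed.

Lemma dist_cell (N i s t : R) : 0 < N -> i <= N * s -> N * s <= i + 1 ->
  i <= N * t -> N * t <= i + 1 -> `|s - t| <= N^-1.
Proof.
move=> N0 s1 s2 t1 t2; rewrite -[N^-1]mulr1 -ler_pdivrMl ?invr_gt0// invrK.
rewrite -{1}(gtr0_norm N0) -normrM ler_norml.
have -> : N * (s - t) = N * s - N * t by ring.
by apply/andP; split; lra.
Qed.

(** Cutting the parameters into cells of length 1/(n+1) covers the curve by n+2 squares of side
    2L/(n+1), of total area at most 8 L^2/(n+1). *)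
Lemma null_curve (S : set R) (g : R -> pt R) (L : R) : 0 < L ->
  (forall t, S t -> 0 <= t <= 1) ->
  (forall s t, S s -> S t -> `|(g s).1 - (g t).1| <= L * `|s - t| /\ `|(g s).2 - (g t).2| <= L * `|s - t|) ->
  mu.-negligible (g @` S).
Proof.
move=> L0 S01 gL.
apply: (@null_cover _ _ _ _ (8 * L ^+ 2)) => n.
pose I (i : nat) : set R := [set t | S t /\ i%:R <= n.+1%:R * t <= i.+1%:R].
pose p (i : nat) : pt R := g (xget 0 (I i)).
pose r : R := L / n.+1%:R.
have n0 : 0 < n.+1%:R :> R by rewrite ltr0n.
have r0 : 0 < r by rewrite divr_gt0.
pose Q (i : nat) : set (R * R) := `[(p i).1 - r, (p i).1 + r]%classic `*` `[(p i).2 - r, (p i).2 + r]%classic.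
have mQ i : measurable (Q i) by apply: measurableX; exact: measurable_itv.
have muQ i : mu (Q i) = (4 * r ^+ 2)%:E.
  rewrite mu_box; [|lra|lra].
  by congr EFin; ring.
exists (\big[setU/set0]_(i < n.+2) Q i); first by apply: bigsetU_measurable => i _; exact: mQ.
split.
  move=> _ [t St <-].
  have /andP[t0 t1] := S01 t St.
  pose i := Num.trunc (n.+1%:R * t).
  have nt0 : 0 <= n.+1%:R * t by rewrite mulr_ge0// ltW.
  have /andP[i1 i2] := truncn_itv nt0.
  have Iit : I i t by split => //; rewrite i1 ltW.
  (* There is one cell more than n+1 because the parameter t = 1 falls into the cell of index
     n+1. *)
  have ilt : (i < n.+2)%N.
    rewrite ltnS -(ler_nat R) (le_trans i1)// ler_piMr// ltW//.
  rewrite -bigcup_mkord; exists i => //=.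
  have Ig : I i (xget 0 (I i)) by apply: xgetPex; exists t.
  have [Sg /andP[g1 g2]] := Ig.
  have d : `|t - xget 0 (I i)| <= n.+1%:R^-1.
    by apply: (@dist_cell n.+1%:R i%:R) => //; rewrite natr1// ltW.
  have [h1 h2] := gL _ _ St Sg.
  have Lr : L * `|t - xget 0 (I i)| <= r by rewrite ler_wpM2l// ltW.
  split; rewrite /= in_itv/= -ler_distl.
    exact: le_trans h1 Lr.
  exact: le_trans h2 Lr.
apply: (le_trans (Boole_inequality _ _)) => [i _|]; first exact: mQ.
have -> : (\sum_(i < n.+2) mu (Q i))%E = (\sum_(i < n.+2) (4 * r ^+ 2)%:E)%E by apply: eq_bigr => i _; exact: muQ.
rewrite sumEFin lee_fin sumr_const card_ord.
rewrite /r -[_ *+ n.+2]mulr_natr.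
have n2 : n.+2%:R = n.+1%:R + 1 :> R by rewrite natr1.
rewrite n2 exprMn.
have n1 : 1 <= n.+1%:R :> R by rewrite ler1n.
have L2 : 0 <= L ^+ 2 by rewrite sqr_ge0.
rewrite ler_pdivlMr//.
have -> : 4 * (L ^+ 2 * n.+1%:R^-1 ^+ 2) * (n.+1%:R + 1) * n.+1%:R =
  4 * L ^+ 2 * (1 + n.+1%:R^-1).
  by field; rewrite gt_eqF.
have : n.+1%:R^-1 <= 1 :> R by rewrite invf_le1.
move=> h; have -> : 8 * L ^+ 2 = 4 * L ^+ 2 * 2 by ring.
apply: ler_wpM2l; first by rewrite mulr_ge0.
by move: (n.+1%:R^-1) h => z h; lra.
Qed.

(** A point of the closed triangle that is not generic lies on a side or on a median line, hence on
    one of six lines, and [F] is Lipschitz on each. *)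
Lemma image_nongeneric_null (F : pt R -> pt R) (L : R) : 0 < L ->
  (forall x y, That x -> That y ->
    `|(F x).1 - (F y).1| <= L * (`|x.1 - y.1| + `|x.2 - y.2|) /\
    `|(F x).2 - (F y).2| <= L * (`|x.1 - y.1| + `|x.2 - y.2|)) ->
  mu.-negligible (F @` (@That R `\` @generic R)).
Proof.
move=> L0 FL.
pose c (a b d e : R) (t : R) : pt R := (a + b * t, d + e * t).
pose S a b d e : set R := [set t | 0 <= t <= 1 /\ That (c a b d e t)].
have neg a b d e : `|b| <= 1 -> `|e| <= 1 -> mu.-negligible ((F \o c a b d e) @` S a b d e).
  move=> b1 e1; apply: (@null_curve _ _ (L * 2)); [lra|by move=> t []|].
  move=> s t [_ Ss] [_ St].
  have h : L * (`|(c a b d e s).1 - (c a b d e t).1| + `|(c a b d e s).2 - (c a b d e t).2|) <= L * 2 * `|s - t|.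
    rewrite -mulrA; apply: ler_wpM2l; first exact: ltW.
    rewrite /c /=.
    rewrite (_ : a + b * s - (a + b * t) = b * (s - t)); last by ring.
    rewrite (_ : d + e * s - (d + e * t) = e * (s - t)); last by ring.
    by rewrite !normrM mulr_natl mulr2n lerD// ler_piMl.
  by have [h1 h2] := FL _ _ Ss St; split; [exact: le_trans h1 h|exact: le_trans h2 h].
have n1 : `|1 : R| <= 1 by rewrite normr1.
have n0 : `|0 : R| <= 1 by rewrite normr0.
have nm : `|-1 : R| <= 1 by rewrite normrN normr1.
have nh : `|- 2^-1 : R| <= 1 by rewrite normrN ger0_norm; lra.
(* In order: the sides x1 = 0, x2 = 0 and x1 + x2 = 1, then the medians x1 = x2, x1 = lam_2 and x2 =
   lam_2. The factors one half keep the parameter in [0, 1]. *)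
have Un := negligibleU (negligibleU (negligibleU (neg 0 0 0 1 n0 n1) (neg 0 1 0 0 n1 n0))
    (negligibleU (neg 0 1 1 (-1) n1 nm) (neg 2^-1 (- 2^-1) 2^-1 (- 2^-1) nh nh)))
   (negligibleU (neg 2^-1 (- 2^-1) 0 1 nh n1) (neg 0 1 2^-1 (- 2^-1) n1 nh)).
apply: negligibleS Un => _ [x [Tx nx] <-].
have inS a b d e t : 0 <= t <= 1 -> c a b d e t = x -> ((F \o c a b d e) @` S a b d e) (F x).
  by move=> t01 ex; exists t; [split => //; rewrite ex|rewrite /= ex].
have /ThatE l0 := Tx.
have la := l0 ord0; have lb := l0 (lift ord0 ord0); have lc := l0 (lift ord0 (lift ord0 ord0)).
rewrite /lam /= in la lb lc.
have [a0|a0] := eqVneq x.1 0.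
  left; left; left; apply: (inS _ _ _ _ x.2); first by lra.
  by apply: pt_eq; rewrite /c /= ?a0; ring.
have [b0|b0] := eqVneq x.2 0.
  left; left; right; apply: (inS _ _ _ _ x.1); first by lra.
  by apply: pt_eq; rewrite /c /= ?b0; ring.
have [c0|c0] := eqVneq (1 - x.1 - x.2) 0.
  left; right; left; apply: (inS _ _ _ _ x.1); first by lra.
  by apply: pt_eq; rewrite /c /=; lra.
have [ab|ab] := eqVneq x.1 x.2.
  left; right; right; apply: (inS _ _ _ _ (1 - x.1 - x.2)); first by lra.
  by apply: pt_eq; rewrite /c /=; lra.
have [ac|ac] := eqVneq x.1 (1 - x.1 - x.2).
  right; left; apply: (inS _ _ _ _ x.2); first by lra.
  by apply: pt_eq; rewrite /c /=; lra.
have [bc|bc] := eqVneq x.2 (1 - x.1 - x.2).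
  right; right; apply: (inS _ _ _ _ x.1); first by lra.
  by apply: pt_eq; rewrite /c /=; lra.
exfalso; apply: nx; split.
  by apply: ord3P; rewrite /lam /= lt_neqAle eq_sym ?a0 ?b0 ?c0.
by apply: ord3P; apply: ord3P; rewrite /lam /= ?eqxx// => _ //; rewrite eq_sym.
Qed.

End NullCurves.

(** * Transport of the approximation from the reference triangle to its image *)

Section Pull.
Variable R : realType.
Local Notation o0 := (@ord0 1).
Local Notation o1 := (lift (@ord0 1) (@ord0 0)).
Local Notation e_ := (@Defs.basis R).
Local Notation mu := (@mu R).
Variables (D : set (pt R)) (Fm Psi : pt R -> pt R) (beta : R).
Let Omega := Fm @` @open_tri R.
Let O := Fm @` @generic R.
Hypothesis mD : measurable (D : set (R * R)).
Hypothesis fD : (mu D < +oo)%E.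
Hypothesis oOm : open Omega.
Hypothesis OmD : Omega `<=` D°.
Hypothesis cF : continuous Fm.
Hypothesis FK : forall x, open_tri x -> Psi (Fm x) = x.
Hypothesis sPsi : forall i, smooth_on Omega (pcoord i \o Psi).
Hypothesis beta0 : 0 <= beta.
Hypothesis dPsi : forall y i j, Omega y -> `|partial j (pcoord i \o Psi) y| <= beta.
Hypothesis nO : mu.-negligible (D `\` O).

Variables (W : nat -> pt R -> R) (w : pt R -> R) (e : nat -> R) (B B1 : R).
Hypothesis B0 : 0 <= B.
Hypothesis B10 : 0 <= B1.
Hypothesis sW : forall n k, smoothn k (@open_tri R) (W n).
Hypothesis WB : forall n x, open_tri x -> `|W n x| <= B.
Hypothesis dWB : forall n x j, open_tri x -> `|partial j (W n) x| <= B1.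
Hypothesis e0 : forall n, 0 < e n.
Hypothesis Wsupp : forall n x, open_tri x -> W n x != 0 -> forall i, e n <= lam i x.
Hypothesis Ww : forall x, generic x -> \forall n \near \oo, \forall y \near x, W n y = w y.

Lemma generic_tri : @generic R `<=` @open_tri R.
Proof. by move=> x []. Qed.

Let OmPsi y : Omega y -> open_tri (Psi y) /\ Fm (Psi y) = y.
Proof. by move=> [x xt <-]; rewrite FK. Qed.

Let Psi_cont y : Omega y -> {for y, continuous Psi}.
Proof.
move=> Oy.
suff -> : Psi = (fun y => ((pcoord o0 \o Psi) y, (pcoord o1 \o Psi) y)).
  by apply: continuous_pair; exact: (sPsi _ [::] Oy).1.
by apply/funext => z; apply: pt_eq.
Qed.

(** Inside the open set [Omega] this is the preimage of [generic] under the continuous inverse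
    [Psi]. *)
Lemma Fm_generic_open : open O.
Proof.
rewrite openE => _ [x gx <-]; rewrite /interior.
have Ox : Omega (Fm x) by exists x => //; exact: generic_tri.
have n1 : \forall y \near Fm x, Omega y by exact: open_nbhs_nbhs.
have n2 : \forall y \near Fm x, generic (Psi y).
  apply: (Psi_cont Ox); rewrite FK; last exact: generic_tri.
  by apply: open_nbhs_nbhs; split => //; exact: generic_open.
apply: filterS2 n1 n2 => y Oy gy; exists (Psi y) => //; exact: (OmPsi Oy).2.
Qed.

(** [W n] vanishes unless every barycentric coordinate is at least [e n]. The image of that region
    is a compact subset of [Omega], so the extension by zero stays smooth. *)
Let phi n : pt R -> R := (W n \o Psi) \_ Omega.

Let phiE n y : Omega y -> phi n y = W n (Psi y).
Proof. by move=> Oy; rewrite /phi /patch mem_set. Qed.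

Let near_Om y : Omega y -> \forall z \near y, Omega z.
Proof. by move=> Oy; exact: open_nbhs_nbhs. Qed.

Let dcomp (f : pt R -> R) y j : smoothn 1 (@open_tri R) f -> Omega y ->
  partial j (f \o Psi) y =
  partial j (pcoord o0 \o Psi) y * partial o0 f (Psi y) + partial j (pcoord o1 \o Psi) y * partial o1 f (Psi y).
Proof.
move=> sf Oy; have Ty := (OmPsi Oy).1.
apply: (@derive_val _ _ _ _ _ _ _ (@is_derive_comp2 _ _ f Psi y (e_ j) (@open_tri_open R) Ty _ _ _)).
- by move=> z i Tz; exact: (smoothn_base sf Tz).2.
- by move=> i; have s1 : smoothn 0 (@open_tri R) (partial i f) := sf.2 i; exact: (smoothn_base s1 Ty).1.
- by move=> i; exact: (sPsi i [::] Oy).2.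
Qed.

Let phi_dE n y j : Omega y -> partial j (phi n) y =
  partial j (pcoord o0 \o Psi) y * partial o0 (W n) (Psi y) + partial j (pcoord o1 \o Psi) y * partial o1 (W n) (Psi y).
Proof.
move=> Oy; rewrite -(dcomp j (sW n 1) Oy); apply: near_eq_partial.
by apply: filterS (near_Om Oy) => z; exact: phiE.
Qed.

Let K n : set (pt R) := [set x | forall i, e n <= lam i x].

Let K_tri n : K n `<=` @open_tri R.
Proof. by move=> x h i; exact: lt_le_trans (e0 n) (h i). Qed.

Let FK_compact n : compact (Fm @` K n).
Proof.
apply: continuous_compact; first exact: continuous_subspaceT.
apply: (subclosed_compact _ (@That_compact R)).
  rewrite (_ : K n = ~` [set x | exists i, lam i x < e n]).
    apply: open_closedC.
    have -> : [set x | exists i, lam i x < e n] = \bigcup_i [set x | lam i x < e n].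
      by apply/seteqP; split => x /= [i]; [move=> h; exists i|move=> _ h; exists i].
    apply: bigcup_open => i _; apply: open_lt_fun; first exact: lam_cont.
    by move=> x; exact: cvg_cst.
  apply/seteqP; split => x /=.
    by move=> h [i]; rewrite ltNge h.
  by move=> h i; rewrite leNgt; apply/negP => xi; apply: h; exists i.
by move=> x h; apply/ThatE => i; exact: ltW (lt_le_trans (e0 n) (h i)).
Qed.

Let phi0 n y : ~ (Fm @` K n) y -> phi n y = 0.
Proof.
move=> ny; have [Oy|Oy] := pselect (Omega y); last by rewrite /phi /patch memNset.
rewrite phiE//; have [Ty E] := OmPsi Oy.
apply/eqP; apply: contrapT => /negP Wn; apply: ny; exists (Psi y) => //.
exact: Wsupp Wn.
Qed.

Let FK_closed n : closed (Fm @` K n).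
Proof. by apply: compact_closed; [exact: norm_hausdorff|exact: FK_compact]. Qed.

Let supp_sub n : closure [set x | phi n x != 0] `<=` Fm @` K n.
Proof.
rewrite [X in _ `<=` X](closure_id _).1//; apply: closure_subset => y /=.
by move=> /eqP py; apply: contrapT => /phi0.
Qed.

Let phi_test n : test_fun D (phi n).
Proof.
split.
  apply/smooth_onP => k; apply: smoothn_local => y _.
  have [Oy|Oy] := pselect (Omega y).
    exists Omega, (W n \o Psi); split=> //; last by move=> z; exact: phiE.
    apply: (smoothn_comp (W := @open_tri R)) => //; first exact: open_tri_open.
      by move=> z /OmPsi[].
    by move=> i; move: k; exact/smooth_onP.
  exists (~` (Fm @` K n)), (cst 0); split=> //.
  - exact: closed_openC.
  - by move=> [x Kx xy]; apply: Oy; exists x => //; exact: (K_tri Kx).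
  - exact: smoothn_cst.
  - by move=> z; exact: phi0.
have sub := @supp_sub n.
split; first by apply: (subclosed_compact _ (FK_compact (n := n))) => //; exact: closed_closure.
by move=> y /sub [x Kx xy]; apply: OmD; exists x => //; exact: (K_tri Kx).
Qed.

Let phiB n y : `|phi n y| <= B.
Proof.
have [Oy|Oy] := pselect (Omega y); last by rewrite /phi /patch memNset// normr0.
by rewrite phiE// WB//; exact: (OmPsi Oy).1.
Qed.

Let dphiB n y j : `|partial j (phi n) y| <= 2 * (beta * B1).
Proof.
have [Oy|Oy] := pselect (Omega y).
  rewrite phi_dE// (le_trans (ler_normD _ _))// !normrM mulr_natl mulr2n.
  by have Ty := (OmPsi Oy).1; rewrite lerD// ler_pM//; [exact: dPsi|exact: dWB|exact: dPsi|exact: dWB].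
rewrite (@supp_partial _ (phi n) y j _).2 ?normr0 ?mulr_ge0//.
move=> cy; apply: Oy.
by have [x Kx xy] := supp_sub cy; exists x => //; exact: (K_tri Kx).
Qed.

Variables (u : pt R -> R) (Bu : R).
Hypothesis mu_ : measurable_fun (D : set (R * R)) u.
Hypothesis uB : forall x, D x -> `|u x| <= Bu.
Hypothesis uw : forall x, O x -> u x = w (Psi x).

Let phiu y : O y -> \forall n \near \oo, \forall z \near y, phi n z = u z.
Proof.
move=> Oy; have oO := Fm_generic_open.
have nO' : \forall z \near y, O z by exact: open_nbhs_nbhs.
have [x gx xy] := Oy.
have Omy : Omega y by exists x => //; exact: generic_tri.
apply: filterS (Ww gx) => n nx.
have n2 : \forall z \near y, W n (Psi z) = w (Psi z).
  have H : nbhs (Psi y) [set x | W n x = w x] by rewrite -xy FK//; exact: generic_tri.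
  exact: (Psi_cont Omy H).
apply: filterS2 nO' n2 => z Oz E; rewrite uw// -E phiE//.
by have [a ga az] := Oz; exists a => //; exact: generic_tri.
Qed.

(** The approximation lemmas ask for one constant bounding both [u] and the test functions. *)
Let uB' x : D x -> `|u x| <= B + Bu.
Proof. by move=> Dx; rewrite (le_trans (uB Dx))// lerDr. Qed.

Let Bu0 x : D x -> 0 <= Bu.
Proof. by move=> Dx; exact: le_trans (uB Dx). Qed.

Let phiB' n x : D x -> `|phi n x| <= B + Bu.
Proof. by move=> Dx; rewrite (le_trans (phiB n x))// lerDl; exact: Bu0 Dx. Qed.

Let bb0 : 0 <= 2 * (beta * B1).
Proof. by rewrite !mulr_ge0. Qed.

Let dphiB' n x j : D x -> `|partial j (phi n) x| <= 2 * (beta * B1).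
Proof. by move=> _; exact: dphiB. Qed.

Lemma pull_weak : weak_grad D u (broken_grad O u).
Proof. exact: (broken_grad_weak bb0 mD fD Fm_generic_open nO mu_ uB' phi_test phiB' dphiB' phiu). Qed.

Lemma pull_H10 : in_H10 D u.
Proof. exact: (broken_grad_H10 bb0 mD fD Fm_generic_open nO mu_ uB' phi_test phiB' dphiB' phiu). Qed.

Lemma pull_bound j x : D x -> `|broken_grad O u x 0 j| <= 2 * (beta * B1).
Proof. exact: (broken_grad_bound bb0 dphiB' phiu). Qed.

Lemma pull_integral j : \int[mu]_(x in D) broken_grad O u x 0 j = 0.
Proof. exact: (broken_grad_integral mD fD Fm_generic_open nO phi_test dphiB' phiu). Qed.

(** The chain rule is available for the smooth [W n] only; it passes to [w] and [u] because for
    large [n] both agree with the approximants near the point. *)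
Lemma pull_grad j x : generic x -> broken_grad O u (Fm x) 0 j =
  partial j (pcoord o0 \o Psi) (Fm x) * partial o0 w x + partial j (pcoord o1 \o Psi) (Fm x) * partial o1 w x.
Proof.
move=> gx; have Ox : O (Fm x) by exists x.
have Omx : Omega (Fm x) by exists x => //; exact: generic_tri.
rewrite mxE /patch mem_set//.
have [n _ /(_ n (leqnn n)) nu] := phiu Ox.
have [m _ nw] := Ww gx.
have [k _ nk] := phiu Ox.
have /nw wn := leq_maxl m k; have /nk un := leq_maxr m k.
rewrite -(near_eq_partial j un) phi_dE// FK; last exact: generic_tri.
by rewrite !(near_eq_partial _ wn).
Qed.

End Pull.

(** * Computing both partial derivatives at once *)

Section PartialPairs.
Variable R : realType.
Local Notation o0 := (@ord0 1).
Local Notation o1 := (lift (@ord0 1) (@ord0 0)).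
Local Notation e_ := (@Defs.basis R).
Implicit Types (f g : pt R -> R) (x : pt R) (a b : R).

(** Derivability and the values of both partials travel together, so that a gradient is computed by
    composing rules and closed by [ring] or [field]. *)
Definition pd f x a b := is_derive x (e_ o0) f a /\ is_derive x (e_ o1) f b.

Lemma pd_derivable f x a b i : pd f x a b -> derivable f x (e_ i).
Proof. by move=> [[d0 _] [d1 _]]; move: i; exact: ord2P. Qed.

Lemma pd0 f x a b : pd f x a b -> partial o0 f x = a.
Proof. by move=> [[_ d0] _]. Qed.

Lemma pd1 f x a b : pd f x a b -> partial o1 f x = b.
Proof. by move=> [_ [_ d1]]. Qed.

Lemma pd_partial f x : (forall i, derivable f x (e_ i)) -> pd f x (partial o0 f x) (partial o1 f x).
Proof. by move=> d; split; apply: DeriveDef. Qed.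

Lemma pd_eq f x a b a' b' : pd f x a b -> a = a' -> b = b' -> pd f x a' b'.
Proof. by move=> h <- <-. Qed.

Lemma pd_near f g x a b : (\near x, f x = g x) -> pd f x a b -> pd g x a b.
Proof. by move=> fg [d0 d1]; split; exact: near_eq_is_derive fg _. Qed.

Lemma pd_cst (c : R) x : pd (cst c) x 0 0.
Proof. by split; exact: is_derive_cst. Qed.

Lemma is_deriveDfun (V : normedModType R) (f g : V -> R) (x v : V) (a b : R) :
  is_derive x v f a -> is_derive x v g b -> is_derive x v (fun y => f y + g y) (a + b).
Proof. by move=> df dg; exact: is_deriveD. Qed.

Lemma is_deriveMfun (V : normedModType R) (f g : V -> R) (x v : V) (a b : R) :
  is_derive x v f a -> is_derive x v g b -> is_derive x v (fun y => f y * g y) (f x * b + g x * a).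
Proof. by move=> df dg; exact: is_deriveM. Qed.

Lemma is_deriveVfun (V : normedModType R) (f : V -> R) (x v : V) (a : R) :
  f x != 0 -> is_derive x v f a -> is_derive x v (fun y => (f y)^-1) (- f x ^- 2 * a).
Proof.
move=> f0 [df dfE]; have dV : is_derive (f x) 1 (fun t : R => t^-1) (- f x ^- 2).
  apply: is_derive_eq; first exact: is_deriveV.
  by rewrite [_ *: _]mulr1.
by rewrite -dfE; exact: (@is_derive_comp1 _ _ (fun t : R => t^-1)).
Qed.

Lemma pdD f g x a b a' b' : pd f x a b -> pd g x a' b' -> pd (fun y => f y + g y) x (a + a') (b + b').
Proof. by move=> [f0 f1] [g0 g1]; split; exact: is_deriveDfun. Qed.

Lemma pdM f g x a b a' b' : pd f x a b -> pd g x a' b' ->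
  pd (fun y => f y * g y) x (f x * a' + g x * a) (f x * b' + g x * b).
Proof. by move=> [f0 f1] [g0 g1]; split; exact: is_deriveMfun. Qed.

Lemma pdV f x a b : f x != 0 -> pd f x a b -> pd (fun y => (f y)^-1) x (- f x ^- 2 * a) (- f x ^- 2 * b).
Proof. by move=> fx [f0 f1]; split; exact: is_deriveVfun. Qed.

Lemma pd_coord0 x : pd (fun y => y.1) x 1 0.
Proof. by split; [exact: (is_derive_coord o0 x (e_ o0))|exact: (is_derive_coord o0 x (e_ o1))]. Qed.

Lemma pd_coord1 x : pd (fun y => y.2) x 0 1.
Proof. by split; [exact: (is_derive_coord o1 x (e_ o0))|exact: (is_derive_coord o1 x (e_ o1))]. Qed.

Definition aff (a b c : R) x : R := a + b * x.1 + c * x.2.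

Lemma pd_aff a b c x : pd (aff a b c) x b c.
Proof.
have := pdD (pdD (pd_cst a x) (pdM (pd_cst b x) (pd_coord0 x))) (pdM (pd_cst c x) (pd_coord1 x)).
by move=> h; apply: (pd_eq h); rewrite /=; ring.
Qed.

Lemma smoothn_aff n U a b c : open U -> smoothn n U (aff a b c).
Proof.
move=> oU; have s0 : smoothn n U (fun y : pt R => y.1) := smoothn_coord n U o0.
have s1 : smoothn n U (fun y : pt R => y.2) := smoothn_coord n U o1.
have sc d : smoothn n U (fun _ : pt R => d) := smoothn_cst n U d.
apply: smoothnD => //; last exact: smoothnM.
by apply: smoothnD => //; exact: smoothnM.
Qed.

Lemma lam_aff (i : 'I_3) : exists a b c, [/\ @lam R i = aff a b c, `|a| <= 1, `|b| <= 1 & `|c| <= 1].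
Proof.
have n1 : `|1 : R| <= 1 by rewrite normr1.
have n0 : `|0 : R| <= 1 by rewrite normr0.
have nm : `|-1 : R| <= 1 by rewrite normrN normr1.
move: i; apply: ord3P.
- by exists 0, 1, 0; split=> //; apply/funext => x; rewrite /lam /aff /=; ring.
- by exists 0, 0, 1; split=> //; apply/funext => x; rewrite /lam /aff /=; ring.
- by exists 1, (-1), (-1); split=> //; apply/funext => x; rewrite /lam /aff /=; ring.
Qed.

Lemma open_tri_norm x : open_tri x -> (0 < x.1 /\ x.1 < 1) /\ (0 < x.2 /\ x.2 < 1).
Proof.
move=> h; have := h ord0; have := h (lift ord0 ord0); have := h (lift ord0 (lift ord0 ord0)).
by rewrite /lam /= => a b c; split; lra.
Qed.

Lemma aff_bound (a b c Q : R) x : `|a| <= Q -> `|b| <= Q -> `|c| <= Q -> open_tri x ->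
  `|aff a b c x| <= 3 * Q.
Proof.
move=> aQ bQ cQ /open_tri_norm[[x0 x1] [y0 y1]].
rewrite /aff (le_trans (ler_normD _ _))//.
have h1 : `|a + b * x.1| <= 2 * Q.
  rewrite (le_trans (ler_normD _ _))// mulr_natl mulr2n lerD// normrM (gtr0_norm x0).
  by rewrite (le_trans _ bQ)// ler_piMr// ltW.
have h2 : `|c * x.2| <= Q.
  by rewrite normrM (gtr0_norm y0) (le_trans _ cQ)// ler_piMr// ltW.
lra.
Qed.

Lemma lam_bound (i : 'I_3) x : open_tri x -> `|lam i x| <= 1.
Proof.
move=> Tx; have [[x0 x1] [y0 y1]] := open_tri_norm Tx; rewrite (gtr0_norm (Tx i)).
by have := Tx (lift ord0 (lift ord0 ord0)); move: i; apply: ord3P; rewrite /lam /=; lra.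
Qed.

End PartialPairs.

Section ReferenceMin.
Variable R : realType.
Local Notation e_ := (@Defs.basis R).
Local Notation i0 := (@ord0 2).
Local Notation i1 := (lift (@ord0 2) (@ord0 1)).
Local Notation i2 := (lift (@ord0 2) (lift (@ord0 1) (@ord0 0))).
Implicit Types (x : pt R).

Definition min_lam x : R := Num.min (Num.min (lam i0 x) (lam i1 x)) (lam i2 x).

Definition min_mol (e : R) x : R := smin3 e (lam i0 x) (lam i1 x) (lam i2 x).

Lemma min_lam_le x k : (forall i, lam k x <= lam i x) -> min_lam x = lam k x.
Proof.
move=> h; apply/eqP; rewrite eq_le; apply/andP; split; last by rewrite /min_lam !le_min !h.
by rewrite /min_lam; move: k h; apply: ord3P => h; rewrite !ge_min lexx ?orbT.
Qed.

Lemma min_lam_ct x k : ct_open k x -> \forall y \near x, min_lam y = lam k y.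
Proof.
move=> xk; apply: (@filterS _ _ _ (ct_open k)); last first.
  by apply: open_nbhs_nbhs; split => //; exact: ct_open_open.
move=> y [y0 yk]; apply: min_lam_le => i.
by have [->//|ik] := eqVneq i k; exact: ltW (yk i ik).
Qed.

Lemma min_mol_supp e x : 0 < e -> min_mol e x != 0 -> forall i, e <= lam i x.
Proof. by move=> e0 /(smin3_supp e0)[h0 h1 h2]; exact: ord3P. Qed.

Lemma min_mol_bound e x : 0 < e -> open_tri x -> `|min_mol e x| <= 7.
Proof. by move=> e0 Tx; apply: smin3_norm => //; exact: lam_bound. Qed.

Lemma smoothn_lam n U i : open U -> smoothn n U (@lam R i).
Proof. by move=> oU; have [a [b [c [-> _ _ _]]]] := lam_aff R i; exact: smoothn_aff. Qed.

Lemma smoothn_min_mol n U e : open U -> smoothn n U (min_mol e).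
Proof. by move=> oU; apply: smoothn_smin3 => //; exact: smoothn_lam. Qed.

Lemma partial_lam_bound i j x : derivable (@lam R i) x (e_ j) /\ `|partial j (@lam R i) x| <= 1.
Proof.
have [a [b [c [-> _ b1 c1]]]] := lam_aff R i; have d := pd_aff a b c x.
split; first exact: pd_derivable d.
by move: j; apply: ord2P; rewrite ?(pd0 d) ?(pd1 d).
Qed.

Lemma min_mol_partial : exists2 L : R, 0 < L &
  forall e x j, 0 < e -> `|partial j (min_mol e) x| <= L.
Proof.
have [L L0 LT] := @Theta_deriv R.
exists (L * (1 + 4 * L + 2 * L ^+ 2)).
  rewrite mulr_gt0//.
  have : 0 < L ^+ 2 by rewrite exprn_gt0.
  lra.
move=> e x j e0.
have [d0 b0] := partial_lam_bound i0 j x; have [d1 b1] := partial_lam_bound i1 j x.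
have [d2 b2] := partial_lam_bound i2 j x.
by have [_] := derive_smin3 LT e0 d0 d1 d2 b0 b1 b2; rewrite mulr1.
Qed.

Lemma min_mol_near x : generic x ->
  \forall n \near \oo, \forall y \near x, min_mol (n.+1%:R^-1) y = min_lam y.
Proof.
move=> [Tx gx].
(* Half of the smallest coordinate or gap: the strict inequalities then hold on a neighbourhood, and
   [smin3E] applies there as soon as 6/(n+1) is at most d. *)
have [d d0 dx] : exists2 d : R, 0 < d & (forall i, d < lam i x) /\ (forall i j, i != j -> d < `|lam i x - lam j x|).
  pose D : R := Num.min (Num.min (Num.min (lam i0 x) (lam i1 x)) (lam i2 x))
    (Num.min (Num.min `|lam i0 x - lam i1 x| `|lam i0 x - lam i2 x|) `|lam i1 x - lam i2 x|).
  have D0 : 0 < D.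
    by rewrite /D !lt_min !Tx/= !normr_gt0 !subr_eq0 !gx.
  exists (D / 2); first by rewrite divr_gt0.
  have D2 : D / 2 < D by lra.
  split=> [i|i j ij]; apply: (lt_le_trans D2); rewrite /D.
    by move: i; apply: ord3P; rewrite !ge_min lexx ?orbT.
  by move: i j ij; apply: ord3P; apply: ord3P => //= _; rewrite !ge_min ?lexx ?orbT//
    -?[`|lam i1 x - lam i0 x|]distrC -?[`|lam i2 x - lam i0 x|]distrC -?[`|lam i2 x - lam i1 x|]distrC ?lexx ?orbT.
have nx : \forall y \near x, (forall i, d < lam i y) /\ (forall i j, i != j -> d < `|lam i y - lam j y|).
  apply: open_nbhs_nbhs; split=> //; apply: openI.
    apply: (@open_forall3 _ (fun i => [set y | d < lam i y])) => i.
    by apply: open_lt_fun; [move=> y; exact: cvg_cst|exact: lam_cont].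
  apply: (@open_forall3 _ (fun i => [set y | forall j, i != j -> d < `|lam i y - lam j y|])) => i.
  apply: (@open_forall3 _ (fun j => [set y | i != j -> d < `|lam i y - lam j y|])) => j.
  apply: (@open_imp _ [set y | d < `|lam i y - lam j y|]); apply: open_lt_fun.
    by move=> y; exact: cvg_cst.
  by move=> y; apply: cvg_norm; apply: cvgB; exact: lam_cont.
exists (Num.trunc (6 / d)).+1 => // n /= nd.
have nn : 6 / d < n%:R.
  by apply: lt_le_trans (_ : (Num.trunc (6 / d)).+1%:R <= _); [exact: truncnS_gt|rewrite ler_nat].
have e0 : 0 < n.+1%:R^-1 :> R by rewrite invr_gt0 ltr0n.
have ed : 6 * n.+1%:R^-1 <= d.
  rewrite ler_pdivrMr ?ltr0n// mulrC -ler_pdivrMr// (le_trans (ltW nn))// ler_nat//.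
apply: filterS nx => y [h1 h2].
have hl i : 6 * n.+1%:R^-1 <= lam i y by exact: le_trans ed (ltW (h1 i)).
have hd i j : i != j -> 2 * n.+1%:R^-1 <= `|lam i y - lam j y|.
  by move=> /h2; move: (n.+1%:R^-1) e0 ed => z z0 zd; lra.
by apply: smin3E => //; exact: hd.
Qed.

End ReferenceMin.

(** * Bubbles and the divergence equation *)

Section Bubbles.
Variable R : realType.
Local Notation o0 := (@ord0 1).
Local Notation o1 := (lift (@ord0 1) (@ord0 0)).
Local Notation i0 := (@ord0 2).
Local Notation i1 := (lift (@ord0 2) (@ord0 1)).
Local Notation i2 := (lift (@ord0 2) (lift (@ord0 1) (@ord0 0))).
Implicit Types (x : pt R) (a b c g Q : R).

Definition bubble a b c g x : R := min_lam x * (aff a b c x + g * min_lam x).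

Definition bubble_mol a b c g (e : R) x : R := min_mol e x * (aff a b c x + g * min_mol e x).

Lemma smoothn_bubble_mol n U a b c g e : open U -> smoothn n U (bubble_mol a b c g e).
Proof.
move=> oU; have sm := smoothn_min_mol n e oU.
apply: smoothnM => //; apply: smoothnD => //; first exact: smoothn_aff.
by apply: smoothnM => //; exact: smoothn_cst.
Qed.

(** The affine part is at most 3 Q and the mollified minimum at most 7, whence 3 + 7 = 10 and 7 * 10
    = 70. *)
Lemma bubble_mol_bound a b c g e Q x : 0 < e -> `|a| <= Q -> `|b| <= Q -> `|c| <= Q -> `|g| <= Q ->
  open_tri x -> `|aff a b c x + g * min_mol e x| <= 10 * Q /\ `|bubble_mol a b c g e x| <= 70 * Q.
Proof.
move=> e0 aQ bQ cQ gQ Tx; have M7 := min_mol_bound e0 Tx.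
have h : `|aff a b c x + g * min_mol e x| <= 10 * Q.
  rewrite (le_trans (ler_normD _ _))//.
  have h1 := aff_bound aQ bQ cQ Tx.
  have h2 : `|g * min_mol e x| <= Q * 7 by rewrite normrM ler_pM.
  lra.
split=> //; rewrite /bubble_mol normrM.
have -> : 70 * Q = 7 * (10 * Q) by ring.
by rewrite ler_pM.
Qed.

(** By the product rule the bound is 7 (Q + Q L) + 10 Q L. *)
Lemma bubble_mol_partial a b c g e Q L x j : 0 < e -> 0 <= L -> `|a| <= Q -> `|b| <= Q -> `|c| <= Q -> `|g| <= Q ->
  (forall j, `|partial j (min_mol e) x| <= L) ->
  open_tri x -> `|partial j (bubble_mol a b c g e) x| <= (17 * L + 7) * Q.
Proof.
move=> e0 L0 aQ bQ cQ gQ ML Tx.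
have [h1 _] := bubble_mol_bound e0 aQ bQ cQ gQ Tx.
have M7 := min_mol_bound e0 Tx.
have dM : pd (min_mol e) x (partial o0 (min_mol e) x) (partial o1 (min_mol e) x).
  apply: pd_partial => i.
  exact: (smoothn_base (smoothn_min_mol 0 e openT) I).2.
have d := pdM dM (pdD (pd_aff a b c x) (pdM (pd_cst g x) dM)).
have key (r s : R) : `|r| <= Q -> `|s| <= L ->
  `|min_mol e x * (r + (g * s + min_mol e x * 0)) + (aff a b c x + g * min_mol e x) * s| <= (17 * L + 7) * Q.
  move=> rQ sL; have Q0 : 0 <= Q by exact: le_trans rQ.
  have e1 : `|r + (g * s + min_mol e x * 0)| <= Q + Q * L.
    by rewrite mulr0 addr0 (le_trans (ler_normD _ _))// lerD// normrM ler_pM.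
  have e2 : `|min_mol e x * (r + (g * s + min_mol e x * 0))| <= 7 * (Q + Q * L) by rewrite normrM ler_pM.
  have e3 : `|(aff a b c x + g * min_mol e x) * s| <= (10 * Q) * L by rewrite normrM ler_pM.
  rewrite (le_trans (ler_normD _ _))// (le_trans (lerD e2 e3))// le_eqVlt; apply/orP; left; apply/eqP; ring.
by move: j; apply: ord2P; rewrite ?(pd0 d) ?(pd1 d) key.
Qed.

Lemma bubble_mol_supp a b c g e x : 0 < e -> bubble_mol a b c g e x != 0 -> forall i, e <= lam i x.
Proof.
move=> e0 h; apply: min_mol_supp => //; apply: contraNN h => /eqP h.
by rewrite /bubble_mol h mul0r.
Qed.

Lemma bubble_mol_near a b c g x : generic x -> \forall n \near \oo, \forall y \near x,
  bubble_mol a b c g (n.+1%:R^-1) y = bubble a b c g y.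
Proof.
move=> gx; apply: filterS (min_mol_near gx) => n; apply: filterS => y E.
by rewrite /bubble_mol E.
Qed.

Lemma min_lam_cont : continuous (@min_lam R).
Proof.
move=> x; rewrite /min_lam.
apply: (@continuous_min _ _ (fun x => Num.min (lam i0 x) (lam i1 x)) (@lam R i2)); last exact: lam_cont.
by apply: (@continuous_min _ _ (@lam R i0) (@lam R i1)); exact: lam_cont.
Qed.

Lemma aff_cont a b c : continuous (aff a b c).
Proof. by move=> x; exact: (smoothn_base (smoothn_aff 0 a b c openT) I).1. Qed.

Lemma bubble_cont a b c g : continuous (bubble a b c g).
Proof.
move=> x; apply: (@continuousM _ _ (@min_lam R) (fun y => aff a b c y + g * min_lam y)); first exact: min_lam_cont.
apply: (@continuousD _ _ _ (aff a b c) (fun y => g * min_lam y)); first exact: aff_cont.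
by apply: (@continuousM _ _ (cst g) (@min_lam R)); [exact: cvg_cst|exact: min_lam_cont].
Qed.

Lemma pd_bubble k a b c g x al be ga : ct_open k x -> lam k = aff al be ga ->
  pd (bubble a b c g) x
    (lam k x * (b + g * be) + (aff a b c x + g * lam k x) * be)
    (lam k x * (c + g * ga) + (aff a b c x + g * lam k x) * ga).
Proof.
move=> xk E.
have dl : pd (lam k) x be ga by rewrite E; exact: pd_aff.
have d := pdM dl (pdD (pd_aff a b c x) (pdM (pd_cst g x) dl)).
apply: (@pd_near _ (fun y => lam k y * (aff a b c y + g * lam k y))).
  by apply: filterS (min_lam_ct xk) => y e; rewrite /bubble e.
by apply: (pd_eq d); rewrite mulr0 addr0.
Qed.

Section DivergenceSolution.
Variables (a b c : 'I_3 -> R).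
Let A := a i0 + a i1 + a i2.
Let B := b i0 + b i1 + b i2.
Let C := c i0 + c i1 + c i2.
(* With gamma_k = grad (lam k) . g, P_k = grad (lam k) . p and delta = div p, the divergence of m (p + g m) on the
   k-th triangle is P_k + lam k (delta + 2 gamma_k); summing over k isolates gamma, then delta, then kappa. *)
Definition sol_g0 : R := (2 * B - C) / 6.
Definition sol_g1 : R := (2 * C - B) / 6.
Definition sol_delta : R := (b i0 + c i1 - 2 * (sol_g0 + sol_g1)) / 3.
Definition sol_kappa : R := (A + (B + C) / 3 - sol_delta) / 3.

Definition sol0 : pt R -> R := bubble (a i0 - sol_kappa) (b i0 - sol_delta - 2 * sol_g0) (c i0) sol_g0.
Definition sol1 : pt R -> R := bubble (a i1 - sol_kappa) (b i1) (c i1 - sol_delta - 2 * sol_g1) sol_g1.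

(** The components of p are read off from the pieces 0 and 1. On piece 2 nothing is left to choose:
    the P_k sum to zero, so its equation follows from the summed one, which fixed g and kappa, once
    delta is the divergence of p. *)
Lemma pd_sol k x : ct_open k x -> exists u0x u0y u1x u1y,
  [/\ pd sol0 x u0x u0y, pd sol1 x u1x u1y & u0x + u1y = aff (a k) (b k) (c k) x - sol_kappa].
Proof.
have e0 : lam i0 = aff 0 1 0 :> (pt R -> R) by apply/funext => y; rewrite /lam /aff /=; ring.
have e1 : lam i1 = aff 0 0 1 :> (pt R -> R) by apply/funext => y; rewrite /lam /aff /=; ring.
have e2 : lam i2 = aff 1 (-1) (-1) :> (pt R -> R) by apply/funext => y; rewrite /lam /aff /=; ring.
move=> xk; move: k xk; apply: ord3P => xk;
  [have d0 := pd_bubble (a i0 - sol_kappa) (b i0 - sol_delta - 2 * sol_g0) (c i0) sol_g0 xk e0;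
   have d1 := pd_bubble (a i1 - sol_kappa) (b i1) (c i1 - sol_delta - 2 * sol_g1) sol_g1 xk e0
  |have d0 := pd_bubble (a i0 - sol_kappa) (b i0 - sol_delta - 2 * sol_g0) (c i0) sol_g0 xk e1;
   have d1 := pd_bubble (a i1 - sol_kappa) (b i1) (c i1 - sol_delta - 2 * sol_g1) sol_g1 xk e1
  |have d0 := pd_bubble (a i0 - sol_kappa) (b i0 - sol_delta - 2 * sol_g0) (c i0) sol_g0 xk e2;
   have d1 := pd_bubble (a i1 - sol_kappa) (b i1) (c i1 - sol_delta - 2 * sol_g1) sol_g1 xk e2];
  do 4 eexists; (split; [exact: d0|exact: d1|]);
  rewrite /lam /aff /sol_kappa /sol_delta /sol_g0 /sol_g1 /A /B /C /=;
  by move: (a i0) (a i1) (a i2) (b i0) (b i1) (b i2) (c i0) (c i1) (c i2) (x.1) (x.2) => *; field.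
Qed.

Lemma sol_bound Q : (forall k, `|a k| <= Q) -> (forall k, `|b k| <= Q) -> (forall k, `|c k| <= Q) ->
  [/\ `|a i0 - sol_kappa| <= 10 * Q, `|b i0 - sol_delta - 2 * sol_g0| <= 10 * Q, `|c i0| <= 10 * Q & `|sol_g0| <= 10 * Q] /\
  [/\ `|a i1 - sol_kappa| <= 10 * Q, `|b i1| <= 10 * Q, `|c i1 - sol_delta - 2 * sol_g1| <= 10 * Q & `|sol_g1| <= 10 * Q].
Proof.
move=> aQ bQ cQ.
have := aQ i0; have := aQ i1; have := aQ i2; have := bQ i0; have := bQ i1; have := bQ i2; have := cQ i0; have := cQ i1; have := cQ i2.
rewrite /sol_kappa /sol_delta /sol_g0 /sol_g1 /A /B /C.
move: (a i0) (a i1) (a i2) (b i0) (b i1) (b i2) (c i0) (c i1) (c i2) => a0 a1 a2 b0 b1 b2 c0 c1 c2.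
rewrite !ler_norml => /andP[? ?] /andP[? ?] /andP[? ?] /andP[? ?] /andP[? ?] /andP[? ?] /andP[? ?] /andP[? ?] /andP[? ?].
by split; split; apply/andP; split; lra.
Qed.

End DivergenceSolution.

Lemma sum_degree2 (F : nat -> nat -> R) :
  \sum_(i < 3) \sum_(j < 3 | (i + j <= 2)%N) F i j =
  F 0%N 0%N + F 1%N 0%N + F 0%N 1%N + F 2%N 0%N + F 1%N 1%N + F 0%N 2%N.
Proof.
have inner (i : nat) : \sum_(j < 3 | (i + j <= 2)%N) F i j =
  (if (i + 0 <= 2)%N then F i 0%N else 0) + ((if (i + 1 <= 2)%N then F i 1%N else 0) + ((if (i + 2 <= 2)%N then F i 2%N else 0) + 0)).
  by rewrite big_mkcond !big_ord_recl big_ord0.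
under eq_bigr do rewrite inner.
by rewrite !big_ord_recl big_ord0 /=; ring.
Qed.

Lemma sum_degree1 (F : nat -> nat -> R) :
  \sum_(i < 2) \sum_(j < 2 | (i + j <= 1)%N) F i j = F 0%N 0%N + F 1%N 0%N + F 0%N 1%N.
Proof.
have inner (i : nat) : \sum_(j < 2 | (i + j <= 1)%N) F i j =
  (if (i + 0 <= 1)%N then F i 0%N else 0) + ((if (i + 1 <= 1)%N then F i 1%N else 0) + 0).
  by rewrite big_mkcond !big_ord_recl big_ord0.
under eq_bigr do rewrite inner.
by rewrite !big_ord_recl big_ord0 /=; ring.
Qed.

Lemma poly2P (D : set (pt R)) (f : pt R -> R) : poly_on 2 D f <-> exists c00 c10 c01 c20 c11 c02 : R,
  forall x, D x -> f x = c00 + c10 * x.1 + c01 * x.2 + c20 * x.1 ^+ 2 + c11 * x.1 * x.2 + c02 * x.2 ^+ 2.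
Proof.
split=> [[c fc]|[c00 [c10 [c01 [c20 [c11 [c02 h]]]]]]].
  exists (c 0 0)%N, (c 1 0)%N, (c 0 1)%N, (c 2 0)%N, (c 1 1)%N, (c 0 2)%N => x Dx.
  by rewrite fc// (sum_degree2 (fun i j => c i j * x.1 ^+ i * x.2 ^+ j)); ring.
exists (fun i j => nth 0 (nth [::] [:: [:: c00; c01; c02]; [:: c10; c11]; [:: c20]] i) j) => x Dx.
rewrite h// (sum_degree2 (fun i j => nth 0 (nth [::] [:: [:: c00; c01; c02]; [:: c10; c11]; [:: c20]] i) j * x.1 ^+ i * x.2 ^+ j)) /=.
by ring.
Qed.

Lemma poly1P (D : set (pt R)) (f : pt R -> R) : poly_on 1 D f -> exists a b c : R,
  forall x, D x -> f x = aff a b c x.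
Proof.
move=> [c fc]; exists (c 0 0)%N, (c 1 0)%N, (c 0 1)%N => x Dx.
by rewrite fc// (sum_degree1 (fun i j => c i j * x.1 ^+ i * x.2 ^+ j)) /aff; ring.
Qed.

Lemma bubble_poly k a b c g : poly_on 2 (hull (ct (@ref_tri R) k))° (bubble a b c g).
Proof.
apply/poly2P.
have E x : (hull (ct (@ref_tri R) k))° x -> bubble a b c g x = lam k x * (aff a b c x + g * lam k x).
  by move=> /interior_subset/ct_hull h; rewrite /bubble (min_lam_le h).
move: k E; apply: ord3P => E.
- by exists 0, a, 0, (b + g), c, 0 => x /E ->; rewrite /lam /aff /=; ring.
- by exists 0, 0, a, 0, b, (c + g) => x /E ->; rewrite /lam /aff /=; ring.
- exists (a + g), (b - g - (a + g)), (c - g - (a + g)), (- (b - g)), (- (b - g) - (c - g)), (- (c - g)) => x /E ->.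
  by rewrite /lam /aff /=; ring.
Qed.

End Bubbles.

Section ReferenceBubble.
Variable R : realType.
Local Notation o0 := (@ord0 1).
Local Notation o1 := (lift (@ord0 1) (@ord0 0)).
Local Notation mu := (@mu R).
Implicit Types (x : pt R).

Lemma That_measurable : measurable (@That R : set (R * R)).
Proof. by apply: compact_measurable_pt; exact: That_compact. Qed.

Lemma That_box : @That R `<=` `[0, 1]%classic `*` `[0, 1]%classic.
Proof.
move=> x /ThatE h; have := h ord0; have := h (lift ord0 ord0); have := h (lift ord0 (lift ord0 ord0)).
by rewrite /lam /= => a b c; split; rewrite /= in_itv/=; lra.
Qed.

Lemma That_finite : (mu (@That R) < +oo)%E.
Proof.
pose S : set (R * R) := `[0, 1]%classic `*` `[0, 1]%classic.
have h : (mu (@That R) <= mu S)%E.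
  apply: le_measure; rewrite ?inE; [exact: That_measurable| |exact: That_box].
  by apply: measurableX; exact: measurable_itv.
by apply: (le_lt_trans h); rewrite mu_box ?ltry.
Qed.

Lemma That_pos : 0 < fine (mu (@That R)).
Proof.
pose S : set (R * R) := `[1/4, 1/3]%classic `*` `[1/4, 1/3]%classic.
have h : (mu S <= mu (@That R))%E.
  apply: le_measure; rewrite ?inE; [|exact: That_measurable|].
    by apply: measurableX; exact: measurable_itv.
  move=> x [/=]; rewrite !in_itv/= => /andP[x0 x1] /andP[y0 y1].
  by apply/ThatE; apply: ord3P; rewrite /lam /=; lra.
rewrite -lte_fin fineK; last by rewrite ge0_fin_numE ?That_finite.
apply: (lt_le_trans _ h); rewrite mu_box ?lte_fin; [|lra|lra].
by rewrite mulr_gt0//; lra.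
Qed.

Lemma That_nongeneric_null : mu.-negligible (@That R `\` @generic R).
Proof.
rewrite -[X in mu.-negligible X]image_id.
apply: (@image_nongeneric_null _ _ 1) => // x y _ _; rewrite !mul1r.
by rewrite lerDl lerDr.
Qed.

Lemma natr1V_gt0 (n : nat) : 0 < n.+1%:R^-1 :> R.
Proof. by rewrite invr_gt0 ltr0n. Qed.

Section OneBubble.
Variables (a b c g : R).
Let u := bubble a b c g.
Let W n := bubble_mol a b c g (n.+1%:R^-1).
Let Q := `|a| + `|b| + `|c| + `|g|.

Let aQ : `|a| <= Q. Proof. by rewrite /Q -!addrA lerDl !addr_ge0. Qed.
Let bQ : `|b| <= Q. Proof. by rewrite /Q -!addrA [`|a| + _]addrCA lerDl !addr_ge0. Qed.
Let cQ : `|c| <= Q. Proof. by rewrite /Q -addrA [X in _ <= X]addrCA lerDl !addr_ge0. Qed.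
Let gQ : `|g| <= Q. Proof. by rewrite /Q lerDr !addr_ge0. Qed.

(** The transport argument with the identity for both the map and its inverse; the images under the
    identity are rewritten away at the end. *)
Let setup : exists B1, [/\ 0 <= B1,
  weak_grad (@That R) u (broken_grad (@generic R) u),
  forall j x, That x -> `|broken_grad (@generic R) u x 0 j| <= B1
  & forall j, \int[mu]_(x in @That R) broken_grad (@generic R) u x 0 j = 0].
Proof.
have [L L0 ML] := min_mol_partial R.
have Q0 : 0 <= Q by rewrite !addr_ge0.
have [Bu Bu0 BuP] := compact_cont_bounded (@That_compact R) (@bubble_cont R a b c g).
have e1 : (fun x : pt R => x) @` @open_tri R = @open_tri R by exact: image_id.
have e2 : (fun x : pt R => x) @` @generic R = @generic R by exact: image_id.
have h1 : open ((fun x : pt R => x) @` @open_tri R) by rewrite e1; exact: open_tri_open.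
have h2 : (fun x : pt R => x) @` @open_tri R `<=` (@That R)° by rewrite e1; exact: open_tri_That.
have h3 i : smooth_on ((fun x : pt R => x) @` @open_tri R) (pcoord i \o (fun x : pt R => x)).
  by rewrite e1; apply/smooth_onP => n; exact: smoothn_coord.
have h4 (y : pt R) i j : ((fun x : pt R => x) @` @open_tri R) y -> `|partial j (pcoord i \o (fun x : pt R => x)) y| <= 1.
  by move=> _; rewrite (partial_coord i j y); case: eqP; rewrite ?normr1 ?normr0.
have h5 : mu.-negligible (@That R `\` (fun x : pt R => x) @` @generic R).
  by rewrite e2; exact: That_nongeneric_null.
have hc : continuous (fun x : pt R => x) by move=> x; exact: cvg_id.
have sW n k : smoothn k (@open_tri R) (W n) by apply: smoothn_bubble_mol; exact: open_tri_open.
have WB n x : open_tri x -> `|W n x| <= 70 * Q by move=> Tx; exact: (bubble_mol_bound (natr1V_gt0 n) aQ bQ cQ gQ Tx).2.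
have dWB n x j : open_tri x -> `|partial j (W n) x| <= (17 * L + 7) * Q.
  move=> Tx; apply: (bubble_mol_partial _ (natr1V_gt0 n) (ltW L0) aQ bQ cQ gQ _ Tx).
  by move=> i; apply: ML; exact: natr1V_gt0.
have Ws n x : open_tri x -> W n x != 0 -> forall i, n.+1%:R^-1 <= lam i x.
  by move=> _; apply: bubble_mol_supp; exact: natr1V_gt0.
have Ww x : generic x -> \forall n \near \oo, \forall y \near x, W n y = u y by exact: bubble_mol_near.
have mu_ : measurable_fun (@That R : set (R * R)) u.
  apply: measurable_funS (open_continuous_measurable_pt openT _) => //.
  by move=> x _; exact: bubble_cont.
have uB x : That x -> `|u x| <= Bu by exact: BuP.
have uw x : ((fun x : pt R => x) @` @generic R) x -> u x = u x by [].
have B10 : 0 <= (17 * L + 7) * Q by rewrite mulr_ge0//; lra.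
have B0 : 0 <= 70 * Q by rewrite mulr_ge0.
exists (2 * (1 * ((17 * L + 7) * Q))); split.
- by rewrite mul1r mulr_ge0.
- rewrite -e2; apply: (pull_weak That_measurable That_finite h1 h2 hc _ h3 _ h4 h5 B0 B10 sW WB dWB natr1V_gt0 Ws Ww mu_ uB uw) => //.
- rewrite -e2 => j x; apply: (pull_bound h1 hc _ h3 _ h4 B10 sW dWB natr1V_gt0 Ws Ww uw) => //.
- rewrite -e2 => j; apply: (pull_integral That_measurable That_finite h1 h2 hc _ h3 _ h4 h5 B10 sW dWB natr1V_gt0 Ws Ww uw) => //.
Qed.

Lemma bubble_weak : weak_grad (@That R) u (broken_grad (@generic R) u).
Proof. by have [B1 []] := setup. Qed.

Lemma bubble_grad_bound : exists B1, forall j x, That x -> `|broken_grad (@generic R) u x 0 j| <= B1.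
Proof. by have [B1 []] := setup; exists B1. Qed.

Lemma bubble_grad_integral j : \int[mu]_(x in @That R) broken_grad (@generic R) u x 0 j = 0.
Proof. by have [B1 []] := setup. Qed.

End OneBubble.

Lemma Vhat_bubbles (a b c g : 'I_2 -> R) :
  Vhat (fun x => \col_i bubble (a i) (b i) (c i) (g i) x).
Proof.
have E i : vcomp (fun x => \col_i bubble (a i) (b i) (c i) (g i) x) i = bubble (a i) (b i) (c i) (g i).
  by apply/funext => x; rewrite /vcomp mxE.
split=> [i|k i]; rewrite E; last exact: bubble_poly.
by eexists; exact: bubble_weak.
Qed.

Lemma sol_kappa_eq0 (qh : pt R -> R) (a b c : 'I_3 -> R) : Qhat0 qh ->
  (forall k x, (hull (ct (@ref_tri R) k))° x -> qh x = aff (a k) (b k) (c k) x) ->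
  sol_kappa a b c = 0.
Proof.
move=> [[[mq _] _] q0] qE.
set kp := sol_kappa a b c.
have w0 : weak_grad (@That R) (sol0 a b c) (broken_grad (@generic R) (sol0 a b c)) by exact: bubble_weak.
have w1 : weak_grad (@That R) (sol1 a b c) (broken_grad (@generic R) (sol1 a b c)) by exact: bubble_weak.
have i0 : \int[mu]_(x in @That R) broken_grad (@generic R) (sol0 a b c) x 0 o0 = 0 by exact: bubble_grad_integral.
have i1 : \int[mu]_(x in @That R) broken_grad (@generic R) (sol1 a b c) x 0 o1 = 0 by exact: bubble_grad_integral.
have [B0 b0] : exists B, forall j x, That x -> `|broken_grad (@generic R) (sol0 a b c) x 0 j| <= B by exact: bubble_grad_bound.
have [B1 b1] : exists B, forall j x, That x -> `|broken_grad (@generic R) (sol1 a b c) x 0 j| <= B by exact: bubble_grad_bound.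
set G0 := fun x => broken_grad (@generic R) (sol0 a b c) x 0 o0 in i0.
set G1 := fun x => broken_grad (@generic R) (sol1 a b c) x 0 o1 in i1.
have m0 : measurable_fun (@That R : set (R * R)) G0 by have [_ /(_ o0)[[]]] := w0.
have m1 : measurable_fun (@That R : set (R * R)) G1 by have [_ /(_ o1)[[]]] := w1.
have I0 : mu.-integrable (@That R) (EFin \o G0).
  by apply: (bounded_integrable That_measurable That_finite m0) => x; exact: b0.
have I1 : mu.-integrable (@That R) (EFin \o G1).
  by apply: (bounded_integrable That_measurable That_finite m1) => x; exact: b1.
have I01 : mu.-integrable (@That R) (EFin \o (fun x => G0 x + G1 x)).
  apply: (bounded_integrable (B := B0 + B1) That_measurable That_finite (measurable_funD m0 m1)) => x Tx.
  by rewrite (le_trans (ler_normD _ _))// lerD//; [exact: b0|exact: b1].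
have Ik : mu.-integrable (@That R) (EFin \o cst kp).
  by apply: (bounded_integrable (B := `|kp|) That_measurable That_finite).
(* Almost everywhere [qh] is the divergence plus [kp]. Since the divergence has integral zero, what
   remains is [kp] times the positive area of the triangle. *)
have key : \int[mu]_(x in @That R) qh x = \int[mu]_(x in @That R) ((G0 x + G1 x) + cst kp x).
  rewrite /Rintegral; congr fine; apply: ae_eq_integral => //.
  - exact: That_measurable.
  - exact/measurable_EFinP.
  - apply/measurable_EFinP; apply: measurable_funD => //; exact: measurable_funD.
  - apply: negligibleS That_nongeneric_null => x /= /not_implyP[Tx nx]; split=> // gx; apply: nx.
    have [k xk] := generic_ct gx.
    rewrite (qE k); last exact: ct_open_interior.
    have [u0x [u0y [u1x [u1y [d0 d1 E]]]]] := pd_sol a b c xk.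
    rewrite /G0 /G1 !mxE /patch mem_set// (pd0 d0) (pd1 d1) E /cst subrK//.
rewrite q0 RintegralD// in key; last exact: That_measurable.
rewrite RintegralD// in key; last exact: That_measurable.
rewrite i0 i1 !add0r Rintegral_cst in key; last exact: That_measurable.
move/esym/eqP : key; rewrite mulf_eq0 => /orP[/eqP//|/eqP h].
by have := That_pos; rewrite h ltxx.
Qed.

End ReferenceBubble.

(** * Quadratic elements *)

Section QuadraticMap.
Variable R : realType.
Local Notation o0 := (@ord0 1).
Local Notation o1 := (lift (@ord0 1) (@ord0 0)).
Local Notation e_ := (@Defs.basis R).
Local Notation mu := (@mu R).
Implicit Types (x y z : pt R) (c d : nat -> R).

Definition quad c x : R :=
  c 0%N + c 1%N * x.1 + c 2%N * x.2 + c 3%N * x.1 ^+ 2 + c 4%N * x.1 * x.2 + c 5%N * x.2 ^+ 2.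
Definition qx c : pt R -> R := aff (c 1%N) (2 * c 3%N) (c 4%N).
Definition qy c : pt R -> R := aff (c 2%N) (c 4%N) (2 * c 5%N).
Definition quad_map c d x : pt R := (quad c x, quad d x).
Definition jac c d x : R := qx c x * qy d x - qy c x * qx d x.
Definition mid x y : pt R := ((x.1 + y.1) / 2, (x.2 + y.2) / 2).

(** The midpoint rule is exact for quadratics. It gives F x - F y = DF(midpoint)(x - y) with the
    same point for both components, so one matrix can be inverted. *)
Lemma quad_mid c x y :
  quad c x - quad c y = qx c (mid x y) * (x.1 - y.1) + qy c (mid x y) * (x.2 - y.2).
Proof. by rewrite /quad /qx /qy /aff /mid /=; field. Qed.

Lemma pd_quad c x : pd (quad c) x (qx c x) (qy c x).
Proof.
have X := pd_coord0 x; have Y := pd_coord1 x.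
have K (s : R) := pd_cst s x.
have := pdD (pdD (pdD (pdD (pdD (K (c 0%N)) (pdM (K (c 1%N)) X)) (pdM (K (c 2%N)) Y))
  (pdM (K (c 3%N)) (pdM X X))) (pdM (pdM (K (c 4%N)) X) Y)) (pdM (K (c 5%N)) (pdM Y Y)).
by move=> h; apply: (pd_eq h); rewrite /qx /qy /aff /cst; ring.
Qed.

Lemma quad_cont c : continuous (quad c).
Proof.
move=> x; apply: differentiable_continuous.
have oT := @openT (pt R).
apply: (C1_differentiable oT (I : setT x) _ _).1.
  by move=> y i _; exact: pd_derivable (pd_quad c y).
have E0 : partial o0 (quad c) = qx c by apply/funext => y; exact: pd0 (pd_quad c y).
have E1 : partial o1 (quad c) = qy c by apply/funext => y; exact: pd1 (pd_quad c y).
by apply: ord2P; rewrite ?E0 ?E1; exact: aff_cont.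
Qed.

Lemma quad_map_cont c d : continuous (quad_map c d).
Proof. by move=> x; apply: continuous_pair; exact: quad_cont. Qed.

Lemma quad_lipschitz c : exists2 L : R, 0 < L & forall x y, That x -> That y ->
  `|quad c x - quad c y| <= L * (`|x.1 - y.1| + `|x.2 - y.2|).
Proof.
pose L := `|c 1%N| + `|2 * c 3%N| + `|c 4%N| + `|c 2%N| + `|2 * c 5%N| + 1.
have L0 : 0 < L by rewrite ltr_wpDl// !addr_ge0.
exists L => // x y /That_box[/=]; rewrite !in_itv/= => /andP[x0 x1] /andP[x2 x3].
move=> /That_box[/=]; rewrite !in_itv/= => /andP[y0 y1] /andP[y2 y3].
have affb (a b e : R) : `|aff a b e (mid x y)| <= `|a| + `|b| + `|e|.
  rewrite /aff /mid /= (le_trans (ler_normD _ _))// lerD//.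
    rewrite (le_trans (ler_normD _ _))// lerD// normrM ler_piMr// ger0_norm; lra.
  by rewrite normrM ler_piMr// ger0_norm; lra.
rewrite quad_mid (le_trans (ler_normD _ _))// !normrM mulrDr lerD// ler_wpM2r//.
  rewrite (le_trans (affb _ _ _))// /L.
  have := normr_ge0 (c 2%N); have := normr_ge0 (2 * c 5%N); lra.
rewrite (le_trans (affb _ _ _))// /L.
have := normr_ge0 (c 1%N); have := normr_ge0 (2 * c 3%N); lra.
Qed.

Section Bounds.
Variables (c d : nat -> R) (C0 c1 h : R).
Hypothesis C00 : 0 < C0.
Hypothesis c10 : 0 < c1.
Hypothesis h0 : 0 < h.
Hypothesis b1 : forall e x, e = c \/ e = d -> open_tri x -> `|qx e x| <= C0 * h /\ `|qy e x| <= C0 * h.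
Hypothesis bJ : forall x, open_tri x -> c1 * h ^+ 2 <= jac c d x.

Lemma jac_gt0 x : open_tri x -> 0 < jac c d x.
Proof. by move=> /bJ; apply: lt_le_trans; rewrite mulr_gt0// exprn_gt0. Qed.

Definition center : pt R := (3^-1, 3^-1).

(** The bounds on DF hold in the open triangle only. Midpoints with an interior point stay inside,
    so boundary points are reached as well. *)
Lemma mid_center x : That x -> open_tri (mid x center).
Proof.
move=> /ThatE h3; have := h3 ord0; have := h3 (lift ord0 ord0); have := h3 (lift ord0 (lift ord0 ord0)).
by rewrite /lam /= => p q s; apply: ord3P; rewrite /lam /mid /center /=; lra.
Qed.

Lemma image_box x : That x ->
  `|quad c x - quad c center| <= 2 * (C0 * h) /\ `|quad d x - quad d center| <= 2 * (C0 * h).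
Proof.
move=> Tx; have Mx := mid_center Tx.
have [/=] := That_box Tx; rewrite !in_itv/= => /andP[x0 x1] /andP[y0 y1].
have d1 : `|x.1 - center.1| <= 1 by rewrite /center /= ler_norml; apply/andP; split; lra.
have d2 : `|x.2 - center.2| <= 1 by rewrite /center /= ler_norml; apply/andP; split; lra.
have key e : e = c \/ e = d -> `|quad e x - quad e center| <= 2 * (C0 * h).
  move=> ecd; have [q1 q2] := b1 ecd Mx.
  rewrite quad_mid (le_trans (ler_normD _ _))// !normrM mulr_natl mulr2n.
  by rewrite lerD// -[X in _ <= X]mulr1 ler_pM.
by split; apply: key; [left|right].
Qed.

Lemma mu_image : (mu (quad_map c d @` @That R) <= ((4 * (C0 * h)) ^+ 2)%:E)%E.
Proof.
pose p := quad_map c d center; pose r := 2 * (C0 * h).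
pose S : set (R * R) := `[p.1 - r, p.1 + r]%classic `*` `[p.2 - r, p.2 + r]%classic.
have r0 : 0 < r by rewrite !mulr_gt0.
have -> : ((4 * (C0 * h)) ^+ 2)%:E = mu S.
  by rewrite mu_box; [congr EFin; rewrite /r; ring|lra|lra].
apply: le_measure; rewrite ?inE.
- apply: compact_measurable_pt; apply: continuous_compact; last exact: That_compact.
  by apply: continuous_subspaceT; exact: quad_map_cont.
- by apply: measurableX; exact: measurable_itv.
- move=> _ [x Tx <-]; have [h1 h2] := image_box Tx.
  by split; rewrite /= in_itv/= -ler_distl /p /=.
Qed.

(* The minimiser x of |F - y|^2 over the square around z lies in its interior; it is a critical point, and DF x is
   invertible, so F x = y. *)
Lemma box_in_image z (r : R) y : 0 < r ->
  (forall x, `|x.1 - z.1| <= r -> `|x.2 - z.2| <= r -> open_tri x) ->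
  `|y.1 - quad c z| <= c1 * h * r / (12 * C0) -> `|y.2 - quad d z| <= c1 * h * r / (12 * C0) ->
  exists x, [/\ `|x.1 - z.1| <= r, `|x.2 - z.2| <= r & quad_map c d x = y].
Proof.
move=> r0 zr y1 y2; set rho := c1 * h * r / (12 * C0) in y1 y2.
have rho0 : 0 < rho by rewrite divr_gt0// !mulr_gt0.
pose S : set (pt R) := `[z.1 - r, z.1 + r]%classic `*` `[z.2 - r, z.2 + r]%classic.
have SE x : S x <-> `|x.1 - z.1| <= r /\ `|x.2 - z.2| <= r.
  rewrite /S; split=> -[/=]; first by rewrite !in_itv/= -!ler_distl.
  by move=> h1 h2; split; rewrite /= in_itv/= -ler_distl.
have cS : compact S by apply: compact_setX; exact: segment_compact.
pose g x : R := (quad c x - y.1) ^+ 2 + (quad d x - y.2) ^+ 2.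
have pdg x : pd g x (2 * ((quad c x - y.1) * qx c x + (quad d x - y.2) * qx d x))
                    (2 * ((quad c x - y.1) * qy c x + (quad d x - y.2) * qy d x)).
  have k1 := pdD (pd_quad c x) (pd_cst (- y.1) x).
  have k2 := pdD (pd_quad d x) (pd_cst (- y.2) x).
  have k := pdD (pdM k1 k1) (pdM k2 k2).
  by apply: (pd_eq k); rewrite /cst; ring.
have cg : continuous g.
  move=> x.
  apply: (@continuousD _ _ _ (fun x => (quad c x - y.1) ^+ 2) (fun x => (quad d x - y.2) ^+ 2)).
    apply: (@continuous_comp _ _ _ (fun x => quad c x - y.1) (fun t : R => t ^+ 2)); last exact: exprn_continuous.
    by apply: continuousB; [exact: quad_cont|exact: cvg_cst].
  apply: (@continuous_comp _ _ _ (fun x => quad d x - y.2) (fun t : R => t ^+ 2)); last exact: exprn_continuous.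
    by apply: continuousB; [exact: quad_cont|exact: cvg_cst].
have S0 : S !=set0 by exists z; apply/SE; rewrite !subrr normr0 ltW.
have [x Sx xmin] := compact_EVT_min S0 cS (continuous_subspaceT cg).
rewrite inE in Sx.
have [x1 x2] := (SE x).1 Sx.
have Tx := zr x x1 x2.
have Tm : open_tri (mid x z).
  apply: zr; rewrite /mid /=.
    by rewrite (_ : (x.1 + z.1) / 2 - z.1 = (x.1 - z.1) / 2);
      [rewrite normrM [X in _ * X]ger0_norm ?invr_ge0//; have := normr_ge0 (x.1 - z.1); lra|field].
  by rewrite (_ : (x.2 + z.2) / 2 - z.2 = (x.2 - z.2) / 2);
      [rewrite normrM [X in _ * X]ger0_norm ?invr_ge0//; have := normr_ge0 (x.2 - z.2); lra|field].
have sqle (a : R) : `|a| <= rho -> a ^+ 2 <= rho ^+ 2.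
  by move=> ha; rewrite -(real_normK (num_real a)) ler_pXn2r// nnegrE ltW.
(* The minimum is compared with the value at the centre [z] of the square. *)
have gz : g x <= 2 * rho ^+ 2.
  apply: (@le_trans _ _ (g z)); first by apply: xmin; rewrite inE; apply/SE; rewrite !subrr normr0 ltW.
  rewrite /g mulr_natl mulr2n lerD//.
    by apply: sqle; rewrite distrC.
  by apply: sqle; rewrite distrC.
have sq (a b : R) : a ^+ 2 + b ^+ 2 <= 2 * rho ^+ 2 -> `|a| <= 2 * rho.
  move=> ab; have rho2 : 0 <= 2 * rho by rewrite mulr_ge0// ltW.
  rewrite -(ler_pXn2r (ltn0Sn 1)) ?nnegrE// (real_normK (num_real a)).
  have : 0 <= b ^+ 2 by rewrite sqr_ge0.
  have : 0 <= rho ^+ 2 by rewrite sqr_ge0.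
  by rewrite (_ : (2 * rho) ^+ 2 = 4 * rho ^+ 2); [lra|ring].
(* 2 rho from the minimality of [x] and rho from the distance of [y] to the image of [z]. *)
have a1 : `|quad c x - quad c z| <= 3 * rho.
  have := sq _ _ gz; have := y1 => u1 u2.
  by rewrite (le_trans (ler_distD y.1 _ _))//; lra.
have a2 : `|quad d x - quad d z| <= 3 * rho.
  have u2 : `|quad d x - y.2| <= 2 * rho by apply: (sq _ (quad c x - y.1)); rewrite addrC; exact: gz.
  by rewrite (le_trans (ler_distD y.2 _ _))//; lra.
have Jm := jac_gt0 Tm.
have [[m1 m2] [m3 m4]] := (b1 (or_introl (erefl c)) Tm, b1 (or_intror (erefl d)) Tm).
(* Cramer's rule for DF(mid x z)(x - z) = F x - F z. *)
have cramer1 : jac c d (mid x z) * (x.1 - z.1) =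
    qy d (mid x z) * (quad c x - quad c z) - qy c (mid x z) * (quad d x - quad d z).
  by rewrite !quad_mid /jac; ring.
have cramer2 : jac c d (mid x z) * (x.2 - z.2) =
    qx c (mid x z) * (quad d x - quad d z) - qx d (mid x z) * (quad c x - quad c z).
  by rewrite !quad_mid /jac; ring.
(* The factor 12 in [rho] is chosen here: 6 C0 h rho / (c1 h^2) = r / 2, so the minimiser stays off
   the boundary of the square. *)
have strict (t p q s w : R) : jac c d (mid x z) * t = p * q - s * w -> `|p| <= C0 * h -> `|s| <= C0 * h ->
    `|q| <= 3 * rho -> `|w| <= 3 * rho -> `|t| < r.
  move=> E p1 s1 q1 w1.
  have : `|jac c d (mid x z) * t| <= C0 * h * (3 * rho) + C0 * h * (3 * rho).
    by rewrite E (le_trans (ler_normB _ _))// !normrM lerD// ler_pM.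
  rewrite normrM (gtr0_norm Jm) => E2.
  have E3 : c1 * h ^+ 2 * `|t| <= c1 * h ^+ 2 * (r / 2).
    apply: (le_trans (_ : _ <= jac c d (mid x z) * `|t|)); first by rewrite ler_wpM2r// bJ.
    apply: (le_trans E2); rewrite le_eqVlt; apply/orP; left; apply/eqP.
    by rewrite /rho; field; rewrite gt_eqF.
  have : `|t| <= r / 2 by move: E3; rewrite ler_pM2l// mulr_gt0// exprn_gt0.
  by move: (`|t|) => t' ht; lra.
have sx1 : `|x.1 - z.1| < r by exact: strict cramer1 m4 m2 a1 a2.
have sx2 : `|x.2 - z.2| < r by exact: strict cramer2 m1 m3 a2 a1.
(* Fermat's theorem on the axis-parallel line through the minimiser. *)
have crit j : (\forall t \near (0 : R), S (x + t *: e_ j)) -> partial j g x = 0.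
  move=> /nbhs_ballP[e /= e0 eS].
  have dg (s : R) : is_derive s 1 (fun t : R => g (x + t *: e_ j)) (partial j g (x + s *: e_ j)).
    by apply: is_derive_line; exact: pd_derivable (pdg _).
  have e2 : - e <= e by lra.
  have [||t te|_ dE] := @derive1_at_min R (fun t : R => g (x + t *: e_ j)) (- e) e 0 e2.
  - by move=> t _; exact: (@ex_derive _ _ _ _ _ _ _ (dg t)).
  - by rewrite in_itv/= oppr_lt0 e0.
  - rewrite scale0r addr0; apply: xmin; rewrite inE; apply: eS.
    by rewrite -ball_normE /ball_/= sub0r normrN ltr_norml; move: te; rewrite in_itv.
  have := @derive_val _ _ _ _ _ _ _ (dg 0).
  by rewrite dE scale0r addr0.
have cont_line j : continuous (fun t : R => x + t *: e_ j).
  by move=> t; apply: cvgD; [exact: cvg_cst|apply: cvgZr_tmp; exact: cvg_id].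
have near_lt (f : pt R -> R) j : continuous f -> f x < r -> \forall t \near (0 : R), f (x + t *: e_ j) < r.
  move=> cf fx.
  have cc : f (x + t *: e_ j) @[t --> (0 : R)] --> f (x + 0 *: e_ j).
    exact: (@continuous_comp _ _ _ (fun t : R => x + t *: e_ j) f 0 (cont_line j 0) (cf _)).
  by apply: (cvgr_lt _ cc); rewrite scale0r addr0.
have cn1 : continuous (fun y : pt R => `|y.1 - z.1|).
  by move=> t; apply: cvg_norm; apply: cvgB; [exact: cvg_fst|exact: cvg_cst].
have cn2 : continuous (fun y : pt R => `|y.2 - z.2|).
  by move=> t; apply: cvg_norm; apply: cvgB; [exact: cvg_snd|exact: cvg_cst].
have nearS j : \forall t \near (0 : R), S (x + t *: e_ j).
  apply: filterS2 (near_lt _ j cn1 sx1) (near_lt _ j cn2 sx2) => t t1 t2.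
  by apply/SE; split; exact: ltW.
have E0 := crit o0 (nearS o0); have E1 := crit o1 (nearS o1).
rewrite (pd0 (pdg x)) in E0; rewrite (pd1 (pdg x)) in E1.
have Jx := jac_gt0 Tx.
(* [E0] and [E1] say that the transpose of DF x annihilates F x - y. Multiplying by the adjugate
   isolates [jac] times one component. *)
exists x; split=> //; apply: pt_eq => /=.
  have : jac c d x * (quad c x - y.1) * 2 = 0.
    transitivity (qy d x * 0 - qx d x * (0 : R)); last by rewrite !mulr0 subrr.
    by rewrite -{1}E0 -E1 /jac; ring.
  by move/eqP; rewrite !mulf_eq0 pnatr_eq0 orbF gt_eqF//= subr_eq0 => /eqP.
have : jac c d x * (quad d x - y.2) * 2 = 0.
  transitivity (qx c x * 0 - qy c x * (0 : R)); last by rewrite !mulr0 subrr.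
  by rewrite -{1}E1 -E0 /jac; ring.
by move/eqP; rewrite !mulf_eq0 pnatr_eq0 orbF gt_eqF//= subr_eq0 => /eqP.
Qed.

End Bounds.
End QuadraticMap.

(** * The Piola transform in coordinates *)

Section Weights.
Variable R : realType.
Local Notation o0 := (@ord0 1).
Local Notation o1 := (lift (@ord0 1) (@ord0 0)).
Implicit Types (x y z : pt R) (c d e : nat -> R).

(* Component of the Piola transform h^2 DF V / det DF, pulled back to the reference triangle; e is c or d. *)
Definition wt c d e (h : R) (V0 V1 : pt R -> R) x : R :=
  h ^+ 2 * ((qx e x * V0 x + qy e x * V1 x) * (jac c d x)^-1).

Definition jac_x c d x : R := qx c x * d 4%N + qy d x * (2 * c 3%N) - (qy c x * (2 * d 3%N) + qx d x * c 4%N).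
Definition jac_y c d x : R := qx c x * (2 * d 5%N) + qy d x * c 4%N - (qy c x * d 4%N + qx d x * (2 * c 5%N)).

Lemma pd_jac c d x : pd (jac c d) x (jac_x c d x) (jac_y c d x).
Proof.
have q1 := pd_aff (c 1%N) (2 * c 3%N) (c 4%N) x; have q2 := pd_aff (c 2%N) (c 4%N) (2 * c 5%N) x.
have q3 := pd_aff (d 1%N) (2 * d 3%N) (d 4%N) x; have q4 := pd_aff (d 2%N) (d 4%N) (2 * d 5%N) x.
have k := pdD (pdM q1 q4) (pdM (pd_cst (-1) x) (pdM q2 q3)).
have E : jac c d = (fun y => qx c y * qy d y + -1 * (qy c y * qx d y)) by apply/funext => y; rewrite /jac; ring.
by rewrite E; apply: (pd_eq k); rewrite /jac_x /jac_y /qx /qy /cst; ring.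
Qed.

Definition num e (V0 V1 : R) x : R := qx e x * V0 + qy e x * V1.

Lemma pd_wt c d e h (V0 V1 : pt R -> R) x a0 b0 a1 b1 : pd V0 x a0 b0 -> pd V1 x a1 b1 -> jac c d x != 0 ->
  pd (wt c d e h V0 V1) x
    (h ^+ 2 * (((num e a0 a1 x + (2 * e 3%N * V0 x + e 4%N * V1 x)) * jac c d x - num e (V0 x) (V1 x) x * jac_x c d x) / jac c d x ^+ 2))
    (h ^+ 2 * (((num e b0 b1 x + (e 4%N * V0 x + 2 * e 5%N * V1 x)) * jac c d x - num e (V0 x) (V1 x) x * jac_y c d x) / jac c d x ^+ 2)).
Proof.
move=> p0 p1 J0.
have q1 := pd_aff (e 1%N) (2 * e 3%N) (e 4%N) x; have q2 := pd_aff (e 2%N) (e 4%N) (2 * e 5%N) x.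
have k := pdM (pd_cst (h ^+ 2) x) (pdM (pdD (pdM q1 p0) (pdM q2 p1)) (pdV J0 (pd_jac c d x))).
by apply: (pd_eq k); rewrite /num /qx /qy /cst; field.
Qed.

(** The Piola identity: the divergence becomes the reference divergence over the Jacobian
    determinant, all second derivatives of F cancelling. The four equations make B the inverse of
    DF, as for the derivatives of the inverse map. *)
Lemma piola_trace c d (h : R) (V0 V1 : pt R -> R) x a0 b0 a1 b1 (B00 B01 B10 B11 : R) :
  pd V0 x a0 b0 -> pd V1 x a1 b1 -> jac c d x != 0 ->
  qx c x * B00 + qx d x * B01 = 1 -> qy c x * B00 + qy d x * B01 = 0 ->
  qx c x * B10 + qx d x * B11 = 0 -> qy c x * B10 + qy d x * B11 = 1 ->
  B00 * partial o0 (wt c d c h V0 V1) x + B10 * partial o1 (wt c d c h V0 V1) x +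
  (B01 * partial o0 (wt c d d h V0 V1) x + B11 * partial o1 (wt c d d h V0 V1) x) =
  h ^+ 2 * (a0 + b1) / jac c d x.
Proof.
move=> p0 p1 J0 E1 E2 E3 E4.
have K0 := pd_wt c h p0 p1 J0; have K1 := pd_wt d h p0 p1 J0.
rewrite (pd0 K0) (pd1 K0) (pd0 K1) (pd1 K1).
have B00E : B00 = qy d x / jac c d x.
  apply: (mulfI J0); rewrite mulrCA mulfV// mulr1.
  transitivity (qy d x * (qx c x * B00 + qx d x * B01) - qx d x * (qy c x * B00 + qy d x * B01)).
    by rewrite /jac; ring.
  by rewrite E1 E2 mulr1 mulr0 subr0.
have B01E : B01 = - qy c x / jac c d x.
  apply: (mulfI J0); rewrite mulrCA mulfV// mulr1.
  transitivity (qx c x * (qy c x * B00 + qy d x * B01) - qy c x * (qx c x * B00 + qx d x * B01)).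
    by rewrite /jac; ring.
  by rewrite E1 E2 mulr1 mulr0 sub0r.
have B10E : B10 = - qx d x / jac c d x.
  apply: (mulfI J0); rewrite mulrCA mulfV// mulr1.
  transitivity (qy d x * (qx c x * B10 + qx d x * B11) - qx d x * (qy c x * B10 + qy d x * B11)).
    by rewrite /jac; ring.
  by rewrite E3 E4 mulr1 mulr0 sub0r.
have B11E : B11 = qx c x / jac c d x.
  apply: (mulfI J0); rewrite mulrCA mulfV// mulr1.
  transitivity (qx c x * (qy c x * B10 + qy d x * B11) - qy c x * (qx c x * B10 + qx d x * B11)).
    by rewrite /jac; ring.
  by rewrite E3 E4 mulr1 mulr0 subr0.
rewrite B00E B01E B10E B11E /num /jac_x /jac_y.
(* The determinant is unfolded because the cancellation with [jac_x] and [jac_y] is not visible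
   while it is opaque. *)
have -> : jac c d x = qx c x * qy d x - qy c x * qx d x by [].
move: J0; have -> : jac c d x = qx c x * qy d x - qy c x * qx d x by [].
move: (qx c x) (qy c x) (qx d x) (qy d x) (V0 x) (V1 x) => f0 f1 g0 g1 v0 v1 J0.
by field.
Qed.

Lemma smoothn_wt n U c d e h (V0 V1 : pt R -> R) : open U -> (forall x, U x -> jac c d x != 0) ->
  smoothn n U V0 -> smoothn n U V1 -> smoothn n U (wt c d e h V0 V1).
Proof.
move=> oU J0 s0 s1.
have sa p q r : smoothn n U (aff p q r) by exact: smoothn_aff.
have sJ : smoothn n U (jac c d) by apply: smoothnB => //; apply: smoothnM => //; exact: sa.
apply: smoothnM => //; first exact: smoothn_cst.
apply: smoothnM => //; last exact: smoothnV.
by apply: smoothnD => //; apply: smoothnM => //; exact: sa.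
Qed.

Section WeightBounds.
Variables (c d : nat -> R) (C0 c1 h : R).
Hypothesis C00 : 0 < C0.
Hypothesis c10 : 0 < c1.
Hypothesis h0 : 0 < h.
Hypothesis b1 : forall e x, e = c \/ e = d -> open_tri x -> `|qx e x| <= C0 * h /\ `|qy e x| <= C0 * h.
Hypothesis b2 : forall e, e = c \/ e = d -> [/\ `|2 * e 3%N| <= C0 * h ^+ 2, `|e 4%N| <= C0 * h ^+ 2 & `|2 * e 5%N| <= C0 * h ^+ 2].
Hypothesis bJ : forall x, open_tri x -> c1 * h ^+ 2 <= jac c d x.

Variables (e : nat -> R) (V0 V1 : pt R -> R) (K : R) (x : pt R).
Hypothesis ecd : e = c \/ e = d.
Hypothesis Tx : open_tri x.
Hypothesis V0K : `|V0 x| <= K.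
Hypothesis V1K : `|V1 x| <= K.

Let K0 : 0 <= K. Proof. exact: le_trans V0K. Qed.

Lemma norm_sum2 (p q r s A B : R) : `|p| <= A -> `|q| <= B -> `|r| <= A -> `|s| <= B -> `|p * q + r * s| <= 2 * (A * B).
Proof. by move=> pA qB rA sB; rewrite (le_trans (ler_normD _ _))// !normrM mulr_natl mulr2n lerD// ler_pM. Qed.

Let num_bound u0 u1 : `|u0| <= K -> `|u1| <= K -> `|num e u0 u1 x| <= 2 * (C0 * h * K).
Proof. by move=> h1 h2; have [q1 q2] := b1 ecd Tx; exact: norm_sum2. Qed.

Let Jpos : 0 < c1 * h ^+ 2. Proof. by rewrite mulr_gt0// exprn_gt0. Qed.
Let J0 : 0 < jac c d x. Proof. exact: lt_le_trans Jpos (bJ Tx). Qed.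
Let JV : (jac c d x)^-1 <= (c1 * h ^+ 2)^-1. Proof. by rewrite lef_pV2 ?posrE// bJ. Qed.

Lemma wt_bound : `|wt c d e h V0 V1 x| <= 2 * C0 * h / c1 * K.
Proof.
rewrite /wt normrM [`|h ^+ 2|]normrX (gtr0_norm h0) normrM normfV (gtr0_norm J0) -/(num e (V0 x) (V1 x) x).
have nb := num_bound V0K V1K.
have -> : 2 * C0 * h / c1 * K = h ^+ 2 * (2 * (C0 * h * K) * (c1 * h ^+ 2)^-1).
  by field; rewrite !gt_eqF.
by rewrite ler_pM2l ?exprn_gt0// ler_pM// invr_ge0 ltW.
Qed.

Let jac_xy_bound : `|jac_x c d x| <= 4 * (C0 * h * (C0 * h ^+ 2)) /\ `|jac_y c d x| <= 4 * (C0 * h * (C0 * h ^+ 2)).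
Proof.
have [q1 q2] := b1 (or_introl (erefl c)) Tx; have [q3 q4] := b1 (or_intror (erefl d)) Tx.
have [r1 r2 r3] := b2 (or_introl (erefl c)); have [r4 r5 r6] := b2 (or_intror (erefl d)).
split; rewrite (le_trans (ler_normB _ _))//.
  by have := norm_sum2 q1 r5 q4 r1; have := norm_sum2 q2 r4 q3 r2; lra.
by have := norm_sum2 q1 r6 q4 r2; have := norm_sum2 q2 r5 q3 r3; lra.
Qed.

(** Quotient rule N'/J - N J'/J^2, where N = O(h), N' = O(h + h^2), J' = O(h^3) and J is at least c1
    h^2. The h^2 in N' and the whole of J' come from the second derivatives of the map. *)
Lemma wt_partial_bound a0 b0 a1 b1' j : pd V0 x a0 b0 -> pd V1 x a1 b1' ->
  `|a0| <= K -> `|b0| <= K -> `|a1| <= K -> `|b1'| <= K ->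
  `|partial j (wt c d e h V0 V1) x| <= (2 * C0 * (h + h ^+ 2) / c1 + 8 * C0 ^+ 3 * h ^+ 2 / c1 ^+ 2) * K.
Proof.
move=> p0 p1 a0K b0K a1K b1K.
have k := pd_wt e h p0 p1 (lt0r_neq0 J0).
have nb := num_bound V0K V1K.
have [s1 s2 s3] := b2 ecd.
have [jx jy] := jac_xy_bound.
have key (N N' J' : R) : `|N| <= 2 * (C0 * h * K) -> `|N'| <= 2 * (C0 * h * K) + 2 * (C0 * h ^+ 2 * K) ->
   `|J'| <= 4 * (C0 * h * (C0 * h ^+ 2)) ->
   `|h ^+ 2 * ((N' * jac c d x - N * J') / jac c d x ^+ 2)| <= (2 * C0 * (h + h ^+ 2) / c1 + 8 * C0 ^+ 3 * h ^+ 2 / c1 ^+ 2) * K.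
  move=> Nb N'b J'b.
  have -> : h ^+ 2 * ((N' * jac c d x - N * J') / jac c d x ^+ 2) =
    h ^+ 2 * (N' * (jac c d x)^-1 - N * J' * ((jac c d x)^-1 * (jac c d x)^-1)).
    by field; rewrite gt_eqF.
  have -> : (2 * C0 * (h + h ^+ 2) / c1 + 8 * C0 ^+ 3 * h ^+ 2 / c1 ^+ 2) * K =
    h ^+ 2 * ((2 * (C0 * h * K) + 2 * (C0 * h ^+ 2 * K)) * (c1 * h ^+ 2)^-1 +
       2 * (C0 * h * K) * (4 * (C0 * h * (C0 * h ^+ 2))) * ((c1 * h ^+ 2)^-1 * (c1 * h ^+ 2)^-1)).
    by field; rewrite !gt_eqF.
  have JV0 : 0 <= (jac c d x)^-1 by rewrite invr_ge0 ltW.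
  rewrite normrM normrX (gtr0_norm h0) ler_pM2l ?exprn_gt0// (le_trans (ler_normB _ _))//.
  rewrite !normrM (ger0_norm JV0) lerD// ler_pM// ?mulr_ge0//.
    by rewrite ler_pM.
  by rewrite ler_pM.
have nb2 u0 u1 s t : `|u0| <= K -> `|u1| <= K -> `|s| <= C0 * h ^+ 2 -> `|t| <= C0 * h ^+ 2 ->
   `|num e u0 u1 x + (s * V0 x + t * V1 x)| <= 2 * (C0 * h * K) + 2 * (C0 * h ^+ 2 * K).
  move=> h1 h2 sb tb; rewrite (le_trans (ler_normD _ _))// lerD//; first exact: num_bound.
  exact: norm_sum2.
by move: j; apply: ord2P; rewrite ?(pd0 k) ?(pd1 k); apply: key => //; exact: nb2.
Qed.

End WeightBounds.
End Weights.

Lemma Rintegral_sqr_ge d (X : measurableType d) (R : realType) (nu : {measure set X -> \bar R})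
    (T B : set X) (q : X -> R) (P A : R) : measurable T -> measurable B -> B `<=` T ->
  measurable_fun T q -> nu.-integrable T (fun x => (q x ^+ 2)%:E) -> 0 <= P ->
  {ae nu, forall x, B x -> P <= `|q x|} -> ((A ^+ 2)%:E <= nu B)%E ->
  P ^+ 2 * A ^+ 2 <= \int[nu]_(x in T) (q x ^+ 2).
Proof.
move=> mT mB BT mq iq P0 qP AB.
have mq2 : measurable_fun T (fun x => (q x ^+ 2)%:E).
  by apply/measurable_EFinP; exact: measurable_funX.
have h1 : (\int[nu]_(x in B) (q x ^+ 2)%:E <= \int[nu]_(x in T) (q x ^+ 2)%:E)%E.
  by apply: ge0_subset_integral => // x _; rewrite lee_fin sqr_ge0.
have h2 : (\int[nu]_(x in B) (P ^+ 2)%:E <= \int[nu]_(x in B) (q x ^+ 2)%:E)%E.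
  apply: ae_ge0_le_integral => //.
  - by move=> x _; rewrite lee_fin sqr_ge0.
  - by move=> x _; rewrite lee_fin sqr_ge0.
  - exact: measurable_funS mq2.
  - apply: filterS qP => x h Bx; rewrite lee_fin -(real_normK (num_real (q x))) ler_pXn2r// ?nnegrE//.
    exact: h.
have h3 : ((P ^+ 2 * A ^+ 2)%:E <= \int[nu]_(x in B) (P ^+ 2)%:E)%E.
  rewrite integral_cst// EFinM; apply: lee_wpmul2l => //.
  by rewrite lee_fin sqr_ge0.
have qfin := integrable_fin_num mT iq.
by rewrite -lee_fin /Rintegral fineK//; exact: le_trans h3 (le_trans h2 h1).
Qed.

(** * Comparison of norms with suprema and coefficients *)

Section NormEstimates.
Variable R : realType.
Local Notation mu := (@mu R).
Implicit Types (D T : set (pt R)) (f : pt R -> R).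

Lemma L2norm_sqr D f : L2norm D f ^+ 2 = \int[mu]_(x in D) (f x ^+ 2).
Proof. by rewrite sqr_sqrtr//; apply: Rintegral_ge0 => x _; exact: sqr_ge0. Qed.

Lemma L2norm_sqr_le D f (M S : R) : measurable (D : set (R * R)) -> (mu D <= S%:E)%E ->
  measurable_fun (D : set (R * R)) f -> 0 <= M -> (forall x, D x -> `|f x| <= M) ->
  L2norm D f ^+ 2 <= M ^+ 2 * S.
Proof.
move=> mD DS mf M0 fM.
have fD : (mu D < +oo)%E by apply: (le_lt_trans DS); rewrite ltry.
rewrite L2norm_sqr.
have i1 : mu.-integrable D (EFin \o (fun x => f x ^+ 2)) by have [_] := bounded_L2 mD fD mf fM.
have i2 : mu.-integrable D (EFin \o cst (M ^+ 2)).
  by apply: (bounded_integrable (B := `|M ^+ 2|) mD fD).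
apply: (@le_trans _ _ (\int[mu]_(x in D) (cst (M ^+ 2) x))).
  apply: le_Rintegral => // x Dx; rewrite -(real_normK (num_real (f x))) ler_pXn2r// ?nnegrE//.
  exact: fM.
rewrite Rintegral_cst//; apply: ler_wpM2l; first exact: sqr_ge0.
rewrite -lee_fin fineK; first exact: DS.
by rewrite ge0_fin_numE.
Qed.

(** Two components and four derivatives give six squares, rounded up to nine. *)
Lemma H1normv_le D (v : pt R -> 'cV[R]_2) (Dv : pt R -> 'M[R]_2) (M : R) :
  0 <= M -> (forall i, L2norm D (vcomp v i) ^+ 2 <= M ^+ 2) ->
  (forall i j, L2norm D (fun x => Dv x i j) ^+ 2 <= M ^+ 2) ->
  H1normv D v Dv <= 3 * M.
Proof.
move=> M0 h1 h2.
have e i j : L2norm D (fun x => row i (Dv x) 0 j) = L2norm D (fun x => Dv x i j).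
  by rewrite /L2norm; congr Num.sqrt; apply: eq_Rintegral => x _; rewrite mxE.
have h i : H1norm D (vcomp v i) (fun x => row i (Dv x)) ^+ 2 <= 3 * M ^+ 2.
  rewrite sqr_sqrtr; last by rewrite addr_ge0 ?sqr_ge0// sumr_ge0// => j _; exact: sqr_ge0.
  rewrite !big_ord_recl big_ord0 !e addr0.
  by have := h1 i; have := h2 i ord0; have := h2 i (lift ord0 ord0); lra.
have M3 : 0 <= 3 * M by rewrite mulr_ge0.
rewrite -(ler_pXn2r (ltn0Sn 1)) ?nnegrE ?sqrtr_ge0//.
rewrite sqr_sqrtr; last by apply: sumr_ge0 => i _; exact: sqr_ge0.
rewrite !big_ord_recl big_ord0 addr0.
have := h ord0; have := h (lift ord0 ord0).
have : 0 <= M ^+ 2 by exact: sqr_ge0.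
rewrite (_ : (3 * M) ^+ 2 = 9 * M ^+ 2); last by ring.
by move=> ? ? ?; lra.
Qed.

Lemma L2norm_ge T (B : set (pt R)) (q : pt R -> R) (P A : R) : measurable (T : set (R * R)) ->
  measurable (B : set (R * R)) -> B `<=` T -> in_L2 T q -> 0 <= P ->
  {ae mu, forall x, B x -> P <= `|q x|} -> ((A ^+ 2)%:E <= mu B)%E -> 0 <= A ->
  P * A <= L2norm T q.
Proof.
move=> mT mB BT [mq iq] P0 qP AB A0.
rewrite -(ler_pXn2r (ltn0Sn 1)) ?nnegrE ?sqrtr_ge0 ?mulr_ge0//.
rewrite L2norm_sqr exprMn; exact: (@Rintegral_sqr_ge _ _ R (lebesgue_measure \x lebesgue_measure)%E T B q P A mT mB BT mq iq P0 qP AB).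
Qed.

(** An affine function is determined by its values at three points in general position. P is the
    largest modulus among the points at distance 1/36, so |b| and |c| are at most 72 P and |a| at
    most 145 P. On the box of radius 1/288 around the maximal point the function varies by at most 2
    * 72 P / 288 = P / 2. *)
Lemma aff_lower (a b c z1 z2 : R) : 0 <= z1 <= 1 -> 0 <= z2 <= 1 ->
  exists dx dy P : R, [/\ [\/ dx = 0 /\ dy = 0, dx = 36^-1 /\ dy = 0 | dx = 0 /\ dy = 36^-1],
    0 <= P, [/\ `|a| <= 180 * P, `|b| <= 180 * P & `|c| <= 180 * P] &
    forall x, `|x.1 - (z1 + dx)| <= 288^-1 -> `|x.2 - (z2 + dy)| <= 288^-1 -> P / 2 <= `|aff a b c x|].
Proof.
move=> /andP[z10 z11] /andP[z20 z21].
pose p0 := a + b * z1 + c * z2.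
pose p1 := a + b * (z1 + 36^-1) + c * z2.
pose p2 := a + b * z1 + c * (z2 + 36^-1).
have key (dx dy P : R) : [\/ dx = 0 /\ dy = 0, dx = 36^-1 /\ dy = 0 | dx = 0 /\ dy = 36^-1] ->
   P = `|a + b * (z1 + dx) + c * (z2 + dy)| -> `|p0| <= P -> `|p1| <= P -> `|p2| <= P ->
   exists dx dy P : R, [/\ [\/ dx = 0 /\ dy = 0, dx = 36^-1 /\ dy = 0 | dx = 0 /\ dy = 36^-1],
    0 <= P, [/\ `|a| <= 180 * P, `|b| <= 180 * P & `|c| <= 180 * P] &
    forall x, `|x.1 - (z1 + dx)| <= 288^-1 -> `|x.2 - (z2 + dy)| <= 288^-1 -> P / 2 <= `|aff a b c x|].
  move=> hd PE h0 h1 h2; exists dx, dy, P.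
  have P0 : 0 <= P by rewrite PE.
  have bE : b = 36 * (p1 - p0) by rewrite /p1 /p0; field.
  have cE : c = 36 * (p2 - p0) by rewrite /p2 /p0; field.
  have bb : `|b| <= 72 * P.
    rewrite bE normrM ger0_norm//; have := ler_normB p1 p0; lra.
  have cb : `|c| <= 72 * P.
    rewrite cE normrM ger0_norm//; have := ler_normB p2 p0; lra.
  have bz : `|b * z1| <= 72 * P.
    by rewrite normrM (ger0_norm z10) (le_trans _ bb)// ler_piMr.
  have cz : `|c * z2| <= 72 * P.
    by rewrite normrM (ger0_norm z20) (le_trans _ cb)// ler_piMr.
  split=> //.
    split; [|lra|lra].
    have -> : a = p0 - b * z1 - c * z2 by rewrite /p0; ring.
    rewrite (le_trans (ler_normB _ _))//.
    have := ler_normB p0 (b * z1); lra.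
  move=> x x1 x2.
  have e1 : `|b * (x.1 - (z1 + dx))| <= 72 * P * 288^-1 by rewrite normrM ler_pM.
  have e2 : `|c * (x.2 - (z2 + dy))| <= 72 * P * 288^-1 by rewrite normrM ler_pM.
  have E : a + b * (z1 + dx) + c * (z2 + dy) = aff a b c x - (b * (x.1 - (z1 + dx)) + c * (x.2 - (z2 + dy))).
    by rewrite /aff; ring.
  have h3 : P <= `|aff a b c x| + (`|b * (x.1 - (z1 + dx))| + `|c * (x.2 - (z2 + dy))|).
    by rewrite PE E (le_trans (ler_normB _ _))// lerD2l ler_normD.
  lra.
have [h01|h01] := leP `|p0| `|p1|; have [h12|h12] := leP `|p1| `|p2|.
- apply: (key 0 36^-1 `|p2|) => //; [by apply: Or33|by rewrite addr0|exact: le_trans h01 h12].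
- by apply: (key 36^-1 0 `|p1|) => //; [apply: Or32|rewrite addr0|exact: ltW].
- have [h02|h02] := leP `|p0| `|p2|.
    by apply: (key 0 36^-1 `|p2|) => //; [apply: Or33|rewrite addr0].
  by apply: (key 0 0 `|p0|) => //; [apply: Or31|rewrite !addr0|exact: ltW|exact: ltW].
- by apply: (key 0 0 `|p0|) => //; [apply: Or31|rewrite !addr0|exact: ltW|exact: ltW (lt_trans h12 h01)].
Qed.

(* 1/36 and 1/288: small enough for the shifted boxes around the centroids to stay inside the open pieces. *)
Lemma ct_aff_lower (k : 'I_3) (a b c : R) : exists (z : pt R) (P : R), [/\ 0 <= P,
    [/\ `|a| <= 180 * P, `|b| <= 180 * P & `|c| <= 180 * P] &
    forall x, `|x.1 - z.1| <= 288^-1 -> `|x.2 - z.2| <= 288^-1 -> ct_open k x /\ P / 2 <= `|aff a b c x|].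
Proof.
have key (z1 z2 : R) : 0 <= z1 <= 1 -> 0 <= z2 <= 1 ->
    (forall dx dy : R, [\/ dx = 0 /\ dy = 0, dx = 36^-1 /\ dy = 0 | dx = 0 /\ dy = 36^-1] ->
     forall x, `|x.1 - (z1 + dx)| <= 288^-1 -> `|x.2 - (z2 + dy)| <= 288^-1 -> ct_open k x) ->
    exists (z : pt R) (P : R), [/\ 0 <= P,
    [/\ `|a| <= 180 * P, `|b| <= 180 * P & `|c| <= 180 * P] &
    forall x, `|x.1 - z.1| <= 288^-1 -> `|x.2 - z.2| <= 288^-1 -> ct_open k x /\ P / 2 <= `|aff a b c x|].
  move=> z1b z2b hz; have [dx [dy [P [hd P0 hb hx]]]] := aff_lower a b c z1b z2b.
  exists (z1 + dx, z2 + dy), P; split=> // x x1 x2; split; last exact: hx.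
  exact: (hz dx dy).
have T1 : 0 <= (1 / 9 : R) <= 1 by apply/andP; split; lra.
have T4 : 0 <= (4 / 9 : R) <= 1 by apply/andP; split; lra.
have near (p q dx dy x1 x2 : R) : [\/ dx = 0 /\ dy = 0, dx = 36^-1 /\ dy = 0 | dx = 0 /\ dy = 36^-1] ->
   `|x1 - (p + dx)| <= 288^-1 -> `|x2 - (q + dy)| <= 288^-1 ->
   [/\ p - 288^-1 <= x1, x1 <= p + 36^-1 + 288^-1, q - 288^-1 <= x2, x2 <= q + 36^-1 + 288^-1 & x1 + x2 <= p + q + 36^-1 + 144^-1].
  by rewrite !ler_norml => hd /andP[u1 u2] /andP[u3 u4]; case: hd => -[E1 E2]; rewrite E1 E2 in u1 u2 u3 u4; split; lra.
move: k key; apply: ord3P => key; [apply: (key (1/9) (4/9)) => //|apply: (key (4/9) (1/9)) => //|apply: (key (4/9) (4/9)) => //];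
  move=> dx dy hd x h1 h2; have [u1 u2 u3 u4 u5] := near _ _ _ _ _ _ hd h1 h2;
  (split; [by rewrite /lam /=; lra|by apply: ord3P; rewrite /lam //= => _; lra]).
Qed.

End NormEstimates.

Lemma det_mx22 (R : comRingType) (A : 'M[R]_2) :
  \det A = A ord0 ord0 * A (lift ord0 ord0) (lift ord0 ord0) - A ord0 (lift ord0 ord0) * A (lift ord0 ord0) ord0.
Proof.
rewrite (expand_det_row _ ord0) !big_ord_recl big_ord0 addr0 /cofactor !det_mx11 !mxE /=.
rewrite expr0 expr1 mul1r mulN1r mulrN; congr (_ * A _ _ - _ * A _ _); exact: val_inj.
Qed.

(** * The field on one element and its estimates *)

Section Element.
Variable R : realType.
Local Notation o0 := (@ord0 1).
Local Notation o1 := (lift (@ord0 1) (@ord0 0)).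
Local Notation e_ := (@Defs.basis R).
Local Notation mu := (@mu R).
Variables (C0 c1 c2 h : R) (F : pt R -> pt R) (c d : nat -> R).
Hypothesis C00 : 0 < C0.
Hypothesis c10 : 0 < c1.
Hypothesis h_ge0 : 0 <= h.
Hypothesis reg : regular_elt_map C0 c1 c2 h F.
Hypothesis Fq : forall x, That x -> F x = quad_map c d x.

Let cmp (i : 'I_2) : nat -> R := if i == ord0 then c else d.
Let T := elt F.
Let Psi := elt_inv F.
Let Fm := quad_map c d.
Let Omega := Fm @` @open_tri R.
Let O := Fm @` @generic R.

Let That_tri (x : pt R) : open_tri x -> That x.
Proof. by move=> /open_tri_That/interior_subset. Qed.

Let FqT : T = Fm @` @That R.
Proof. by apply/seteqP; split=> _ [x Tx <-]; exists x => //; rewrite Fq. Qed.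

Let FqOm : F @` @open_tri R = Omega.
Proof. by apply/seteqP; split=> _ [x Tx <-]; exists x => //; rewrite Fq//; exact: That_tri. Qed.

Let PsiK (x : pt R) : That x -> Psi (Fm x) = x.
Proof. by move=> Tx; rewrite /Fm -Fq//; have [_ + _ _] := rem_diffeo reg; exact. Qed.

Let Fint : F @` ((@That R)°) = T°.
Proof. by have [] := rem_diffeo reg. Qed.

Let OmT : Omega `<=` T°.
Proof. by rewrite -FqOm -Fint => _ [x Tx <-]; exists x => //; exact: open_tri_That. Qed.

Let smooth_Psi i : smooth_on T° (pcoord i \o Psi).
Proof. by have [_ _ _ /(_ i)[]] := rem_diffeo reg. Qed.

(** Near a point of [Omega] the inverse is continuous on the open set T°, so nearby points are
    images of points of the open triangle. *)
Let Omega_open : open Omega.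
Proof.
rewrite openE => y Oy; rewrite /interior.
have Ty := OmT Oy; have [x Tx xy] := Oy.
have cP : {for y, continuous Psi}.
  have -> : Psi = (fun y => ((pcoord o0 \o Psi) y, (pcoord o1 \o Psi) y)) by apply/funext => z; apply: pt_eq.
  by apply: continuous_pair; exact: (smooth_Psi _ [::] Ty).1.
have n1 : nbhs y T° by apply: open_nbhs_nbhs; split=> //; exact: open_interior.
have n2 : nbhs (Psi y) (@open_tri R).
  rewrite -xy PsiK; last exact: That_tri.
  by apply: open_nbhs_nbhs; split=> //; exact: open_tri_open.
have n3 := cP _ n2.
apply: filterS2 n1 n3 => z + Pz; rewrite -Fint => -[w Tw wz].
have Tw' := interior_subset Tw.
exists w; last by rewrite -wz Fq.
by move: Pz; rewrite /= -wz Fq// PsiK.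
Qed.

Let F_near x : open_tri x -> \forall y \near x, open_tri y /\ F y = Fm y.
Proof.
move=> Tx; have : nbhs x (@open_tri R) by apply: open_nbhs_nbhs; split=> //; exact: open_tri_open.
by apply: filterS => y Ty; split=> //; rewrite Fq//; exact: That_tri.
Qed.

Let pd_F i x : open_tri x -> pd (pcoord i \o F) x (qx (cmp i) x) (qy (cmp i) x).
Proof.
move=> Tx; apply: (@pd_near _ (quad (cmp i))); last exact: pd_quad.
apply: filterS (F_near Tx) => y [_ E]; rewrite /= E.
by move: i; apply: ord2P.
Qed.

Let partial2_F i x : open_tri x ->
  [/\ partials [:: o0; o0] (pcoord i \o F) x = 2 * cmp i 3%N,
      partials [:: o1; o0] (pcoord i \o F) x = cmp i 4%N
    & partials [:: o1; o1] (pcoord i \o F) x = 2 * cmp i 5%N].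
Proof.
move=> Tx.
have n0 : \forall y \near x, partial o0 (pcoord i \o F) y = qx (cmp i) y.
  by apply: filterS (F_near Tx) => y [Ty _]; exact: pd0 (pd_F i Ty).
have n1 : \forall y \near x, partial o1 (pcoord i \o F) y = qy (cmp i) y.
  by apply: filterS (F_near Tx) => y [Ty _]; exact: pd1 (pd_F i Ty).
have qX := pd_aff (cmp i 1%N) (2 * cmp i 3%N) (cmp i 4%N) x.
have qY := pd_aff (cmp i 2%N) (cmp i 4%N) (2 * cmp i 5%N) x.
rewrite /partials /=; split.
- by rewrite (near_eq_partial _ n0); exact: pd0 qX.
- by rewrite (near_eq_partial _ n0); exact: pd1 qX.
- by rewrite (near_eq_partial _ n1); exact: pd1 qY.
Qed.

Lemma Wsemi_le m (D : set (pt R)) (f : pt R -> pt R) (B : R) : (Wsemi m D f <= B%:E)%E ->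
  forall s i x, size s = m -> (D°) x -> `|partials s (pcoord i \o f) x| <= B.
Proof.
move=> WB s i x sm Dx; rewrite -lee_fin; apply: le_trans WB.
by apply: ereal_sup_ubound; exists s, i, x.
Qed.

Let center_tri : open_tri (center R).
Proof. by apply: ord3P; rewrite /lam /center /=; lra. Qed.

Let b1 : forall e x, e = c \/ e = d -> open_tri x -> `|qx e x| <= C0 * h /\ `|qy e x| <= C0 * h.
Proof.
have key i x : open_tri x -> `|qx (cmp i) x| <= C0 * h /\ `|qy (cmp i) x| <= C0 * h.
  move=> Tx; have W := Wsemi_le (rem_bound reg (isT : (1 <= 2)%N)).
  have P := pd_F i Tx.
  have := W [:: o0] i x erefl (open_tri_That Tx); have := W [:: o1] i x erefl (open_tri_That Tx).
  by rewrite /partials /= (pd0 P) (pd1 P) expr1 => ? ?; split.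
by move=> e x [->|->] Tx; [exact: (key o0)|exact: (key o1)].
Qed.

(** Second derivatives of a quadratic are constant, so their value at one interior point gives the
    coefficients. *)
Let b2 : forall e, e = c \/ e = d ->
  [/\ `|2 * e 3%N| <= C0 * h ^+ 2, `|e 4%N| <= C0 * h ^+ 2 & `|2 * e 5%N| <= C0 * h ^+ 2].
Proof.
have key i : [/\ `|2 * cmp i 3%N| <= C0 * h ^+ 2, `|cmp i 4%N| <= C0 * h ^+ 2 & `|2 * cmp i 5%N| <= C0 * h ^+ 2].
  have W := Wsemi_le (rem_bound reg (isT : (2 <= 2)%N)).
  have [E1 E2 E3] := partial2_F i center_tri.
  by rewrite -E1 -E2 -E3; split; apply: W => //; exact: open_tri_That.
by move=> e [->|->]; [exact: (key o0)|exact: (key o1)].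
Qed.

Let Jac_F x : open_tri x -> [/\ Jac F x o0 o0 = qx c x, Jac F x o0 o1 = qy c x, Jac F x o1 o0 = qx d x & Jac F x o1 o1 = qy d x].
Proof.
move=> Tx; have P0 := pd_F o0 Tx; have P1 := pd_F o1 Tx.
by rewrite /Jac !mxE (pd0 P0) (pd1 P0) (pd0 P1) (pd1 P1).
Qed.

Let det_F x : open_tri x -> \det (Jac F x) = jac c d x.
Proof. by move=> Tx; have [E1 E2 E3 E4] := Jac_F Tx; rewrite det_mx22 E1 E2 E3 E4. Qed.

Let bJ x : open_tri x -> c1 * h ^+ 2 <= jac c d x.
Proof. by move=> Tx; rewrite -det_F//; have [] := rem_det reg (open_tri_That Tx). Qed.

(** For h = 0 the bound on DF would give two distinct interior points the same image, against the
    inverse. *)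
Let h_gt0 : 0 < h.
Proof.
rewrite lt_neqAle h_ge0 andbT; apply/negP => /eqP h0.
pose p : pt R := (1 / 4, 1 / 4).
have pT : open_tri p by apply: ord3P; rewrite /lam /p /=; lra.
have Tm : open_tri (mid p (center R)) by apply: mid_center; exact: That_tri.
have q0 e : e = c \/ e = d -> quad e p = quad e (center R).
  move=> ecd; have [] := b1 ecd Tm; rewrite -h0 mulr0 !normr_le0 => /eqP E1 /eqP E2.
  by apply/eqP; rewrite -subr_eq0 quad_mid E1 E2 !mul0r addr0.
have E : Fm p = Fm (center R).
  by apply: pt_eq => /=; apply: q0; [left|right].
have := congr1 Psi E; rewrite !PsiK; [|exact: That_tri|exact: That_tri].
by move=> /(congr1 fst) /=; lra.
Qed.

Let mT : measurable (T : set (R * R)).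
Proof.
rewrite FqT; apply: compact_measurable_pt; apply: continuous_compact; last exact: That_compact.
by apply: continuous_subspaceT; exact: quad_map_cont.
Qed.

Let muT : (mu T <= ((4 * (C0 * h)) ^+ 2)%:E)%E.
Proof. by rewrite FqT; exact: (mu_image C00 h_gt0 b1). Qed.

Let muTfin : (mu T < +oo)%E.
Proof. by apply: (le_lt_trans muT); rewrite ltry. Qed.

Let nO : mu.-negligible (T `\` O).
Proof.
have [L1 L10 L1P] := quad_lipschitz c; have [L2 L20 L2P] := quad_lipschitz d.
have N : mu.-negligible (Fm @` (@That R `\` @generic R)).
  apply: (@image_nongeneric_null _ _ (L1 + L2)); first exact: addr_gt0.
  move=> x y Tx Ty; have s0 : 0 <= `|x.1 - y.1| + `|x.2 - y.2| by rewrite addr_ge0.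
  split.
    by rewrite (le_trans (L1P x y Tx Ty))// ler_wpM2r// lerDl ltW.
  by rewrite (le_trans (L2P x y Tx Ty))// ler_wpM2r// lerDr ltW.
apply: negligibleS N => y [+ nOy]; rewrite FqT => -[x Tx xy]; exists x => //; split=> // gx.
by apply: nOy; exists x.
Qed.

Let smooth_Psi_Om i : smooth_on Omega (pcoord i \o Psi).
Proof. by move=> s x Ox; apply: smooth_Psi; exact: OmT. Qed.

Let dPsi y i j : Omega y -> `|partial j (pcoord i \o Psi) y| <= C0 / h.
Proof.
move=> Oy; have W := Wsemi_le (rem_bound_inv reg (isT : (1 <= 3)%N)).
by have := W [:: j] i y erefl (OmT Oy); rewrite expr1.
Qed.

(* Differentiating Psi (Fm x) = x. *)
Let chain i j x : open_tri x ->
  partial j (quad c) x * partial o0 (pcoord i \o Psi) (Fm x) +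
  partial j (quad d) x * partial o1 (pcoord i \o Psi) (Fm x) = (i == j)%:R.
Proof.
move=> Tx; have Ox : Omega (Fm x) by exists x.
have s1 : smoothn 1 Omega (pcoord i \o Psi) by move: (smooth_Psi_Om i) => /smooth_onP.
have D := @is_derive_comp2 R Omega (pcoord i \o Psi) Fm x (e_ j) Omega_open Ox
  (fun y k Oy => (smoothn_base s1 Oy).2 k)
  (fun k => (smoothn_base (s1.2 k : smoothn 0 Omega (partial k (pcoord i \o Psi))) Ox).1).
have dF k : derivable (pcoord k \o Fm) x (e_ j).
  by move: k; apply: ord2P; [exact: pd_derivable (pd_quad c x)|exact: pd_derivable (pd_quad d x)].
have <- := @derive_val _ _ _ _ _ _ _ (D dF).
rewrite -(partial_coord i j x); apply: near_eq_partial.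
by apply: filterS (F_near Tx) => y [Ty _]; rewrite /= PsiK//; exact: That_tri.
Qed.

Lemma elt_coef_bound (q qh : pt R -> R) k a b e : in_L2 T q ->
  {ae mu, forall x, T x -> q x = qh (Psi x)} ->
  (forall x, (hull (ct (@ref_tri R) k))° x -> qh x = aff a b e x) ->
  let Q := 180 * 12 * 288 * C0 / c1 / h * L2norm T q in [/\ `|a| <= Q, `|b| <= Q & `|e| <= Q].
Proof.
move=> qL2 qae qhE Q.
have [z [P [P0 [aP bP eP] box]]] := ct_aff_lower k a b e.
pose r : R := 288^-1.
pose rho := c1 * h * r / (12 * C0).
have r0 : 0 < r by rewrite /r invr_gt0 ltr0n.
have rho0 : 0 < rho by rewrite divr_gt0// !mulr_gt0//; exact: h_gt0.
have rle t : t - rho <= t + rho by rewrite lerD2l (le_trans _ (ltW rho0))// oppr_le0 ltW.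
pose p := quad_map c d z.
pose B : set (R * R) := `[p.1 - rho, p.1 + rho]%classic `*` `[p.2 - rho, p.2 + rho]%classic.
have tri x : `|x.1 - z.1| <= r -> `|x.2 - z.2| <= r -> open_tri x.
  by move=> x1 x2; have [/ct_open_tri] := box x x1 x2.
have Bim y : B y -> exists x, [/\ ct_open k x, Fm x = y & P / 2 <= `|aff a b e x|].
  move=> [/=]; rewrite !in_itv/= -!ler_distl => y1 y2.
  have [x [x1 x2 xy]] := box_in_image C00 c10 h_gt0 b1 bJ r0 tri y1 y2.
  by have [] := box x x1 x2; exists x.
have BT : B `<=` T.
  move=> y /Bim[x [xk <- _]]; rewrite FqT; exists x => //.
  by apply: That_tri; exact: ct_open_tri xk.
have mB : measurable B by apply: measurableX; exact: measurable_itv.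
have BA : (((2 * rho) ^+ 2)%:E <= mu B)%E.
  have -> : ((2 * rho) ^+ 2)%:E = mu B; last by [].
  by rewrite mu_box; [congr EFin; ring|exact: rle|exact: rle].
have qB : {ae mu, forall x, B x -> P / 2 <= `|q x|}.
  apply: negligibleS qae => y /= /not_implyP[By nP] /(_ (BT _ By)) qy; apply: nP.
  have [x [xk xy Px]] := Bim y By.
  rewrite qy -xy PsiK ?qhE//; first exact: ct_open_interior.
  by apply: That_tri; exact: ct_open_tri xk.
have P20 : 0 <= P / 2 by rewrite divr_ge0.
have rho2 : 0 <= 2 * rho by rewrite mulr_ge0// ltW.
have lower := L2norm_ge mT mB BT qL2 P20 qB BA rho2.
(* The square in the image has side 2 rho with rho = c1 h / (12 * 288 * C0), and |q| is at least P /
   2 on it almost everywhere; this is the origin of the constant 180 * 12 * 288. *)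
have PQ : 180 * P <= Q.
  have -> : 180 * P = 180 / rho * (P / 2 * (2 * rho)).
    by field; rewrite gt_eqF.
  have -> : Q = 180 / rho * L2norm T q.
    by rewrite /Q /rho /r; field; rewrite !gt_eqF.
  by apply: ler_wpM2l lower; apply: mulr_ge0; [exact: ler0n|rewrite invr_ge0 ltW].
by split; apply: le_trans PQ.
Qed.

Variables (ak bk ck : 'I_3 -> R) (Qm : R).
Hypothesis Qa : forall k, `|ak k| <= Qm.
Hypothesis Qb : forall k, `|bk k| <= Qm.
Hypothesis Qc : forall k, `|ck k| <= Qm.

Variable (L : R).
Hypothesis L0 : 0 < L.
Hypothesis ML : forall e x j, 0 < e -> `|partial j (@min_mol R e) x| <= L.

(** 77 = 70 + 7, so that K dominates both the bound 70 on the values and the bound 17 L + 7 on the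
    derivatives; 10 Qm bounds the coefficients of the solution. *)
Let K : R := (17 * L + 77) * (10 * Qm).
Let kp := sol_kappa ak bk ck.
Let g0 := sol_g0 bk ck.
Let g1 := sol_g1 bk ck.
Let dl := sol_delta bk ck.
Let mol0 (n : nat) := bubble_mol (ak ord0 - kp) (bk ord0 - dl - 2 * g0) (ck ord0) g0 (n.+1%:R^-1).
Let mol1 (n : nat) := bubble_mol (ak (lift ord0 ord0) - kp) (bk (lift ord0 ord0)) (ck (lift ord0 ord0) - dl - 2 * g1) g1 (n.+1%:R^-1).

Definition elt_weight (i : 'I_2) : pt R -> R := wt c d (cmp i) h (sol0 ak bk ck) (sol1 ak bk ck).
Let W (i : 'I_2) (n : nat) : pt R -> R := wt c d (cmp i) h (mol0 n) (mol1 n).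

(** Zero off [O], where neither the inverse map nor the weight is under control; the part of the
    element left out is negligible. *)
Definition elt_field : pt R -> 'cV[R]_2 := fun y => \col_i ((elt_weight i \o Psi) \_ O) y.

Definition elt_jac : pt R -> 'M[R]_2 := fun y => \matrix_(i, j) broken_grad O (vcomp elt_field i) y 0 j.

Let Qm0 : 0 <= Qm. Proof. exact: le_trans (Qa ord0). Qed.

Let mol_bounds n x : open_tri x -> [/\ `|mol0 n x| <= K, `|mol1 n x| <= K,
  forall j, `|partial j (mol0 n) x| <= K & forall j, `|partial j (mol1 n) x| <= K].
Proof.
move=> Tx; have [[s1 s2 s3 s4] [s5 s6 s7 s8]] := sol_bound Qa Qb Qc.
have n0 := @natr1V_gt0 R n.
have K1 : 70 * (10 * Qm) <= K by apply: ler_wpM2r; [rewrite mulr_ge0|have := L0; lra].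
have K2 : (17 * L + 7) * (10 * Qm) <= K by apply: ler_wpM2r; [rewrite mulr_ge0|have := L0; lra].
have ML' j : `|partial j (@min_mol R n.+1%:R^-1) x| <= L by exact: ML.
split.
- exact: le_trans (bubble_mol_bound n0 s1 s2 s3 s4 Tx).2 K1.
- exact: le_trans (bubble_mol_bound n0 s5 s6 s7 s8 Tx).2 K1.
- by move=> j; exact: le_trans (bubble_mol_partial _ n0 (ltW L0) s1 s2 s3 s4 ML' Tx) K2.
- by move=> j; exact: le_trans (bubble_mol_partial _ n0 (ltW L0) s5 s6 s7 s8 ML' Tx) K2.
Qed.

Let cmp_cd i : cmp i = c \/ cmp i = d.
Proof. by rewrite /cmp; case: ifP; [left|right]. Qed.

Let Jn0 x : open_tri x -> jac c d x != 0.
Proof. by move=> Tx; rewrite gt_eqF// (jac_gt0 c10 h_gt0 bJ Tx). Qed.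

Let sW i n k : smoothn k (@open_tri R) (W i n).
Proof.
have oT := @open_tri_open R.
apply: smoothn_wt => //; exact: smoothn_bubble_mol.
Qed.

Let BW : R := 2 * C0 * h / c1 * K.
Let BdW : R := (2 * C0 * (h + h ^+ 2) / c1 + 8 * C0 ^+ 3 * h ^+ 2 / c1 ^+ 2) * K.

Let WB i n x : open_tri x -> `|W i n x| <= BW.
Proof.
move=> Tx; have [m0 m1 _ _] := mol_bounds n Tx.
exact: (wt_bound c10 h_gt0 b1 bJ (cmp_cd i) Tx m0 m1).
Qed.

Let dWB i n x j : open_tri x -> `|partial j (W i n) x| <= BdW.
Proof.
move=> Tx; have [m0 m1 p0 p1] := mol_bounds n Tx.
have D0 : pd (mol0 n) x (partial o0 (mol0 n) x) (partial o1 (mol0 n) x).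
  by apply: pd_partial => k; exact: (smoothn_base (smoothn_bubble_mol 0 _ _ _ _ _ openT) I).2.
have D1 : pd (mol1 n) x (partial o0 (mol1 n) x) (partial o1 (mol1 n) x).
  by apply: pd_partial => k; exact: (smoothn_base (smoothn_bubble_mol 0 _ _ _ _ _ openT) I).2.
exact: (wt_partial_bound c10 h_gt0 b1 b2 bJ (cmp_cd i) Tx m0 m1 j D0 D1).
Qed.

Let e_gt0 n : 0 < n.+1%:R^-1 :> R. Proof. exact: natr1V_gt0. Qed.

Let Wsupp i n x : open_tri x -> W i n x != 0 -> forall k, n.+1%:R^-1 <= lam k x.
Proof.
move=> Tx Wn; have [m0|m0] := eqVneq (mol0 n x) 0; last exact: bubble_mol_supp m0.
have [m1|m1] := eqVneq (mol1 n x) 0; last exact: bubble_mol_supp m1.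
by move: Wn; rewrite /W /wt m0 m1 !mulr0 addr0 mul0r mulr0 eqxx.
Qed.

Let Ww i x : generic x -> \forall n \near \oo, \forall y \near x, W i n y = elt_weight i y.
Proof.
move=> gx; have n0 := bubble_mol_near (ak ord0 - kp) (bk ord0 - dl - 2 * g0) (ck ord0) g0 gx.
have n1 := bubble_mol_near (ak (lift ord0 ord0) - kp) (bk (lift ord0 ord0)) (ck (lift ord0 ord0) - dl - 2 * g1) g1 gx.
apply: filterS2 n0 n1 => n; apply: filterS2 => y E0 E1.
by rewrite /W /elt_weight /wt /mol0 /mol1 E0 E1.
Qed.

Let gen_tri (x : pt R) : generic x -> open_tri x. Proof. by case. Qed.

Let weight_bound i x : generic x -> `|elt_weight i x| <= BW.
Proof.
move=> gx; have [n _ /(_ n (leqnn n)) E] := Ww i gx.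
by rewrite -(nbhs_singleton E) WB//; exact: gen_tri.
Qed.

Let K0 : 0 <= K.
Proof.
apply: mulr_ge0; last by apply: mulr_ge0 => //; exact: Qm0.
by rewrite addr_ge0// mulr_ge0// ltW.
Qed.

Let BW0 : 0 <= BW.
Proof.
have hh := ltW h_gt0; have cc := ltW C00; have ic : 0 <= c1^-1 by rewrite invr_ge0 ltW.
by apply: mulr_ge0; [rewrite !mulr_ge0|exact: K0].
Qed.

Let BdW0 : 0 <= BdW.
Proof.
have hh := ltW h_gt0; have cc := ltW C00; have ic : 0 <= c1^-1 by rewrite invr_ge0 ltW.
apply: mulr_ge0; last exact: K0.
by rewrite addr_ge0// !mulr_ge0// ?addr_ge0 ?exprn_ge0// invr_ge0 exprn_ge0// ltW.
Qed.

Let cF : continuous Fm. Proof. exact: quad_map_cont. Qed.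

Let FK (x : pt R) : open_tri x -> Psi (Fm x) = x.
Proof. by move=> /That_tri; exact: PsiK. Qed.

Let beta0 : 0 <= C0 / h. Proof. by rewrite divr_ge0 ?ltW. Qed.

Let O_open : open O.
Proof. exact: (Fm_generic_open Omega_open FK smooth_Psi_Om). Qed.

Let uE i : vcomp elt_field i = (elt_weight i \o Psi) \_ O.
Proof. by apply/funext => y; rewrite /vcomp mxE. Qed.

Let uw i y : O y -> vcomp elt_field i y = elt_weight i (Psi y).
Proof. by move=> Oy; rewrite uE /patch mem_set. Qed.

Let OPsi y : O y -> generic (Psi y) /\ Fm (Psi y) = y.
Proof. by move=> [x gx <-]; rewrite FK//; exact: gen_tri. Qed.

Let uB i y : T y -> `|vcomp elt_field i y| <= BW.
Proof.
move=> _; have [Oy|Oy] := pselect (O y).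
  by rewrite uw// weight_bound//; have [] := OPsi Oy.
by rewrite uE /patch memNset// normr0.
Qed.

Let mu_ i : measurable_fun (T : set (R * R)) (vcomp elt_field i).
Proof.
rewrite uE.
have mO : measurable_fun (O : set (R * R)) (elt_weight i \o Psi).
  apply: open_continuous_measurable_pt; first exact: O_open.
  move=> y Oy; have [gy yE] := OPsi Oy.
  have Omy : Omega y by exists (Psi y) => //; exact: gen_tri.
  have cP : {for y, continuous Psi}.
    have -> : Psi = (fun y => ((pcoord o0 \o Psi) y, (pcoord o1 \o Psi) y)) by apply/funext => z; apply: pt_eq.
    by apply: continuous_pair; exact: (smooth_Psi_Om _ [::] Omy).1.
  apply: continuous_comp; first exact: cP.
  have [n _ /(_ n (leqnn n)) En] := Ww i gy.
  have E1 := nbhs_singleton En.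
  have c1' := (smoothn_base (sW i n 0) (gen_tri gy)).1.
  have c2' : elt_weight i z @[z --> Psi y] --> W i n (Psi y).
    by apply: cvg_trans c1'; apply: near_eq_cvg.
  by move: c2'; rewrite E1.
have H := (measurable_restrictT _ (open_measurable_pt O_open)).1 mO.
exact: (measurable_funS measurableT (@subsetT _ _) H).
Qed.

Let elt_weak1 i : weak_grad T (vcomp elt_field i) (broken_grad O (vcomp elt_field i)).
Proof.
exact: (pull_weak mT muTfin Omega_open OmT cF FK smooth_Psi_Om beta0 dPsi nO BW0 BdW0
  (sW i) (WB i) (dWB i) e_gt0 (Wsupp (i := i)) (Ww i) (mu_ i) (uB i) (uw i)).
Qed.

Let elt_H10 i : in_H10 T (vcomp elt_field i).
Proof.
exact: (pull_H10 mT muTfin Omega_open OmT cF FK smooth_Psi_Om beta0 dPsi nO BW0 BdW0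
  (sW i) (WB i) (dWB i) e_gt0 (Wsupp (i := i)) (Ww i) (mu_ i) (uB i) (uw i)).
Qed.

Let elt_bound i j x : T x -> `|broken_grad O (vcomp elt_field i) x 0 j| <= 2 * (C0 / h * BdW).
Proof.
exact: (pull_bound Omega_open cF FK smooth_Psi_Om beta0 dPsi BdW0 (sW i) (dWB i) e_gt0 (Wsupp (i := i)) (Ww i) (uw i)).
Qed.

Lemma elt_field_weak_jac : weak_jac T elt_field elt_jac.
Proof.
move=> i; rewrite (_ : (fun x => row i (elt_jac x)) = broken_grad O (vcomp elt_field i)); first exact: elt_weak1.
by apply/funext => x; apply/rowP => j; rewrite !mxE.
Qed.


(** The factor h^2 is moved into the bubble coefficients, so that the reference field is again a
    pair of bubbles. *)
Let elt_field_piola : exists2 vh, Vhat vh &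
  forall x, generic x -> elt_field (Fm x) = piola F x *m vh x.
Proof.
exists (fun x => \col_i bubble
    (h ^+ 2 * (if i == ord0 then ak ord0 - kp else ak (lift ord0 ord0) - kp))
    (h ^+ 2 * (if i == ord0 then bk ord0 - dl - 2 * g0 else bk (lift ord0 ord0)))
    (h ^+ 2 * (if i == ord0 then ck ord0 else ck (lift ord0 ord0) - dl - 2 * g1))
    (h ^+ 2 * (if i == ord0 then g0 else g1)) x); first exact: Vhat_bubbles.
move=> x gx; have Tx := gen_tri gx.
have bub t a b e g : bubble (t * a) (t * b) (t * e) (t * g) x = t * bubble a b e g x.
  by rewrite /bubble /aff; ring.
have Ox : O (Fm x) by exists x.
apply/colP => i; have E := uw i Ox; rewrite /vcomp FK// in E; rewrite E.
rewrite mxE !big_ord_recl big_ord0 /piola det_F// !mxE /= !bub -/(sol0 ak bk ck x) -/(sol1 ak bk ck x).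
have := Jn0 Tx; move: i E; apply: ord2P => _ Jx; rewrite /elt_weight /wt /cmp /=.
  rewrite (pd0 (pd_F o0 Tx)) (pd1 (pd_F o0 Tx)) -/(sol0 ak bk ck x) -/(sol1 ak bk ck x) /cmp /=.
  by field.
rewrite (pd0 (pd_F o1 Tx)) (pd1 (pd_F o1 Tx)) -/(sol0 ak bk ck x) -/(sol1 ak bk ck x) /cmp /=.
by field.
Qed.

Lemma elt_field_V0 : in_V0 F elt_field.
Proof.
split; last exact: elt_H10.
split; first by move=> i; exists (broken_grad O (vcomp elt_field i)); exact: elt_weak1.
have [vh Vvh vhE] := elt_field_piola; exists vh => //.
apply: negligibleS nO => y /= /not_implyP[Ty ny]; split=> // Oy; apply: ny.
by have [gy yE] := OPsi Oy; rewrite -{1}yE vhE.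
Qed.

Lemma elt_field_trace (q qh : pt R -> R) : Qhat0 qh ->
  (forall k x, (hull (ct (@ref_tri R) k))° x -> qh x = aff (ak k) (bk k) (ck k) x) ->
  {ae mu, forall x, T x -> q x = qh (Psi x)} ->
  {ae mu, forall x, T x -> \tr (elt_jac x) = h ^+ 2 * q x / \det (Jac F (Psi x))}.
Proof.
move=> qh0 qhE qae; have kp0 := sol_kappa_eq0 qh0 qhE.
have key x : generic x -> \tr (elt_jac (Fm x)) = h ^+ 2 * qh x / jac c d x.
  move=> gx; have Tx := gen_tri gx; have [k xk] := generic_ct gx.
  have [u0x [u0y [u1x [u1y [d0 d1 E]]]]] := pd_sol ak bk ck xk.
  rewrite (qhE k); last exact: ct_open_interior.
  rewrite kp0 subr0 in E; rewrite -E.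
  have pg i j := pull_grad Omega_open FK smooth_Psi_Om (sW i) (Ww i) (uw i) j gx.
  have ch i j := chain i j Tx.
  have c0 := pd_quad c x; have c1' := pd_quad d x.
  have h00 := ch o0 o0; have h01 := ch o0 o1; have h10 := ch o1 o0; have h11 := ch o1 o1.
  rewrite (pd0 c0) (pd0 c1') in h00 h10; rewrite (pd1 c0) (pd1 c1') in h01 h11.
  have PT := piola_trace h d0 d1 (Jn0 Tx) h00 h01 h10 h11.
  rewrite /mxtrace !big_ord_recl big_ord0 addr0 /elt_jac mxE [in X in _ + X]mxE.
  by rewrite !pg; exact: PT.
(* Two exceptional sets: the images of non-generic points, and the points where q differs from its
   reference representative. *)
apply: (negligibleS _ (negligibleU nO qae)) => y /= /not_implyP[Ty ny].
have [Oy|Oy] := pselect (O y); [right|by left; split].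
move=> /(_ Ty) qy; apply: ny; have [gy yE] := OPsi Oy.
by rewrite -{1}yE key// qy det_F//; exact: gen_tri.
Qed.

Variable (h0 : R).
Hypothesis hh0 : h <= h0.

(** The factor 1/h from the inverse map cancels the side 4 C0 h of the square containing T, and one
    h splits off from the bound on the weights. Only nonnegative powers of h remain inside the
    parenthesis, so h may be replaced there by [h0]. *)
Lemma elt_field_norm : H1normv T elt_field elt_jac <=
  (30 * (17 * L + 77) * (8 * C0 ^+ 2) * (h0 / c1 + 2 * C0 * (1 + h0) / c1 + 8 * C0 ^+ 3 * h0 / c1 ^+ 2)) * (h * Qm).
Proof.
pose S := 4 * (C0 * h).
have S0 : 0 <= S by rewrite !mulr_ge0// ltW.
pose M1 := BW * S; pose M2 := 2 * (C0 / h * BdW) * S.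
have D0 : 0 <= 2 * (C0 / h * BdW) by apply: mulr_ge0 => //; apply: mulr_ge0; [exact: beta0|exact: BdW0].
have M10 : 0 <= M1 by apply: mulr_ge0; [exact: BW0|].
have M20 : 0 <= M2 by apply: mulr_ge0.
have M0 : 0 <= M1 + M2 by rewrite addr_ge0.
have n1 i : L2norm T (vcomp elt_field i) ^+ 2 <= (M1 + M2) ^+ 2.
  apply: (le_trans (L2norm_sqr_le mT muT (mu_ i) BW0 (uB i))); rewrite -exprMn -/M1.
  by rewrite ler_pXn2r ?nnegrE// lerDl.
have n2 i j : L2norm T (fun x => elt_jac x i j) ^+ 2 <= (M1 + M2) ^+ 2.
  have -> : (fun x => elt_jac x i j) = (fun x => broken_grad O (vcomp elt_field i) x 0 j).
    by apply/funext => x; rewrite mxE.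
  have [_ /(_ j)[[mg _] _]] := elt_weak1 i.
  apply: (le_trans (L2norm_sqr_le mT muT mg D0 (elt_bound i j))); rewrite -exprMn -/M2.
  by rewrite ler_pXn2r ?nnegrE// lerDr.
apply: (le_trans (H1normv_le M0 n1 n2)).
have -> : 3 * (M1 + M2) = (30 * (17 * L + 77) * (8 * C0 ^+ 2) * (h / c1 + 2 * C0 * (1 + h) / c1 + 8 * C0 ^+ 3 * h / c1 ^+ 2)) * (h * Qm).
  by rewrite /M1 /M2 /BW /BdW /K /S; field; rewrite !gt_eqF//; exact: h_gt0.
have hQ : 0 <= h * Qm by rewrite mulr_ge0//; exact: Qm0.
have L77 : 0 <= 17 * L + 77 by rewrite addr_ge0// mulr_ge0// ltW.
have C0' := ltW C00; have ic : 0 <= c1^-1 by rewrite invr_ge0 ltW.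
have ic2 : 0 <= (c1 ^+ 2)^-1 by rewrite invr_ge0 exprn_ge0// ltW.
apply: ler_wpM2r => //; apply: ler_wpM2l; first by rewrite !mulr_ge0// exprn_ge0.
apply: lerD; [apply: lerD|].
- by apply: ler_wpM2r.
- by apply: ler_wpM2r => //; apply: ler_wpM2l; [rewrite mulr_ge0|rewrite lerD2l].
- by apply: ler_wpM2r => //; apply: ler_wpM2l => //; rewrite mulr_ge0// exprn_ge0.
Qed.

End Element.

(** * From the mesh to a single element *)

Section Mesh.
Variable R : realType.
Local Notation i0 := (@ord0 2).
Local Notation i1 := (lift (@ord0 2) (@ord0 1)).
Local Notation i2 := (lift (@ord0 2) (lift (@ord0 1) (@ord0 0))).
Implicit Types (K : triangle R) (G : pt R -> pt R).

Lemma aff_mapE K x : aff_map K x =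
  ((K i2).1 + ((K i0).1 - (K i2).1) * x.1 + ((K i1).1 - (K i2).1) * x.2,
   (K i2).2 + ((K i0).2 - (K i2).2) * x.1 + ((K i1).2 - (K i2).2) * x.2).
Proof.
have -> : i2 = inord 2 by apply: val_inj; rewrite /= inordK.
have -> : i1 = inord 1 by apply: val_inj; rewrite /= inordK.
have -> : i0 = inord 0 by apply: val_inj; rewrite /= inordK.
by rewrite /aff_map; apply: pt_eq; rewrite /= /GRing.scale /=; ring.
Qed.

Lemma aff_map_hull K x : That x -> hull K (aff_map K x).
Proof.
move=> /ThatE Tx; rewrite hullE aff_mapE; exists (fun i => lam i x); split=> //.
- by rewrite /lam /=; ring.
- by rewrite /lam /=; ring.
- by rewrite /lam /=; ring.
Qed.

Lemma elt_map_quad G K : (forall i, poly_on 2 (hull K) (pcoord i \o G)) ->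
  exists c d, forall x, That x -> elt_map G K x = quad_map c d x.
Proof.
move=> GP.
have key i : exists c, forall x, That x -> pcoord i (elt_map G K x) = quad c x.
  have [c00 [c10 [c01 [c20 [c11 [c02 E]]]]]] := (poly2P _ _).1 (GP i).
  pose A0 := (K i2).1; pose A1 := (K i0).1 - (K i2).1; pose A2 := (K i1).1 - (K i2).1.
  pose B0 := (K i2).2; pose B1 := (K i0).2 - (K i2).2; pose B2 := (K i1).2 - (K i2).2.
  (* Coefficients of 1, x, y, x^2, xy, y^2, in the order of [quad], after substituting the affine
     map. *)
  exists (nth 0 [:: c00 + c10 * A0 + c01 * B0 + c20 * A0 ^+ 2 + c11 * A0 * B0 + c02 * B0 ^+ 2;
    c10 * A1 + c01 * B1 + 2 * c20 * A0 * A1 + c11 * (A0 * B1 + A1 * B0) + 2 * c02 * B0 * B1;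
    c10 * A2 + c01 * B2 + 2 * c20 * A0 * A2 + c11 * (A0 * B2 + A2 * B0) + 2 * c02 * B0 * B2;
    c20 * A1 ^+ 2 + c11 * A1 * B1 + c02 * B1 ^+ 2;
    2 * c20 * A1 * A2 + c11 * (A1 * B2 + A2 * B1) + 2 * c02 * B1 * B2;
    c20 * A2 ^+ 2 + c11 * A2 * B2 + c02 * B2 ^+ 2]) => x Tx.
  rewrite [LHS](E _ (aff_map_hull K Tx)).
  by rewrite aff_mapE /= -/A0 -/A1 -/A2 -/B0 -/B1 -/B2 /quad /=; ring.
have [c cE] := key ord0; have [d dE] := key (lift ord0 ord0).
by exists c, d => x Tx; apply: pt_eq; [exact: cE|exact: dE].
Qed.

(** A set without supremum has [sup] equal to 0, so neither boundedness nor nonemptiness has to be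
    checked. *)
Lemma ediam_ge0 (D : set (pt R)) : 0 <= ediam D.
Proof.
rewrite /ediam; set S := [set r | _].
have [[[r Sr] bS]|/sup_out -> //] := pselect (has_sup S).
apply: (@le_trans _ _ r); last exact: ub_le_sup.
by have [x [y [_ _ ->]]] := Sr; exact: sqrtr_ge0.
Qed.

Lemma ediam_mesh_size (M : set (triangle R)) K : finite_set M -> M K -> ediam (hull K) <= mesh_size M.
Proof.
move=> fM MK; apply: ub_le_sup; last by exists K.
have /compact_bounded [N [_ NB]] : compact [set ediam (hull K) | K in M].
  by apply: finite_compact; exact: finite_image.
exists (N + 1) => r Sr; apply: le_trans (ler_norm r) _.
by apply: (NB (N + 1)) => //; rewrite ltrDl.
Qed.

End Mesh.

Theorem theorem3p9 (R : realType) (sigma C0 c1 c2 h0 : R)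
    (sigma_gt0 : 0 < sigma) (C0_gt0 : 0 < C0) (c1_gt0 : 0 < c1)
    (c2_gt0 : 0 < c2) (h0_gt0 : 0 < h0) :
  exists2 C : R, 0 < C &
    forall (M : set (triangle R)) (G : pt R -> pt R),
      isoparametric_mesh sigma C0 c1 c2 M G -> mesh_size M <= h0 ->
      forall K : triangle R, M K ->
        let F := elt_map G K in
        let T := elt F in
        let hT := ediam (hull K) in
        forall q : pt R -> R, in_Q0 F q ->
          exists (v : pt R -> 'cV[R]_2) (Dv : pt R -> 'M[R]_2),
            [/\ in_V0 F v,
                weak_jac T v Dv,
                {ae @mu R, forall x, T x ->
                   \tr (Dv x) = hT ^+ 2 * q x / \det (Jac F (elt_inv F x))}
              & H1normv T v Dv <= C * L2norm T q].
Proof.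
have [L L0 ML] := min_mol_partial R.
(* [A] comes from the norm of the field in terms of the coefficients, [B] from the bound of the
   coefficients by q; the mesh enters neither. *)
pose A := 30 * (17 * L + 77) * (8 * C0 ^+ 2) * (h0 / c1 + 2 * C0 * (1 + h0) / c1 + 8 * C0 ^+ 3 * h0 / c1 ^+ 2).
pose B := 180 * 12 * 288 * C0 / c1.
have L77 : 0 < 17 * L + 77 by rewrite addr_gt0// mulr_gt0.
have ic : 0 < c1^-1 by rewrite invr_gt0.
have ic2 : 0 < (c1 ^+ 2)^-1 by rewrite invr_gt0 exprn_gt0.
have h1 : 0 < 1 + h0 by rewrite addr_gt0.
have A0 : 0 < A.
  by apply: mulr_gt0; [rewrite !mulr_gt0// exprn_gt0|rewrite !addr_gt0// !mulr_gt0// exprn_gt0].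
have B0 : 0 < B by apply: mulr_gt0 ic; apply: mulr_gt0 C0_gt0; rewrite -!natrM ltr0n !muln_gt0.
exists (A * B); first exact: mulr_gt0.
move=> M G iM Mh0 K MK F T hT q [qL2 [qh qh0 qE]].
have [[fM _ _] _ _ Gq Freg] := iM.
have [c [d Fq]] := elt_map_quad (Gq K MK).
have hT0 : 0 <= hT by exact: ediam_ge0.
have hTh0 : hT <= h0 by exact: le_trans (ediam_mesh_size fM MK) Mh0.
have reg : regular_elt_map C0 c1 c2 hT F := Freg K MK.
(* The affine coefficients of [qh] are chosen on the three pieces at once. *)
have [coef coefE] : exists coef : 'I_3 -> R * R * R, forall k x, (hull (ct (@ref_tri R) k))° x ->
    qh x = aff (coef k).1.1 (coef k).1.2 (coef k).2 x.
  have [[_ qP] _] := qh0.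
  have ex k : exists t : R * R * R, forall x, (hull (ct (@ref_tri R) k))° x -> qh x = aff t.1.1 t.1.2 t.2 x.
    by have [a [b [e E]]] := poly1P (qP k); exists (a, b, e).
  by exists (fun k => sval (cid (ex k))) => k; exact: svalP (cid (ex k)).
pose Q := B / hT * L2norm T q.
have QB k : [/\ `|(coef k).1.1| <= Q, `|(coef k).1.2| <= Q & `|(coef k).2| <= Q].
  exact: (elt_coef_bound C0_gt0 c1_gt0 hT0 reg Fq qL2 qE (coefE k)).
have Qa k : `|(coef k).1.1| <= Q by have [] := QB k.
have Qb k : `|(coef k).1.2| <= Q by have [] := QB k.
have Qc k : `|(coef k).2| <= Q by have [] := QB k.
pose a k := (coef k).1.1; pose b k := (coef k).1.2; pose e k := (coef k).2.
exists (elt_field hT F c d a b e), (elt_jac hT F c d a b e); split.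
- exact: (elt_field_V0 C0_gt0 c1_gt0 hT0 reg Fq Qa Qb Qc L0 ML).
- exact: (elt_field_weak_jac C0_gt0 c1_gt0 hT0 reg Fq Qa Qb Qc L0 ML).
- exact: (elt_field_trace c1_gt0 hT0 reg Fq qh0 coefE qE).
- apply: (le_trans (elt_field_norm C0_gt0 c1_gt0 hT0 reg Fq Qa Qb Qc L0 ML hTh0)).
  rewrite -/A -mulrA; apply: ler_wpM2l; first exact: ltW.
  (* Cancelling [hT] against the division in [Q] needs it nonzero; at zero the left side
     vanishes. *)
  have [->|hTn] := eqVneq hT 0; first by rewrite mul0r mulr_ge0 ?sqrtr_ge0// ltW.
  by rewrite (_ : hT * Q = B * L2norm T q)//; rewrite /Q; field.
Qed.
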